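(* Let $q\ge 0$, $\gamma\ge 0$, and $h(x)=e^{-\gamma x}x^{-q}$ with $E[h(\tilde\mu(\mathbb X))]<\infty$, where $\tilde\mu$ is a completely random measure with intensity $\nu(dx,ds)=\eta(dx)\rho_x(ds)$. Let $\tilde\mu_t$ be the tilted completely random measure with parameters $\nu$ and $h$, and $\tilde G_t=\tilde\mu_t/\tilde\mu_t(\mathbb X)$. Let $n\ge1$ and let $X_1,\dots,X_{n+1}$ be, conditionally on $\tilde G_t$, i.i.d. with distribution $\tilde G_t$; write $\mathbf X_n=\{X_1,\dots,X_n\}=\{Y_1,\dots,Y_{\aleph(\mathbf p_n)},\mathbf p_n\}$ with cluster sizes $n_1,\dots,n_{\aleph(\mathbf p_n)}$. Let $U_n$ be the augmenting variable, and $f_{U_n|\mathbf X_n}$ its conditional density given $\mathbf X_n$, both as given in the context. Then: 1. The predictive distribution of $X_{n+1}$ given $\mathbf X_n$ is $$\mathbb P\{X_{n+1}\in dx\mid\mathbf X_n\}=\frac{\omega_{n,\aleph(\mathbf p_n)+1}(x)}{\phi(\mathbf X_n)}\eta(dx)+\sum_{k=1}^{\aleph(\mathbf p_n)}\frac{\omega_{n,k}(Y_k)}{\phi(\mathbf X_n)}\delta_{Y_k}(dx),$$ where $$\phi(\mathbf X_n)=\int_{\mathbb X}\omega_{n,\aleph(\mathbf p_n)+1}(x)\eta(dx)+\sum_{k=1}^{\aleph(\mathbf p_n)}\omega_{n,k}(Y_k),\qquad \omega_{n,\aleph(\mathbf p_n)+1}(x)=\int_0^\infty u\,\tau_{1,x}(\gamma+u)f_{U_n|\mathbf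 X_n}(u)\,du,$$ $$\omega_{n,k}(Y_k)=\int_0^\infty u\,\frac{\tau_{n_k+1,Y_k}(\gamma+u)}{\tau_{n_k,Y_k}(\gamma+u)}f_{U_n|\mathbf X_n}(u)\,du,\qquad k=1,\dots,\aleph(\mathbf p_n).$$ 2. There is an auxiliary positive random variable $\tilde U_n$ (on a possibly enlarged probability space) whose conditional density given $\mathbf X_n$ is $$f_{\tilde U_n|\mathbf X_n}(u)=\frac{\phi(u,\mathbf X_n)}{E[\phi(U_n,\mathbf X_n)\mid\mathbf X_n]}f_{U_n|\mathbf X_n}(u),\qquad u>0,$$ and such that the predictive distribution of $X_{n+1}$ given $\mathbf X_n$, conditional on $\tilde U_n$, is $$\mathbb P\{X_{n+1}\in dx\mid\mathbf X_n,\tilde U_n\}=\frac{\omega_{n,\aleph(\mathbf p_n)+1}(\tilde U_n,x)}{\phi(\tilde U_n,\mathbf X_n)}\eta(dx)+\sum_{k=1}^{\aleph(\mathbf p_n)}\frac{\omega_{n,k}(\tilde U_n,Y_k)}{\phi(\tilde U_n,\mathbf X_n)}\delta_{Y_k}(dx),$$ where $$\phi(u,\mathbf X_n)=\int_{\mathbb X}\omega_{n,\aleph(\mathbf p_n)+1}(u,x)\eta(dx)+\sum_{k=1}^{\aleph(\mathbf p_n)}\omega_{n,k}(u,Y_k),\qquad \omega_{n,\aleph(\mathbf p_n)+1}(u,x)=u\,\tau_{1,x}(\gamma+u),$$ $$\omega_{n,k}(u,Y_k)=u\,\frac{\tau_{n_k+1,Y_k}(\gamma+u)}{\tau_{n_k,Y_k}(\gamma+u)},\qquad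 k=1,\dots,\aleph(\mathbf p_n).$$ 3. In addition, $$\phi(\mathbf X_n)=E[\phi(U_n,\mathbf X_n)\mid\mathbf X_n]=n+q,$$ $$\omega_{n,\aleph(\mathbf p_n)+1}(x)=E[\omega_{n,\aleph(\mathbf p_n)+1}(U_n,x)\mid\mathbf X_n],\qquad \omega_{n,k}(Y_k)=E[\omega_{n,k}(U_n,Y_k)\mid\mathbf X_n],\quad k=1,\dots,\aleph(\mathbf p_n).$$
   Context: Let $\mathbb X$ be a Polish space with Borel $\sigma$-field $\mathcal B(\mathbb X)$, and let $\mathcal M_{\mathbb X}$ be the space of boundedly finite measures on $\mathbb X$ (finite on bounded Borel sets), with the Borel $\sigma$-field $\mathcal B(\mathcal M_{\mathbb X})$ of its weak convergence topology. Intensity: $\eta$ is a non-atomic probability measure on $\mathbb X$, $x\mapsto\rho_x$ is a measurable family of $\sigma$-finite measures on $(0,\infty)$, and $\nu(dx,ds)=\eta(dx)\rho_x(ds)$ satisfies $\int_{(0,\infty)}\min\{y,s\}\,\nu(A,dy)<\infty$ for every bounded $A\in\mathcal B(\mathbb X)$ and $s>0$, and $\nu(\{x\},(0,\infty))=0$ for all $x$. The completely random measure $\tilde\mu$ with intensity (parameter measure) $\nu$ is $\tilde\mu(A)=\int_{(0,\infty)}y\,N(A,dy)$, where $N$ is a Poisson random measure on $\mathbb X\times(0,\infty)$ with intensity $\nu$; its law on $\mathcal M_{\mathbb X}$ is $\mathcal P_{\tilde\mu}$. Standing assumption: $0<\tilde\mu(\mathbb X)<\infty$ almost surely. Tilting: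 for a positive Borel function $h$ with $E[h(\tilde\mu(\mathbb X))]<\infty$, the tilted completely random measure $\tilde\mu_t$ with parameters $\nu,h$ is a random measure with law $$\mathcal P_{\tilde\mu_t}(A)=\frac{1}{E[h(\tilde\mu(\mathbb X))]}\int_A h(\mu(\mathbb X))\,\mathcal P_{\tilde\mu}(d\mu),\quad A\in\mathcal B(\mathcal M_{\mathbb X}),$$ and $\tilde G_t(\cdot)=\tilde\mu_t(\cdot)/\tilde\mu_t(\mathbb X)$. Functions: $\tau_{m,z}(a)=\int_{(0,\infty)}s^m e^{-sa}\rho_z(ds)$ for $m>0$, $z\in\mathbb X$, $a\ge0$; $\psi_a(b)=\int_{\mathbb X}\int_{(0,\infty)}(1-e^{-bs})e^{-as}\rho_x(ds)\,\eta(dx)$. Augmenting variable: $U_n$ is a positive random variable which, conditionally on $\tilde\mu_t$, is independent of $\mathbf X_n$ and has the gamma distribution with shape $n+q$ and rate $\tilde T_t:=\tilde\mu_t(\mathbb X)$; that is, if $\tilde T_t$ has density $f_{\tilde T_t}$, then $(\tilde T_t,U_n)$ has joint density $\frac{u^{n+q-1}e^{-uy}y^{n+q}}{\Gamma(n+q)}f_{\tilde T_t}(y)$ for $u,y>0$. Its conditional density given $\mathbf X_n$ is $$f_{U_n|\mathbf X_n}(u)=\frac{e^{-\psi_0(\gamma+u)}\prod_{k=1}^{\aleph(\mathbf p_n)}\tau_{n_k,Y_k}(\gamma+u)\,u^{n+q-1}}{\int_0^\infty e^{-\psi_0(\gamma+v)}\prod_{k=1}^{\aleph(\mathbf p_n)}\tau_{n_k,Y_k}(\gamma+v)\,v^{n+q-1}\,dv},\quad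 u>0.$$ Partition notation: $Y_1,\dots,Y_{\aleph(\mathbf p_n)}$ are the distinct values among $X_1,\dots,X_n$, $\mathbf p_n=\{C_1,\dots,C_{\aleph(\mathbf p_n)}\}$ is the partition of $\{1,\dots,n\}$ with $C_k=\{i: X_i=Y_k\}$, $\aleph(\mathbf p_n)$ is its number of cells, and $n_k$ is the number of elements of $C_k$. $\delta_a$ is the Dirac measure at $a$. Conditional statements hold almost surely. *)

(* Defs.v *)
From HB Require Import structures.
From mathcomp Require Import all_boot all_order all_algebra.
From mathcomp Require Import all_classical all_reals all_analysis.
From mathcomp Require Import measurable_realfun.

Set Implicit Arguments.
Unset Strict Implicit.
Unset Printing Implicit Defensive.

Import Order.TTheory GRing.Theory Num.Theory.
Import numFieldNormedType.Exports.

Local Open Scope classical_set_scope.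
Local Open Scope ring_scope.
Local Open Scope ereal_scope.

(* A Polish space is a complete separable metric space: "boundedly finite"
   refers to a metric, so the metric is part of the data.  The library's
   [Complete] comes with a point, so the space is nonempty. *)
#[short(type="completeMetricType")]
HB.structure Definition CompleteMetric (R : numDomainType) :=
  {T of Complete T & Metric R T}.

Definition separable (T : topologicalType) : Prop :=
  exists2 D : set T, countable D & dense D.

Notation borel X := (g_sigma_algebraType (@open X)).

Definition mbounded (R : realType) (X : metricType R) (A : set X) : Prop :=
  exists (x : X) (r : R), A `<=` ball x r.

Definition nonatomic d (T : measurableType d) (R : realType)
    (mu : {measure set T -> \bar R}) : Prop :=
  ~ exists A, [/\ measurable A, 0 < mu A &
    forall B, measurable B -> B `<=` A -> mu B = 0 \/ mu B = mu A].

Section bfmeasure.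
Context (R : realType) (X : completeMetricType R).

Record bfmeasure : Type := BFMeasure {
  bfm :> {measure set (borel X) -> \bar R} ;
  bfm_fin : forall A : set (borel X), measurable A -> mbounded A -> bfm A < +oo }.

Lemma mzero_bf (A : set (borel X)) : measurable A -> mbounded A ->
  (@mzero _ (borel X) R : {measure set (borel X) -> \bar R}) A < +oo.
Proof. by move=> _ _; exact: ltry. Qed.

HB.instance Definition _ := gen_eqMixin bfmeasure.
HB.instance Definition _ := gen_choiceMixin bfmeasure.
HB.instance Definition _ := isPointed.Build bfmeasure (BFMeasure mzero_bf).

Definition weak_test (f : borel X -> R) : Prop :=
  [/\ continuous (f : X -> R),
      exists M : R, forall x, (`|f x| <= M)%R &
      exists2 A : set X, mbounded A & forall x, ~ A x -> f x = 0%R].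

(* The open sets of the weak convergence topology of boundedly finite measures,
   i.e. the coarsest topology for which [mu |-> \int f dmu] is continuous for
   every bounded continuous [f] with bounded support. *)
Definition weak_open (O : set bfmeasure) : Prop :=
  forall mu, O mu -> exists (k : nat) (f : 'I_k -> borel X -> R) (e : R),
    [/\ (0 < e)%R, forall i, weak_test (f i) &
      forall mu' : bfmeasure,
        (forall i, `|\int[mu']_x f i x - \int[mu]_x f i x| < e)%R -> O mu'].

End bfmeasure.
Arguments weak_open {R X}.

Notation bfmeasures X := (g_sigma_algebraType (@weak_open _ X)).

Section conditioning.
Context d (Omega : measurableType d) (R : realType) (P : probability Omega R).

(* [Y] is a version of the conditional expectation [E[Z | F]], for [Z >= 0]
   with values in [0, +oo]. *)
Definition is_cond_exp (F : set (set Omega)) (Z Y : Omega -> \bar R) : Prop :=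
  [/\ forall w, 0 <= Y w,
      forall B : set (\bar R), measurable B -> F (Y @^-1` B) &
      forall D, F D -> \int[P]_(w in D) Y w = \int[P]_(w in D) Z w].

Definition is_cond_prob (F : set (set Omega)) (E : set Omega)
    (Y : Omega -> \bar R) : Prop :=
  is_cond_exp F (fun w => (\1_E w)%:E) Y.

End conditioning.

(* Sigma-algebra generated by the maps [f i], [i] in [D]. *)
Definition sigma_fam d d' (Omega : measurableType d) (T : measurableType d')
    (I : Type) (D : set I) (f : I -> Omega -> T) : set (set Omega) :=
  <<s \bigcup_(i in D) preimage_set_system setT (f i) measurable >>.

Section poisson.
Context d d' (Omega : measurableType d) (S : measurableType d') (R : realType).

(* The library's [poisson_pmf] is not a probability mass function at rate 0. *)
Definition is_poisson (P : probability Omega R) (N : Omega -> \bar R)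
    (r : \bar R) : Prop :=
  if r is l%:E then
    forall k : nat, P [set w | N w = k%:R%:E] =
      (expR (- l) * l ^+ k / k`!%:R)%:E
  else {ae P, forall w, N w = +oo}.

Definition is_poisson_random_measure (P : probability Omega R)
    (N : R.-ker Omega ~> S) (nu : {measure set S -> \bar R}) : Prop :=
  (forall B, measurable B -> is_poisson P (N ^~ B) (nu B)) /\
  (forall (k : nat) (B : 'I_k -> set S) (C : 'I_k -> set (\bar R)),
    (forall i, measurable (B i)) -> trivIset setT B ->
    (forall i, measurable (C i)) ->
    P [set w | forall i, C i (N w (B i))] =
      \prod_(i < k) P [set w | C i (N w (B i))]).

End poisson.

Section random_measures.
Context (R : realType) (X : completeMetricType R).

(* [nu (dx, ds) = eta (dx) rho_x (ds)] with the standing conditions on it;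
   [min {y, s}] integrated against [nu (A, dy)] is an integral over
   [A * (0, +oo)] against [nu]. *)
Definition is_intensity (eta : probability (borel X) R)
    (rho : R.-sigmafker (borel X) ~> measurableTypeR R)
    (nu : {measure set (borel X * measurableTypeR R) -> \bar R}) : Prop :=
  [/\ nonatomic eta,
      forall x, rho x `]-oo, 0%R]%classic = 0,
      forall (A : set (borel X)) (B : set (measurableTypeR R)),
        measurable A -> measurable B ->
        nu (A `*` B) = \int[eta]_(x in A) rho x B,
      forall (A : set (borel X)) (s : R), measurable A -> mbounded A ->
        (0 < s)%R ->
        \int[nu]_(p in A `*` `]0%R, +oo[) (Num.min (p.2 : R) s)%:E < +oo &
      forall x : borel X, nu ([set x] `*` `]0%R, +oo[) = 0].

Definition is_crm d (Omega : measurableType d) (P : probability Omega R)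
    (mu : Omega -> bfmeasure X)
    (nu : {measure set (borel X * measurableTypeR R) -> \bar R}) : Prop :=
  exists N : R.-ker Omega ~> (borel X * measurableTypeR R)%type,
    is_poisson_random_measure P N nu /\
    {ae P, forall w, forall A : set (borel X), measurable A ->
       mu w A = \int[N w]_(p in A `*` `]0%R, +oo[) (p.2 : R)%:E}.

Definition total_mass (m : bfmeasure X) : R := fine (m setT).

Definition is_tilted d0 (Omega0 : measurableType d0) (P0 : probability Omega0 R)
    (mu : {mfun Omega0 >-> bfmeasures X}) (h : R -> R)
    d (Omega : measurableType d) (P : probability Omega R)
    (mut : {mfun Omega >-> bfmeasures X}) : Prop :=
  forall A : set (bfmeasures X), measurable A ->
    distribution P mut A =
      (\int[P0]_w (h (total_mass (mu w)))%:E)^-1 *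
      \int[distribution P0 mu]_(m in A) (h (total_mass m))%:E.

Definition normalized (m : bfmeasure X) (A : set (borel X)) : \bar R :=
  m A / m setT.

End random_measures.

Section gamma.
Context (R : realType).

Definition Gamma (a : R) : R :=
  (\int[lebesgue_measure]_(t in `]0, +oo[) (t `^ (a - 1) * expR (- t)))%R.

Definition gamma_law (shape rate : R) (B : set (measurableTypeR R)) : \bar R :=
  \int[lebesgue_measure]_(u in B `&` `]0%R, +oo[)
    (u `^ (shape - 1) * expR (- (u * rate)) * rate `^ shape / Gamma shape)%:E.

End gamma.

Section sampling.
Context (R : realType) (X : completeMetricType R).
Context d (Omega : measurableType d) (P : probability Omega R).
Context (mut : {mfun Omega >-> bfmeasures X}).

Definition sigma_normalized : set (set Omega) :=
  sigma_fam (@measurable _ (borel X)) (fun A w => normalized (mut w) A).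

Definition is_iid_normalized (m : nat) (S : 'I_m -> Omega -> borel X) : Prop :=
  forall A : 'I_m -> set (borel X), (forall i, measurable (A i)) ->
    is_cond_prob P sigma_normalized [set w | forall i, A i (S i w)]
      (fun w => \prod_(i < m) normalized (mut w) (A i)).

(* Given the whole of [mut] (and not only its normalization) the sample is still
   i.i.d. from the normalization, and [U] is independent of it and gamma
   distributed; this determines the joint law of [mut], the sample and [U]. *)
Definition is_augmenting (q : R) (n : nat) (S : 'I_n -> Omega -> borel X)
    (U : Omega -> R) : Prop :=
  (forall w, (0 < U w)%R) /\
  forall (A : 'I_n -> set (borel X)) (B : set (measurableTypeR R)),
    (forall i, measurable (A i)) -> measurable B ->
    is_cond_prob P (g_sigma_algebra_preimage mut)
      [set w | (forall i, A i (S i w)) /\ B (U w)]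
      (fun w => (\prod_(i < n) normalized (mut w) (A i)) *
                gamma_law (n%:R + q) (total_mass (mut w)) B).

End sampling.

(* The distinct values of a sample, the cells of its partition and their sizes;
   cells are numbered from 0. *)
Section clusters.
Context (X : pointedType) (n : nat).
Implicit Types (x : 'I_n -> X) (k : nat).

Definition distinct x : seq X := undup [seq x i | i : 'I_n].
Definition ncells x : nat := size (distinct x).
Definition Yval x k : X := nth point (distinct x) k.
Definition cell x k : {set 'I_n} := [set i | x i == Yval x k].
Definition ncell x k : nat := #|cell x k|.

End clusters.

Section weights.
Context (R : realType) (X : completeMetricType R).
Context (eta : probability (borel X) R).
Context (rho : R.-sigmafker (borel X) ~> (measurableTypeR R)).
Context (gamma q : R) (n : nat).
Implicit Types (z : borel X) (x : 'I_n -> borel X) (A : set (borel X)).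

Definition tau (m : nat) z (a : R) : \bar R :=
  \int[rho z]_(s in `]0%R, +oo[) (s ^+ m * expR (- (s * a)))%:E.

Definition psi (a b : R) : \bar R :=
  \int[eta]_z \int[rho z]_(s in `]0%R, +oo[)
    ((1 - expR (- (b * s))) * expR (- (a * s)))%:E.

(* [fU x] is the formula for the density of the augmenting variable given the
   sample [x]; that it is a conditional density is not assumed anywhere.
   Divisions are in [\bar R], where [0^-1 = +oo], [+oo^-1 = 0], [0 * +oo = 0]. *)
Definition fU_num x (u : R) : \bar R :=
  expeR (- psi 0 (gamma + u)) *
  (\prod_(k < ncells x) tau (ncell x k) (Yval x k) (gamma + u)) *
  (u `^ (n%:R + q - 1))%:E.

Definition fU x (u : R) : \bar R :=
  fU_num x u / \int[lebesgue_measure]_(v in `]0%R, +oo[) fU_num x v.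

(* [omega_new] is the weight of a new value (index [ncells x + 1] in 1-based
   numbering), [omega_cell] that of an old one; the suffix [_at] marks the
   versions at a given value [u] of the augmenting variable. *)
Definition omega_new_at (u : R) z : \bar R := u%:E * tau 1 z (gamma + u).

Definition omega_cell_at (u : R) x (k : nat) : \bar R :=
  u%:E * (tau (ncell x k).+1 (Yval x k) (gamma + u) /
          tau (ncell x k) (Yval x k) (gamma + u)).

Definition phi_at (u : R) x : \bar R :=
  \int[eta]_z omega_new_at u z + \sum_(k < ncells x) omega_cell_at u x k.

Definition omega_new x z : \bar R :=
  \int[lebesgue_measure]_(u in `]0%R, +oo[) (omega_new_at u z * fU x u).

Definition omega_cell x (k : nat) : \bar R :=
  \int[lebesgue_measure]_(u in `]0%R, +oo[) (omega_cell_at u x k * fU x u).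

Definition phi x : \bar R :=
  \int[eta]_z omega_new x z + \sum_(k < ncells x) omega_cell x k.

Definition predictive x A : \bar R :=
  \int[eta]_(z in A) (omega_new x z / phi x) +
  \sum_(k < ncells x) omega_cell x k / phi x * \d_(Yval x k) A.

Definition predictive_at (u : R) x A : \bar R :=
  \int[eta]_(z in A) (omega_new_at u z / phi_at u x) +
  \sum_(k < ncells x) omega_cell_at u x k / phi_at u x * \d_(Yval x k) A.

End weights.

(* Main.v *)
Require Import Defs.
From HB Require Import structures.
From mathcomp Require Import all_boot all_order all_algebra.
From mathcomp Require Import all_classical all_reals all_analysis.
From mathcomp Require Import measurable_realfun ring lra.

(** The augmenting variable removes the normalization. Write [T] for the total mass
    of the completely random measure [mu]. Under the tilted law, the probability that
    [m] observations fall into sets [A i] and that the augmenting variable falls into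
    [du] is proportional to the expectation of
    [exp (- (gamma + u) T) * \prod_i mu (A i) * u ^ (m + q - 1) du]: the powers of
    [T] from the normalization, the tilt and the gamma density cancel
    ([joint_moment]). Such exponentially tilted moments of a completely random
    measure are explicit ([moment_formula]): they equal [exp (- psi_0 (gamma + u))]
    times an integral over samples of the products of the [tau_{n_k, Y_k} (gamma + u)].
    The integral is with respect to a fixed reference measure on tuples ([seating]),
    in which each new point is a fresh draw from [eta] or repeats one of the distinct
    previous ones. Hence a sample of size [m] and its augmenting variable have the
    joint density [joint_density m] with respect to the seating measure and Lebesgue
    measure, up to the constant [joint_const m] ([augmented_law], [sample_law]).

    The moments are obtained by differentiating the Laplace functional of the
    underlying Poisson random measure ([laplace_functional], [mecke_formula]) in the
    direction of indicators, one set at a time. The derivative acts either on the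
    Laplace functional, which opens a cell with weight [tau_1], or on the factor of an
    existing cell, which turns [tau_c] into [tau_(c+1)]. All derivatives are taken
    along difference quotients that increase to their limit, so that only monotone
    convergence is needed.

    For the prediction, adding one observation multiplies the joint density by
    [u * tau_1 (gamma + u)] at a fresh point and by
    [u * tau_(c+1) (gamma + u) / tau_c (gamma + u)] at a point already seen [c] times
    ([continuation_identity]), while the constants for [n] and [n + 1] differ by the
    factor [n + q], by the functional equation of the gamma function ([kappaS]).
    Integrating over [u] gives the predictive distribution ([cond_prob_next]), and
    the total weight is [n + q] because the next observation lies somewhere
    ([total_law], [phi_total]).

    For the second part, the auxiliary variable is sampled from the conditional law of
    the augmenting variable of the whole sample of size [n + 1], on the product of the
    probability space with the line ([augmented_space]). The joint density of the [n]
    first observations, the auxiliary variable and the next observation is then the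
    one of the [n] first observations and their augmenting variable multiplied by the
    weights, which gives both the density of the auxiliary variable and the
    conditional predictive rule. *)

Set Implicit Arguments.
Unset Strict Implicit.
Unset Printing Implicit Defensive.

Import Order.TTheory GRing.Theory Num.Theory.
Import numFieldNormedType.Exports.

Local Open Scope classical_set_scope.
Local Open Scope ring_scope.
Local Open Scope ereal_scope.

(** * Integration of nonnegative functions *)

Section ge0_induction.
Context d (T : measurableType d) (R : realType).

Import HBNNSimple.

(** The monotone class scheme by which integral identities are extended below from
    indicators to all nonnegative measurable functions. *)
Lemma ge0_measurable_ind (P : (T -> \bar R) -> Prop) :
  (forall A, measurable A -> P (fun x => (\1_A x)%:E)) ->
  (forall (k : R) f, (0 <= k)%R -> measurable_fun setT f ->
    (forall x, 0 <= f x) -> P f -> P (fun x => k%:E * f x)) ->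
  (forall f g, measurable_fun setT f -> (forall x, 0 <= f x) ->
    measurable_fun setT g -> (forall x, 0 <= g x) ->
    P f -> P g -> P (fun x => f x + g x)) ->
  (forall f : (T -> \bar R)^nat, (forall n, measurable_fun setT (f n)) ->
    (forall n x, 0 <= f n x) -> (forall x, nondecreasing_seq (f ^~ x)) ->
    (forall n, P (f n)) -> P (fun x => limn (f ^~ x))) ->
  forall f, measurable_fun setT f -> (forall x, 0 <= f x) -> P f.
Proof.
move=> Pind Pscale Padd Plim f mf f0.
pose g := nnsfun_approx measurableT mf.
have -> : f = fun x => limn (fun n => (g n x)%:E).
  apply/funext => x; apply/esym/cvg_lim => //.
  exact: cvg_nnsfun_approx.
apply: (Plim (fun n x => (g n x)%:E)).
- by move=> n; apply/measurable_EFinP.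
- by move=> n x; rewrite lee_fin.
- by move=> x m n mn; rewrite lee_fin; exact/lefP/nd_nnsfun_approx.
move=> n; set s := g n.
have -> : (fun x => (s x)%:E) = (fun x => \sum_(y <- finmap.enum_fset (fset_set (range s)))
    (y * \1_(s @^-1` [set y]) x)%:E).
  by apply/funext => x; rewrite fimfunE fsbig_finite//= sumEFin.
have sr : all (fun y => (0 <= y)%R) (finmap.enum_fset (fset_set (range s))).
  apply/allP => y; rewrite in_fset_set// inE => -[x _ <-].
  exact: fun_ge0.
have nnr : forall l x, all (fun y : R => (0 <= y)%R) l ->
    0 <= \sum_(y <- l) (y * \1_(s @^-1` [set y]) x)%:E.
  move=> l x /allP l0; rewrite big_seq; apply: sume_ge0 => y yl.
  by rewrite lee_fin mulr_ge0// l0.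
have mr : forall l, measurable_fun setT
    (fun x => \sum_(y <- l) (y * \1_(s @^-1` [set y]) x)%:E).
  move=> l; apply: emeasurable_sum => y.
  exact/measurable_EFinP/measurable_funM.
move: (finmap.enum_fset _) sr; elim => [_|y l IH /= /andP[y0 l0]].
  under eq_fun do rewrite big_nil.
  by have := Pind _ measurable0; under eq_fun do rewrite indic0.
under eq_fun do rewrite big_cons EFinM.
apply: Padd => //.
- exact/measurable_funeM/measurable_EFinP.
- by move=> x; rewrite mule_ge0// lee_fin.
- by move=> x; exact: nnr.
- apply: Pscale => //.
  + exact/measurable_EFinP.
  + by apply: Pind; exact: measurable_sfunP.
- exact: IH.
Qed.

End ge0_induction.


Lemma ereal_nd_le_lim (R : realType) (u : (\bar R)^nat) (l : \bar R) :
  nondecreasing_seq u -> u @ \oo --> l -> forall n, u n <= l.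
Proof.
move=> ndu ul n; rewrite -(cvg_lim _ ul)//; apply: lime_ge.
  by apply/cvg_ex; exists l.
by exists n => // m /= /ndu.
Qed.

(** Monotonicity removes the indeterminate form [0 * +oo]: a nondecreasing
    nonnegative sequence with limit 0 vanishes identically. *)
Lemma ge0_nd_cvgeM (R : realType) (u v : (\bar R)^nat) (a b : \bar R) :
  (forall n, 0 <= u n) -> (forall n, 0 <= v n) ->
  nondecreasing_seq u -> nondecreasing_seq v ->
  u @ \oo --> a -> v @ \oo --> b -> (fun n => u n * v n) @ \oo --> a * b.
Proof.
move=> u0 v0 ndu ndv ua vb.
have ule := ereal_nd_le_lim ndu ua; have vle := ereal_nd_le_lim ndv vb.
have a0 : 0 <= a := le_trans (u0 0%N) (ule 0%N).
have b0 : 0 <= b := le_trans (v0 0%N) (vle 0%N).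
have [a_eq0|an0] := eqVneq a 0.
  rewrite a_eq0 mul0e.
  rewrite (_ : (fun n => _) = cst 0); first exact: cvg_cst.
  apply/funext => n /=; rewrite (_ : u n = 0) ?mul0e//.
  by apply/eqP; rewrite eq_le u0 andbT -a_eq0 ule.
have [b_eq0|bn0] := eqVneq b 0.
  rewrite b_eq0 mule0.
  rewrite (_ : (fun n => _) = cst 0); first exact: cvg_cst.
  apply/funext => n /=; rewrite (_ : v n = 0) ?mule0//.
  by apply/eqP; rewrite eq_le v0 andbT -b_eq0 vle.
apply: cvgeM => //.
by apply: neq0_mule_def; rewrite mule_eq0 negb_or an0.
Qed.

Lemma ge0_cvgeZl (R : realType) (u : (\bar R)^nat) (k l : \bar R) :
  0 <= k -> (forall n, 0 <= u n) -> nondecreasing_seq u ->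
  u @ \oo --> l -> (fun n => k * u n) @ \oo --> k * l.
Proof.
move=> k0 u0 ndu ul; apply: (@ge0_nd_cvgeM _ (cst k) u) => //; exact: cvg_cst.
Qed.

Lemma ge0_limnZl (R : realType) (u : (\bar R)^nat) (k : \bar R) :
  0 <= k -> (forall n, 0 <= u n) -> nondecreasing_seq u ->
  limn (fun n => k * u n) = k * limn u.
Proof.
move=> k0 u0 ndu; apply/cvg_lim => //; apply: ge0_cvgeZl => //.
exact: ereal_nondecreasing_is_cvgn.
Qed.

(** Joint laws are handled as functionals [F |-> \int V * F (Y)] of nonnegative
    functions, given by a weight [V] and a map [Y]: this avoids naming the
    measures, and reduces identities between them to indicators. *)
Lemma ge0_integral_weight_eq d1 d2 d (T1 : measurableType d1)
    (T2 : measurableType d2) (T : measurableType d) (R : realType)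
    (m1 : {measure set T1 -> \bar R}) (m2 : {measure set T2 -> \bar R})
    (V1 : T1 -> \bar R) (V2 : T2 -> \bar R) (Y1 : T1 -> T) (Y2 : T2 -> T) :
  measurable_fun setT V1 -> (forall x, 0 <= V1 x) -> measurable_fun setT Y1 ->
  measurable_fun setT V2 -> (forall x, 0 <= V2 x) -> measurable_fun setT Y2 ->
  (forall A, measurable A -> \int[m1]_x (V1 x * (\1_A (Y1 x))%:E) =
                             \int[m2]_x (V2 x * (\1_A (Y2 x))%:E)) ->
  forall f, measurable_fun setT f -> (forall x, 0 <= f x) ->
    \int[m1]_x (V1 x * f (Y1 x)) = \int[m2]_x (V2 x * f (Y2 x)).
Proof.
move=> mV1 V10 mY1 mV2 V20 mY2 VA.
have mc1 f : measurable_fun setT f ->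
    measurable_fun setT (fun x => V1 x * f (Y1 x)).
  by move=> mf; apply: emeasurable_funM => //; exact: measurableT_comp.
have mc2 f : measurable_fun setT f ->
    measurable_fun setT (fun x => V2 x * f (Y2 x)).
  by move=> mf; apply: emeasurable_funM => //; exact: measurableT_comp.
apply: ge0_measurable_ind => //.
- move=> k f k0 mf f0 IH.
  under eq_integral do rewrite muleCA.
  under [RHS]eq_integral do rewrite muleCA.
  rewrite !ge0_integralZl ?lee_fin//; last 4 first.
  + exact: mc2.
  + by move=> x _; rewrite mule_ge0.
  + exact: mc1.
  + by move=> x _; rewrite mule_ge0.
  by rewrite IH.
- move=> f g mf f0 mg g0 IHf IHg.
  under eq_integral do rewrite ge0_muleDr//.
  under [RHS]eq_integral do rewrite ge0_muleDr//.
  rewrite !ge0_integralD//; try (by apply: mc1 || apply: mc2);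
    try by move=> x _; rewrite mule_ge0.
  by rewrite IHf IHg.
- move=> f mf f0 ndf IH.
  under eq_integral do rewrite -ge0_limnZl//.
  under [RHS]eq_integral do rewrite -ge0_limnZl//.
  rewrite !monotone_convergence//; try (by move=> n; apply: mc1 || apply: mc2);
    try (by move=> n x _; rewrite mule_ge0);
    try by move=> x _ m n mn; rewrite lee_wpmul2l// ndf.
  by congr (limn _); apply/funext => n; exact: IH.
Qed.

Section weighted_measure.
Context d1 d (T1 : measurableType d1) (T : measurableType d) (R : realType).
Variables (m : {measure set T1 -> \bar R}) (V : T1 -> \bar R) (Y : T1 -> T).
Hypotheses (mV : measurable_fun setT V) (V0 : forall x, 0 <= V x).
Hypothesis mY : measurable_fun setT Y.

(** The image under [Y] of the measure with density [V]. *)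
Definition wmeasure of measurable_fun setT V & (forall x, 0 <= V x) &
    measurable_fun setT Y : set T -> \bar R :=
  fun A => \int[m]_x (V x * (\1_A (Y x))%:E).

Local Notation wm := (wmeasure mV V0 mY).

Let wm0 : wm set0 = 0.
Proof. by apply: integral0_eq => x _; rewrite indic0 mule0. Qed.

Let wm_ge0 A : 0 <= wm A.
Proof. by apply: integral_ge0 => x _; rewrite mule_ge0// lee_fin. Qed.

Let mwi A : measurable A -> measurable_fun setT (fun x => V x * (\1_A (Y x))%:E).
Proof.
move=> mA; apply: emeasurable_funM => //; apply/measurable_EFinP.
by apply: measurableT_comp => //; exact: measurable_indic.
Qed.

Let wm_sigma_additive : semi_sigma_additive wm.
Proof.
move=> F mF tF mUF; rewrite /wmeasure.
apply: cvg_toP.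
  apply: ereal_nondecreasing_is_cvgn => a b ab.
  by apply: lee_sum_nneg_natr => // n _ _; exact: wm_ge0.
rewrite -integral_nneseries//=; last 2 first.
- by move=> n; exact: mwi.
- by move=> n x _; rewrite mule_ge0// lee_fin.
apply: eq_integral => x _.
rewrite indic_bigcup//= -ge0_limnZl//.
- apply: congr_lim; apply/funext => n /=.
  by rewrite ge0_sume_distrr// => i _; rewrite lee_fin.
- by move=> n; apply: sume_ge0 => i _; rewrite lee_fin.
- by move=> a b ab; apply: lee_sum_nneg_natr => // n _ _; rewrite lee_fin.
Qed.

HB.instance Definition _ := isMeasure.Build _ _ _ wm
  wm0 wm_ge0 wm_sigma_additive.

Lemma ge0_integral_wmeasure f : measurable_fun setT f -> (forall x, 0 <= f x) ->
  \int[wm]_x f x = \int[m]_x (V x * f (Y x)).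
Proof.
move=> mf f0; transitivity (\int[wm]_x (1 * f (id x))).
  by apply: eq_integral => x _; rewrite mul1e.
apply: ge0_integral_weight_eq => // [A mA].
under eq_integral do rewrite mul1e.
by rewrite integral_indic// setIT.
Qed.

End weighted_measure.

(** * Uniqueness of laws of tuples *)

Section measure_determination.
Context d (T : measurableType d) (R : realType).

Lemma eq_finite_measure_pi (m1 m2 : {measure set T -> \bar R}) (G : set (set T)) :
  setI_closed G -> G `<=` measurable ->
  measurable_fun setT (id : g_sigma_algebraType G -> T) -> G setT ->
  m1 setT < +oo -> (forall A, G A -> m1 A = m2 A) ->
  forall A, measurable A -> m1 A = m2 A.
Proof.
move=> GI Gm mid GT fin1 eqG A mA.
have sG : @measurable _ T = <<s G >>.
  apply/seteqP; split => B mB; last first.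
    exact: (smallest_sub (@sigma_algebra_measurable _ T) Gm).
  by have := mid measurableT B mB; rewrite setTI.
apply: (@measure_unique _ _ _ G (fun=> setT)) => //.
- by rewrite bigcup_const.
Qed.

End measure_determination.

Section tuple_measure.
Context d (T : measurableType d) (R : realType) (n : nat).

Definition box (A : 'I_n -> set T) : set (n.-tuple T) :=
  [set t | forall i, A i (tnth t i)].

Lemma boxE A : box A = \bigcap_(i in [set: 'I_n]) (@tnth n T ^~ i) @^-1` A i.
Proof. by apply/seteqP; split => t /= H i; [move=> _; exact: H|exact: H]. Qed.

Lemma measurable_box A : (forall i, measurable (A i)) -> measurable (box A).
Proof.
move=> mA; rewrite boxE; apply: fin_bigcap_measurable => // i _.
by rewrite -[X in measurable X]setTI; exact: measurable_tnth.
Qed.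

Lemma indic_box A t : (\1_(box A) t : R) = (\prod_(i < n) \1_(A i) (tnth t i))%R.
Proof.
rewrite indicE; have [tA|tA] := pselect (box A t).
  rewrite mem_set//= big1// => i _.
  by rewrite indicE mem_set//; exact: tA.
rewrite memNset//=; move/existsNP : tA => [i Ai].
by rewrite (bigD1 i)//= indicE memNset// mul0r.
Qed.

Context d' (S : measurableType d').

(** Products of a rectangle of tuples and a measurable set form a generating family
    stable under intersection: joint laws of a sample and a further variable are
    determined by the events in which each coordinate is constrained separately. *)
Lemma eq_finite_measure_tuple_prod
    (m1 m2 : {measure set (n.-tuple T * S) -> \bar R}) :
  m1 setT < +oo ->
  (forall (A : 'I_n -> set T) (B : set S), (forall i, measurable (A i)) ->
    measurable B -> m1 (box A `*` B) = m2 (box A `*` B)) ->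
  forall D, measurable D -> m1 D = m2 D.
Proof.
move=> fin1 eqm.
pose G := [set D : set (n.-tuple T * S) | exists (A : 'I_n -> set T) (B : set S),
  [/\ forall i, measurable (A i), measurable B & D = box A `*` B]].
apply: (@eq_finite_measure_pi _ _ _ _ _ G) => //.
- move=> _ _ [A [B [mA mB ->]]] [A' [B' [mA' mB' ->]]].
  exists (fun i => A i `&` A' i), (B `&` B'); split.
  + by move=> i; exact: measurableI.
  + exact: measurableI.
  + rewrite -setXI; congr (_ `*` _); apply/seteqP; split => t /=.
      by move=> [tA tA'] i; split; [exact: tA|exact: tA'].
    by move=> H; split => i; have [] := H i.
- move=> _ [A [B [mA mB ->]]]; apply: measurableX => //; exact: measurable_box.
- apply/measurable_fun_pairP; split.
    apply/measurable_fun_tnthP => i _ A mA; rewrite setTI.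
    apply: sub_sigma_algebra.
    exists (fun j => if j == i then A else setT), setT; split => //.
      by move=> j; case: ifP.
    apply/seteqP; split => [[t s] /= tA|[t s] /= [tA _]].
      by split => // j; case: eqP => // ->.
    by have := tA i; rewrite eqxx.
  move=> _ B mB; rewrite setTI; apply: sub_sigma_algebra.
  exists (fun=> setT), B; split => //.
  by apply/seteqP; split => [[t s]|[t s] []] //=.
- exists (fun=> setT), setT; split => //.
  by apply/seteqP; split => [[t s]|[t s] []] //=.
- by move=> _ [A [B [mA mB ->]]]; exact: eqm.
Qed.

Lemma eq_finite_measure_tuple (m1 m2 : {measure set (n.-tuple T) -> \bar R}) :
  m1 setT < +oo ->
  (forall A : 'I_n -> set T, (forall i, measurable (A i)) ->
    m1 (box A) = m2 (box A)) ->
  forall D, measurable D -> m1 D = m2 D.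
Proof.
move=> fin1 eqm.
apply: (@eq_finite_measure_pi _ _ _ _ _ [set D | exists2 A : 'I_n -> set T,
  (forall i, measurable (A i)) & D = box A]) => //.
- move=> _ _ [A mA ->] [A' mA' ->].
  exists (fun i => A i `&` A' i); first by move=> i; exact: measurableI.
  apply/seteqP; split => t /=.
    by move=> [tA tA'] i; split; [exact: tA|exact: tA'].
  by move=> H; split => i; have [] := H i.
- by move=> _ [A mA ->]; exact: measurable_box.
- apply/measurable_fun_tnthP => i _ A mA; rewrite setTI.
  apply: sub_sigma_algebra.
  exists (fun j => if j == i then A else setT).
    by move=> j; case: ifP.
  apply/seteqP; split => [t /= tA j|t /= tA].
    by case: eqP => // ->.
  by have := tA i; rewrite eqxx.
- by exists (fun=> setT) => //; apply/seteqP; split.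
- by move=> _ [A mA ->]; exact: eqm.
Qed.

End tuple_measure.

(** * Exponentials and their difference quotients *)

Section exp_difference_quotient.
Context (R : realType).
Implicit Types x y : \bar R.

Definition expN x : \bar R := expeR (- x).
Definition onemexpN x : \bar R := 1 - expN x.

Lemma expN_fin (r : R) : expN r%:E = (expR (- r))%:E. Proof. by []. Qed.

Lemma expN0 : expN 0 = 1. Proof. by rewrite /expN oppe0 expeR0. Qed.

Lemma expN_ge0 x : 0 <= expN x. Proof. exact: expeR_ge0. Qed.

Lemma expN_le1 x : 0 <= x -> expN x <= 1.
Proof. by move=> x0; rewrite -expeR0 lee_expeR oppe_le0. Qed.

Lemma expN_fin_num x : 0 <= x -> expN x \is a fin_num.
Proof.
move=> x0; rewrite ge0_fin_numE ?expN_ge0//.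
by rewrite (le_lt_trans (expN_le1 x0))// ltry.
Qed.

Lemma expND x y : 0 <= x -> 0 <= y -> expN (x + y) = expN x * expN y.
Proof. by move=> x0 y0; rewrite /expN -expeRD oppeD// ge0_adde_def// inE. Qed.

Lemma expN_sum (I : Type) (s : seq I) (F : I -> \bar R) :
  (forall i, 0 <= F i) -> expN (\sum_(i <- s) F i) = \prod_(i <- s) expN (F i).
Proof.
move=> F0; elim: s => [|i s IH]; first by rewrite !big_nil expN0.
by rewrite !big_cons expND ?IH//; exact: sume_ge0.
Qed.

Lemma expN_le x y : x <= y -> expN y <= expN x.
Proof. by move=> xy; rewrite lee_expeR leeN2. Qed.

Lemma onemexpN_ge0 x : 0 <= x -> 0 <= onemexpN x.
Proof. by move=> x0; rewrite sube_ge0 ?expN_le1// ?expN_fin_num ?orbT. Qed.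

Lemma onemexpN_le x y : x <= y -> onemexpN x <= onemexpN y.
Proof. by move=> xy; rewrite leeB// expN_le. Qed.

Lemma onemexpNK x : 0 <= x -> expN x + onemexpN x = 1.
Proof. by move=> x0; rewrite addeC subeK// expN_fin_num. Qed.

Lemma onemexpND x y : 0 <= x -> 0 <= y ->
  onemexpN (x + y) = onemexpN x + expN x * onemexpN y.
Proof.
move=> x0 y0; have xf := expN_fin_num x0; have yf := expN_fin_num y0.
rewrite /onemexpN expND//.
case: (expN x) xf => // a _; case: (expN y) yf => // b _.
by rewrite -EFinM -!EFinB -EFinM -EFinD; congr EFin; ring.
Qed.

Lemma onemexpN_le_id x : 0 <= x -> onemexpN x <= x.
Proof.
case: x => [r| |]// r0; last by rewrite leey.
rewrite /onemexpN expN_fin -EFinB lee_fin lerBlDr addrC.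
by have := expR_ge1Dx (- r)%R; lra.
Qed.

Lemma onemexpN_ge x : 0 <= x -> x * expN x <= onemexpN x.
Proof.
case: x => [r| |]// r0; last by rewrite /expN/= mule0 onemexpN_ge0.
rewrite /onemexpN expN_fin -EFinM -EFinB lee_fin.
have : ((1 + r) * expR (- r) <= 1)%R.
  by rewrite -[leRHS](expRxMexpNx_1 r) ler_wpM2r ?expR_ge0// expR_ge1Dx.
by rewrite mulrDl mul1r; lra.
Qed.

Lemma measurable_expN : measurable_fun [set: \bar R] expN.
Proof.
rewrite (_ : expN = fun x => if x == +oo then 0 else
    if x == -oo then +oo else (expR (- fine x))%:E); last first.
  by apply/funext => -[r| |].
apply: measurable_fun_ifT.
- apply: (measurable_fun_bool true); rewrite setTI (_ : _ @^-1` _ = [set +oo]).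
    exact: emeasurable_set1.
  by apply/seteqP; split => x /= /eqP.
- exact: measurable_cst.
- apply: measurable_fun_ifT.
  + apply: (measurable_fun_bool true); rewrite setTI (_ : _ @^-1` _ = [set -oo]).
      exact: emeasurable_set1.
    by apply/seteqP; split => x /= /eqP.
  + exact: measurable_cst.
  + apply/measurable_EFinP; apply: measurableT_comp; first exact: measurable_expR.
    by apply: measurableT_comp => //; exact: fine_measurable.
Qed.

Lemma measurable_onemexpN : measurable_fun [set: \bar R] onemexpN.
Proof.
by apply: emeasurable_funB; [exact: measurable_cst|exact: measurable_expN].
Qed.

Lemma cvg_expN (u : (\bar R)^nat) l : (forall n, 0 <= u n) ->
  u @ \oo --> l -> expN \o u @ \oo --> expN l.
Proof.
move=> u0 ul; have l0 : 0 <= l.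
  rewrite -(cvg_lim _ ul)//; apply: lime_ge; first by apply/cvg_ex; exists l.
  exact: nearW.
case: l l0 ul => [r| |]// l0 ul.
  have /fine_cvgP[ufin ur] := ul.
  apply/fine_cvgP; split.
    near=> n; apply: expN_fin_num; exact: u0.
  apply: (@cvg_trans _ ((fun n => expR (- fine (u n))) @ \oo)).
    apply: near_eq_cvg; near=> n => /=.
    have un : u n \is a fin_num by near: n.
    by rewrite -{2}(fineK un).
  apply: (@continuous_cvg _ _ _ _ _ _ (fun x : R => expR (- x))) => //.
  by apply: continuous_comp; [exact: opp_continuous|exact: continuous_expR].
have -> : expN +oo = 0 by [].
apply/fine_cvgP; split.
  near=> n; apply: expN_fin_num; exact: u0.
apply/cvgrPdist_le => e e0; rewrite /=.
move/cvgeyPge : ul => /(_ (- ln e)%R) ul; near=> n.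
rewrite sub0r normrN ger0_norm ?fine_ge0 ?expN_ge0//.
rewrite -lee_fin fineK ?expN_fin_num//.
apply: (@le_trans _ _ (expN (- ln e)%:E)).
  by apply: expN_le; near: n.
by rewrite expN_fin opprK lnK.
Unshelve. all: by end_near. Qed.

Lemma cvg_onemexpN (u : (\bar R)^nat) l : (forall n, 0 <= u n) ->
  u @ \oo --> l -> onemexpN \o u @ \oo --> onemexpN l.
Proof.
move=> u0 ul.
have l0 : 0 <= l.
  rewrite -(cvg_lim _ ul)//; apply: lime_ge; first by apply/cvg_ex; exists l.
  exact: nearW.
apply: cvgeB; [|exact: cvg_cst|exact: cvg_expN].
by rewrite fin_num_adde_defr// fin_numN expN_fin_num.
Qed.

(** The difference quotient of [t |-> - exp (- t x)] at 0 with step [2 ^- k].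
    Halving the step makes the quotient grow, so that derivatives at 0 can be
    taken under integrals by monotone convergence alone. *)
Definition step (k : nat) : R := (2%:R ^- k)%R.
Definition quot (k : nat) x : \bar R := (2%:R ^+ k)%:E * onemexpN ((step k)%:E * x).

Lemma step_gt0 k : (0 < step k)%R. Proof. by rewrite invr_gt0 exprn_gt0. Qed.

Lemma stepV k : (step k * 2%:R ^+ k = 1)%R.
Proof. by rewrite mulVf// expf_eq0 pnatr_eq0 andbF. Qed.

Lemma step_ge0 x k : 0 <= x -> 0 <= (step k)%:E * x.
Proof. by move=> x0; rewrite mule_ge0// lee_fin ltW// step_gt0. Qed.

Lemma quot_ge0 k x : 0 <= x -> 0 <= quot k x.
Proof. by move=> x0; rewrite mule_ge0 ?lee_fin ?exprn_ge0// onemexpN_ge0// step_ge0. Qed.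

Lemma quotK k x : 0 <= x -> expN ((step k)%:E * x) + (step k)%:E * quot k x = 1.
Proof.
by move=> x0; rewrite /quot muleA -EFinM stepV mul1e onemexpNK// step_ge0.
Qed.

Lemma measurable_quot k : measurable_fun [set: \bar R] (quot k).
Proof.
apply: measurable_funeM; apply: measurableT_comp; first exact: measurable_onemexpN.
exact: measurable_funeM.
Qed.

Lemma quot_nd x : 0 <= x -> nondecreasing_seq (quot ^~ x).
Proof.
move=> x0; apply/nondecreasing_seqP => k; rewrite /quot.
have sk : (step k = step k.+1 + step k.+1)%R.
  by rewrite /step exprS invfM mulrC -splitr.
have e0 := step_ge0 k.+1 x0.
have s0 : 0 <= (step k.+1)%:E :> \bar R by rewrite lee_fin ltW ?step_gt0.
rewrite sk EFinD ge0_muleDl//.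
rewrite onemexpND// exprS EFinM.
rewrite [leRHS](_ : _ = (2%:R ^+ k)%:E * (2%:E * onemexpN ((step k.+1)%:E * x))); last first.
  by rewrite muleA; congr (_ * _); rewrite muleC.
rewrite lee_pmul2l ?lte_fin ?exprn_gt0//.
have of0 := onemexpN_ge0 e0.
rewrite -[2%:E]/((1 + 1)%:E) EFinD ge0_muleDl// mul1e leeD2l//.
by rewrite -[leRHS]mul1e lee_wpmul2r// expN_le1.
Qed.

Lemma cvg_step : (step k)%:E @[k --> \oo] --> 0.
Proof.
apply: cvg_EFin; first exact: nearW.
rewrite /step [X in X @ _ --> _](_ : _ = (fun k => (2%:R^-1 : R) ^+ k)%R).
  by apply: cvg_expr; rewrite ger0_norm ?invf_lt1// ltr1n.
by apply/funext => k; rewrite /= exprVn.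
Qed.

Lemma quot_le k x : 0 <= x -> quot k x <= x.
Proof.
move=> x0; rewrite /quot.
apply: (@le_trans _ _ ((2%:R ^+ k)%:E * ((step k)%:E * x))).
  by rewrite lee_wpmul2l ?lee_fin ?exprn_ge0// onemexpN_le_id// step_ge0.
by rewrite muleA -EFinM mulrC stepV mul1e.
Qed.

Lemma quot_ge k x : 0 <= x -> x * expN ((step k)%:E * x) <= quot k x.
Proof.
move=> x0; rewrite /quot.
rewrite [leLHS](_ : _ = (2%:R ^+ k)%:E *
    ((step k)%:E * x * expN ((step k)%:E * x))).
  by rewrite lee_wpmul2l ?lee_fin ?exprn_ge0// onemexpN_ge// step_ge0.
by rewrite !muleA -EFinM mulrC stepV mul1e.
Qed.

Lemma cvg_quot x : 0 <= x -> quot k x @[k --> \oo] --> x.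
Proof.
case: x => [r| |]// r0.
  apply: (@squeeze_cvge _ _ _ _ (fun k => r%:E * expN ((step k)%:E * r%:E)) _ (cst r%:E)).
  - by apply: nearW => k; rewrite quot_ge//= quot_le.
  - rewrite -[X in _ --> X]mule1 -expN0; apply: cvgeZl => //.
    apply: cvg_expN; first by move=> n; exact: step_ge0.
    by rewrite -(mul0e r%:E); apply: cvgeZr => //; exact: cvg_step.
  - exact: cvg_cst.
rewrite (_ : (fun k => _) = fun k => (2%:R ^+ k)%:E); last first.
  apply/funext => k; rewrite /quot gt0_muley ?lte_fin ?step_gt0//.
  by rewrite /onemexpN /expN/= sube0 mule1.
apply/cvgeyPge => M; near=> k.
rewrite lee_fin; apply: (@le_trans _ _ k%:R)%R.
  by near: k; exact: nbhs_infty_ger.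
by rewrite -natrX ler_nat ltnW// ltn_expl.
Unshelve. all: by end_near. Qed.

End exp_difference_quotient.
Arguments step {R} k.
Arguments quot {R} k x.

(** * Independent and Poisson variables *)

Section independent_expectations.
Context d (Omega : measurableType d) (R : realType) (P : probability Omega R).

Lemma emeasurable_prod d' (T : measurableType d') (I : Type) (s : seq I)
    (Q : pred I) (F : I -> T -> \bar R) :
  (forall i, measurable_fun setT (F i)) ->
  measurable_fun setT (fun x => \prod_(i <- s | Q i) F i x).
Proof.
move=> mF; elim: s => [|i s IH].
  by under eq_fun do rewrite big_nil; exact: measurable_cst.
under eq_fun do rewrite big_cons; case: (Q i) => //.
exact: emeasurable_funM.
Qed.

Lemma prode_ge0_cond (I : Type) (s : seq I) (Q : pred I) (F : I -> \bar R) :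
  (forall i, 0 <= F i) -> 0 <= \prod_(i <- s | Q i) F i.
Proof. by move=> F0; apply: prode_ge0. Qed.

(** Independence, stated for events, extends to expectations of products by
    replacing the indicators one coordinate at a time. *)
Lemma independent_expectation_prod k (Y : 'I_k -> Omega -> \bar R) :
  (forall i, measurable_fun setT (Y i)) ->
  (forall C : 'I_k -> set (\bar R), (forall i, measurable (C i)) ->
    P [set w | forall i, C i (Y i w)] = \prod_(i < k) P [set w | C i (Y i w)]) ->
  forall phi : 'I_k -> \bar R -> \bar R,
    (forall i, measurable_fun setT (phi i)) -> (forall i y, 0 <= phi i y) ->
    \int[P]_w \prod_(i < k) phi i (Y i w) = \prod_(i < k) \int[P]_w phi i (Y i w).
Proof.
move=> mY indep.
suff H m : (m <= k)%N -> forall phi : 'I_k -> \bar R -> \bar R,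
    (forall i, measurable_fun setT (phi i)) -> (forall i y, 0 <= phi i y) ->
    (forall i : 'I_k, (m <= i)%N ->
      exists2 C, measurable C & phi i = fun y => (\1_C y)%:E) ->
    \int[P]_w \prod_(i < k) phi i (Y i w) = \prod_(i < k) \int[P]_w phi i (Y i w).
  move=> phi mphi phi0; apply: (H k) => // i.
  by rewrite leqNgt ltn_ord.
elim: m => [_ phi mphi phi0 phiC|m IH mk phi mphi phi0 phiC].
  have {}phiC i : {C | measurable C & phi i = fun y => (\1_C y)%:E}.
    by apply: cid2; exact: phiC.
  pose C i := s2val (phiC i).
  have mC i : measurable (C i) := s2valP (phiC i).
  have phiE i y : phi i y = (\1_(C i) y)%:E.
    by rewrite /C; case: (phiC i) => B /= _ ->.
  have mCY i : measurable [set w | C i (Y i w)].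
    by rewrite -[X in measurable X]setTI; exact: mY.
  transitivity (\int[P]_w (\1_[set w | forall i, C i (Y i w)] w)%:E).
    apply: eq_integral => w _; under eq_bigr do rewrite phiE.
    rewrite prodEFin; congr EFin; rewrite indicE.
    have [wC|/existsNP[i wC]] := pselect (forall i, C i (Y i w)).
      rewrite mem_set//= big1// => i _; rewrite indicE mem_set//; exact: wC.
    rewrite memNset//=.
    by rewrite (bigD1 i)//= indicE memNset// mul0r.
  rewrite integral_indic ?setIT//; last first.
    rewrite (_ : mkset _ = \bigcap_(i in [set: 'I_k]) [set w | C i (Y i w)]).
      exact: fin_bigcap_measurable.
    by apply/seteqP; split => w /= h i; [move=> _; exact: h|exact: h].
  apply: (etrans (indep C mC)); apply: eq_bigr => i _.
  rewrite -[in LHS](setIT [set _ | _]) -integral_indic//.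
  by apply: eq_integral => w _; rewrite phiE.
pose j := Ordinal mk.
have mcomp (f : \bar R -> \bar R) i : measurable_fun setT f ->
    measurable_fun setT (fun w => f (Y i w)).
  by move=> mf; exact: measurableT_comp.
rewrite (bigD1 j)//=.
under eq_integral do rewrite (bigD1 j)//= muleC.
pose V1 w := \prod_(i < k | i != j) phi i (Y i w).
pose V2 (w : Omega) := \prod_(i < k | i != j) \int[P]_w phi i (Y i w).
have V20 w : 0 <= V2 w by apply: prode_ge0_cond => i; exact: integral_ge0.
transitivity (\int[P]_w (V2 w * phi j (Y j w))); last first.
  rewrite /V2 ge0_integralZl//; first by rewrite muleC.
  - exact: mcomp.
  - exact: (V20 point).
apply: (@ge0_integral_weight_eq _ _ _ _ _ _ _ P P V1 V2 (Y j) (Y j)) => //.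
- by apply: emeasurable_prod => i; exact: mcomp.
- by move=> w; exact: prode_ge0_cond.
- exact: measurable_cst.
move=> A mA.
pose phi' i := if i == j then fun y => (\1_A y)%:E else phi i.
have m1A : measurable_fun [set: \bar R] (fun y => (\1_A y : R)%:E).
  exact/measurable_EFinP/measurable_indic.
have mphi' i : measurable_fun setT (phi' i) by rewrite /phi'; case: ifP.
have phi'0 i y : 0 <= phi' i y by rewrite /phi'; case: ifP => // _; rewrite lee_fin.
have phi'j : phi' j = fun y => (\1_A y)%:E by rewrite /phi' eqxx.
have phi'N i : i != j -> phi' i = phi i by move=> /negbTE ij; rewrite /phi' ij.
rewrite /V2 ge0_integralZl//; last 2 first.
- exact: (mcomp (fun y => (\1_A y)%:E)).
- exact: (V20 point).
rewrite [RHS]muleC.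
transitivity (\int[P]_w \prod_(i < k) phi' i (Y i w)).
  apply: eq_integral => w _; rewrite (bigD1 j)//= phi'j muleC.
  by congr (_ * _); apply: eq_bigr => i ij; rewrite phi'N.
rewrite (IH (ltnW mk) phi' mphi' phi'0); last first.
  move=> i; rewrite /phi'; case: eqVneq => [_ _|ij mi]; first by exists A.
  apply: phiC; rewrite ltn_neqAle mi andbT.
  by apply: contra_neq ij => mi'; apply: val_inj.
rewrite (bigD1 j)//= phi'j.
by congr (_ * _); rewrite /V2; apply: eq_bigr => i ij; rewrite phi'N.
Qed.

End independent_expectations.

Section poisson_laplace.
Context (R : realType).

Lemma exp_nneseries (x : R) : (0 <= x)%R ->
  \sum_(k <oo) (x ^+ k / k`!%:R)%:E = (expR x)%:E.
Proof.
move=> x0; rewrite expRE -EFin_lim; last first.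
  rewrite /pseries/=; under eq_fun do rewrite mulrC.
  exact: is_cvg_series_exp_coeff.
apply/congr_lim/funext => n/=; rewrite /pseries/= /series/= -sumEFin//.
by under [RHS]eq_bigr do rewrite mulrC.
Qed.

Context d (Omega : measurableType d) (P : probability Omega R).

(** For a finite rate this is the exponential series; at the infinite rate [Y] is
    almost surely infinite and both sides vanish, unless [v = 0]. *)
Lemma is_poisson_laplace (Y : Omega -> \bar R) (r : \bar R) (v : R) :
  measurable_fun setT Y -> (forall w, 0 <= Y w) -> 0 <= r -> (0 <= v)%R ->
  is_poisson P Y r ->
  \int[P]_w expN (v%:E * Y w) = expN (onemexpN v%:E * r).
Proof.
move=> mY Y0 r0; rewrite le_eqVlt => /predU1P[<- _|v0].
  under eq_integral do rewrite mul0e expN0.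
  rewrite integral_cst//= probability_setT mule1.
  by rewrite /onemexpN expN0 subee// mul0e expN0.
have mF : measurable_fun setT (fun w => expN (v%:E * Y w)).
  apply: measurableT_comp; first exact: measurable_expN.
  exact: measurable_funeM.
have e1 : (0 < 1 - expR (- v))%R by rewrite subr_gt0 expR_lt1 oppr_lt0.
case: r r0 => [l| |]// l0 /=; last first.
  move=> Yoo; rewrite gt0_muley//.
  rewrite (_ : expN +oo = 0)//.
  rewrite -[RHS](integral0 P setT).
  apply: ge0_ae_eq_integral => //; first by move=> w _; exact: expN_ge0.
  apply: filterS Yoo => w -> _.
  by rewrite gt0_muley.
move=> Yk; have {}l0 : (0 <= l)%R by rewrite lee_fin in l0.
pose E k := [set w | Y w = k%:R%:E].
have mE k : measurable (E k).
  by have := mY measurableT _ (emeasurable_set1 (k%:R%:E)); rewrite setTI.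
have tE : trivIset setT E.
  apply/trivIsetP => i j _ _ ij; apply/seteqP; split => w //= [iw jw].
  have := etrans (esym (iw : Y w = _)) jw => -[/eqP].
  by rewrite eqr_nat (negbTE ij).
have PE : P (\bigcup_k E k) = 1.
  rewrite measure_semi_bigcup//; last exact: bigcup_measurable.
  rewrite (eq_eseriesr (g := fun k => ((expR (- l))%:E * (l ^+ k / k`!%:R)%:E))).
    rewrite nneseriesZl; last by move=> k _; rewrite lee_fin divr_ge0// exprn_ge0.
    by rewrite exp_nneseries// -EFinM mulrC expRxMexpNx_1.
  by move=> k _; apply: (etrans (Yk k)); rewrite -EFinM mulrA.
have PEC : P (~` \bigcup_k E k) = 0.
  rewrite probability_setC; first by rewrite [X in 1 - X]PE subee.
  exact: bigcup_measurable.
have mU : measurable (\bigcup_k E k) by exact: bigcup_measurable.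
have F0 w : 0 <= expN (v%:E * Y w) by exact: expN_ge0.
transitivity (\int[P]_(w in \bigcup_k E k) expN (v%:E * Y w)).
  rewrite (@ge0_negligible_integral _ _ _ P setT (~` \bigcup_k E k))//.
  - by rewrite setTD setCK.
  - exact: measurableC.
rewrite ge0_integral_bigcup//; last exact: measurable_funTS.
rewrite (eq_eseriesr (g := fun k => (expR (- l))%:E *
    ((l * expR (- v)) ^+ k / k`!%:R)%:E)); last first.
  move=> k _; rewrite (eq_integral (cst (expN (v%:E * k%:R%:E)))); last first.
    by move=> w /[!inE] ->.
  have -> : \int[P]_(w in E k) cst (expN (v%:E * k%:R%:E)) w =
      expN (v%:E * k%:R%:E) * P [set w | Y w = k%:R%:E] by exact: integral_cst.
  rewrite Yk -[v%:E * _]EFinM expN_fin -!EFinM; congr EFin.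
  rewrite exprMn -expRM_natr mulNr; ring.
rewrite nneseriesZl; last first.
  by move=> k _; rewrite lee_fin divr_ge0// exprn_ge0// mulr_ge0// expR_ge0.
rewrite exp_nneseries ?mulr_ge0 ?expR_ge0// -EFinM -expRD.
rewrite /onemexpN expN_fin -EFinB -EFinM expN_fin; congr (expR _)%:E; ring.
Qed.

End poisson_laplace.

(** * Laplace functional and Mecke formula *)

Section simple_function_levels.
Context d (S : measurableType d) (R : realType) (f : {nnsfun S >-> R}).

Import HBNNSimple.

Let s : seq R := finmap.enum_fset (fset_set (range f)).

Definition level (i : 'I_(size s)) : R := tnth (in_tuple s) i.
Definition level_set (i : 'I_(size s)) : set S := f @^-1` [set level i].

Lemma level_ge0 i : (0 <= level i)%R.
Proof.
have : level i \in s by exact: mem_tnth.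
by rewrite in_fset_set// inE => -[x _ <-]; exact: fun_ge0.
Qed.

Lemma measurable_level_set i : measurable (level_set i).
Proof. exact: measurable_sfunP. Qed.

Lemma trivIset_level_set : trivIset setT level_set.
Proof.
apply/trivIsetP => i j _ _ ij; apply/seteqP; split => x //= [xi xj].
move/eqP: ij; apply; apply/val_inj/eqP => /=.
rewrite -(@nth_uniq _ 0%R s) ?finmap.fset_uniq//.
move: xi xj; rewrite /level_set/= /level !(tnth_nth 0%R)/= => <- /esym/eqP.
by rewrite eq_sym.
Qed.

Lemma level_sum (phi : R -> \bar R) x :
  phi (f x) = \sum_(i < size s) phi (level i) * (\1_(level_set i) x)%:E.
Proof.
have fxs : f x \in s by rewrite in_fset_set// inE; exists x.
have fxi : (index (f x) s < size s)%N by rewrite index_mem.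
have lfx : level (Ordinal fxi) = f x by rewrite /level (tnth_nth 0%R)/= nth_index.
rewrite (bigD1 (Ordinal fxi))//= lfx indicE mem_set/= ?mule1; last first.
  by rewrite /level_set/= lfx.
rewrite big1 ?adde0// => i iN; rewrite indicE memNset ?mule0// => xi.
have := trivIset_level_set; move/trivIsetP => /(_ i (Ordinal fxi) I I iN).
move/seteqP => [/(_ x) + _]; apply; split => //.
Qed.

Lemma integral_level_sum (m : {measure set S -> \bar R}) (phi : R -> \bar R) :
  (forall i, 0 <= phi (level i)) ->
  \int[m]_x phi (f x) = \sum_(i < size s) phi (level i) * m (level_set i).
Proof.
move=> phi0; under eq_integral do rewrite level_sum.
have mi i : measurable_fun setT (fun x => (\1_(level_set i) x : R)%:E).
  apply/measurable_EFinP; apply: measurable_indic; exact: measurable_level_set.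
rewrite ge0_integral_sum//; last 2 first.
- by move=> i; exact: measurable_funeM.
- by move=> i x _; rewrite mule_ge0// lee_fin.
apply: eq_bigr => i _; rewrite ge0_integralZl//.
by rewrite integral_indic ?setIT//; exact: measurable_level_set.
Qed.

End simple_function_levels.
Arguments level {d S R} f i.
Arguments level_set {d S R} f i.

Section poisson_random_measure.
Context d d' (Omega : measurableType d) (S : measurableType d') (R : realType).
Variables (P : probability Omega R) (N : R.-ker Omega ~> S).
Variable nu : {measure set S -> \bar R}.
Hypothesis N_poisson : is_poisson_random_measure P N nu.

Import HBNNSimple.

Lemma measurable_kernel_integral (f : S -> \bar R) :
  measurable_fun setT f -> (forall x, 0 <= f x) ->
  measurable_fun setT (fun w => \int[N w]_x f x).
Proof.
move=> mf f0; apply: measurable_fun_integral_kernel => // A mA.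
exact: measurable_kernel.
Qed.

Let nnsfun_laplace (f : {nnsfun S >-> R}) :
  \int[P]_w expN (\int[N w]_x (f x)%:E) = expN (\int[nu]_x onemexpN (f x)%:E).
Proof.
have [Npois Nindep] := N_poisson.
rewrite (integral_level_sum nu (phi := fun r => onemexpN r%:E)); last first.
  by move=> i; rewrite onemexpN_ge0// lee_fin level_ge0.
have mB := @measurable_level_set _ _ _ f.
rewrite expN_sum; last first.
  by move=> i; rewrite mule_ge0// onemexpN_ge0// lee_fin level_ge0.
transitivity (\int[P]_w \prod_(i < _) expN ((level f i)%:E * N w (level_set f i))).
  apply: eq_integral => w _; rewrite -expN_sum; last first.
    by move=> i; rewrite mule_ge0// lee_fin level_ge0.
  congr expN; rewrite (integral_level_sum (N w) (phi := EFin))// => i.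
  by rewrite lee_fin level_ge0.
rewrite (@independent_expectation_prod _ _ _ P _ (fun i w => N w (level_set f i))
  _ _ (fun i y => expN ((level f i)%:E * y))).
- apply: eq_bigr => i _; apply: is_poisson_laplace => //.
  + exact: measurable_kernel.
  + exact: level_ge0.
  + exact: Npois.
- by move=> i; exact: measurable_kernel.
- move=> C mC; apply: Nindep => //; exact: trivIset_level_set.
- move=> i; apply: measurableT_comp; first exact: measurable_expN.
  exact: measurable_funeM.
- by move=> i y; exact: expN_ge0.
Qed.

Let expectation_onemexpN (Y : Omega -> \bar R) :
  measurable_fun setT Y -> (forall w, 0 <= Y w) ->
  \int[P]_w expN (Y w) + \int[P]_w onemexpN (Y w) = 1.
Proof.
move=> mY Y0; rewrite -ge0_integralD//.
- under eq_integral do rewrite onemexpNK//.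
  by rewrite integral_cst//= probability_setT mule1.
- by move=> w _; exact: expN_ge0.
- by apply: measurableT_comp => //; exact: measurable_expN.
- by move=> w _; exact: onemexpN_ge0.
- by apply: measurableT_comp => //; exact: measurable_onemexpN.
Qed.

(** Independence and the Poisson law give the formula for simple functions;
    the general case follows since [1 - exp (- x)] is increasing, so that both
    sides pass to monotone limits. *)
Lemma laplace_functional (f : S -> \bar R) :
  measurable_fun setT f -> (forall x, 0 <= f x) ->
  \int[P]_w expN (\int[N w]_x f x) = expN (\int[nu]_x onemexpN (f x)).
Proof.
move=> mf f0.
pose g := nnsfun_approx measurableT mf.
have g0 n x : 0 <= (g n x)%:E by rewrite lee_fin.
have mg n : measurable_fun setT (fun x => (g n x)%:E) by exact/measurable_EFinP.
have ndg x : nondecreasing_seq (fun n => (g n x)%:E).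
  by move=> m n mn; rewrite lee_fin; exact/lefP/nd_nnsfun_approx.
have gf x : (g n x)%:E @[n --> \oo] --> f x by exact: cvg_nnsfun_approx.
have fE x : limn (fun n => (g n x)%:E) = f x by exact/cvg_lim.
have mo : measurable_fun setT (@onemexpN R) := @measurable_onemexpN R.
have cvgN w : \int[N w]_x (g n x)%:E @[n --> \oo] --> \int[N w]_x f x.
  under [X in _ --> X]eq_integral do rewrite -fE.
  exact: cvg_monotone_convergence.
have ndN w : nondecreasing_seq (fun n => \int[N w]_x (g n x)%:E).
  by move=> m n mn; apply: ge0_le_integral => // x _; exact: ndg.
have N0 n w : 0 <= \int[N w]_x (g n x)%:E by exact: integral_ge0.
have mN n : measurable_fun setT (fun w => \int[N w]_x (g n x)%:E).
  exact: measurable_kernel_integral.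
have mNf := measurable_kernel_integral mf f0.
have Nf0 w : 0 <= \int[N w]_x f x by exact: integral_ge0.
have lim1 : \int[P]_w onemexpN (\int[N w]_x (g n x)%:E) @[n --> \oo] -->
    \int[P]_w onemexpN (\int[N w]_x f x).
  rewrite (eq_integral (fun w =>
      limn (fun n => onemexpN (\int[N w]_x (g n x)%:E)))); last first.
    by move=> w _; apply/esym/cvg_lim => //; exact: cvg_onemexpN.
  apply: cvg_monotone_convergence => //.
  - by move=> n; exact: measurableT_comp.
  - by move=> n w _; exact: onemexpN_ge0.
  - by move=> w _ m n mn; apply: onemexpN_le; exact: ndN.
have lim2 : expN (\int[nu]_x onemexpN (g n x)%:E) @[n --> \oo] -->
    expN (\int[nu]_x onemexpN (f x)).
  apply: cvg_expN.
    by move=> n; apply: integral_ge0 => x _; exact: onemexpN_ge0.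
  rewrite (eq_integral (fun x => limn (fun n => onemexpN (g n x)%:E))); last first.
    by move=> x _; apply/esym/cvg_lim => //; exact: cvg_onemexpN.
  apply: cvg_monotone_convergence => //.
  - by move=> n; apply: measurableT_comp => //; exact: mg.
  - by move=> n x _; exact: onemexpN_ge0.
  - by move=> x _ m n mn; apply: onemexpN_le; exact: ndg.
have eqE (Y : Omega -> \bar R) : measurable_fun setT Y -> (forall w, 0 <= Y w) ->
    \int[P]_w expN (Y w) = 1 - \int[P]_w onemexpN (Y w).
  move=> mY Y0; have H := expectation_onemexpN mY Y0.
  have fo : \int[P]_w onemexpN (Y w) \is a fin_num.
    rewrite ge0_fin_numE; last first.
      by apply: integral_ge0 => w _; exact: onemexpN_ge0.
    apply: (@le_lt_trans _ _ 1); last exact: ltry.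
    by rewrite -H leeDr//; apply: integral_ge0 => w _; exact: expN_ge0.
  by rewrite -H addeK.
rewrite eqE//; apply/esym; apply: cvg_unique lim2 _ => //=.
under eq_fun do rewrite -nnsfun_laplace eqE//.
by apply: cvgeB => //; exact: cvg_cst.
Qed.

(** Differentiating the Laplace functional at [f] in the direction [g]. The
    bounds [x * exp (- x) <= 1 - exp (- x) <= x] sandwich the difference quotient
    between two products of monotone sequences with the same limit. *)
Lemma mecke_formula (f g : S -> \bar R) :
  measurable_fun setT f -> (forall x, 0 <= f x) ->
  measurable_fun setT g -> (forall x, 0 <= g x) ->
  {ae P, forall w, \int[N w]_x g x < +oo} ->
  \int[P]_w (expN (\int[N w]_x f x) * \int[N w]_x g x) =
  \int[P]_w expN (\int[N w]_x f x) * \int[nu]_x (expN (f x) * g x).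
Proof.
move=> mf f0 mg g0 Ng_fin.
pose Nf w := \int[N w]_x f x; pose Ng w := \int[N w]_x g x.
have Nf0 w : 0 <= Nf w by exact: integral_ge0.
have Ng0 w : 0 <= Ng w by exact: integral_ge0.
have mNf : measurable_fun setT Nf := measurable_kernel_integral mf f0.
have mNg : measurable_fun setT Ng := measurable_kernel_integral mg g0.
pose fg k x := f x + (step k)%:E * g x.
have sg0 k x : 0 <= (step k)%:E * g x by exact: step_ge0.
have msg k : measurable_fun setT (fun x => (step k)%:E * g x).
  exact: measurable_funeM.
have fg0 k x : 0 <= fg k x by rewrite adde_ge0.
have mfg k : measurable_fun setT (fg k) by exact: emeasurable_funD.
have me : measurable_fun setT (@expN R) := @measurable_expN R.
have mo : measurable_fun setT (@onemexpN R) := @measurable_onemexpN R.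
have mexp (Y : Omega -> \bar R) : measurable_fun setT Y ->
    measurable_fun setT (fun w => expN (Y w)) by move=> mY; exact: measurableT_comp.
have mexpS (Y : S -> \bar R) : measurable_fun setT Y ->
    measurable_fun setT (fun w => expN (Y w)) by move=> mY; exact: measurableT_comp.
have NfgE k w : \int[N w]_x fg k x = Nf w + (step k)%:E * Ng w.
  rewrite ge0_integralD// ge0_integralZl// lee_fin ltW//; exact: step_gt0.
pose L := \int[P]_w expN (Nf w).
pose Lk k := \int[P]_w expN (\int[N w]_x fg k x).
pose D k := \int[nu]_x (expN (f x) * quot k (g x)).
pose c k := \int[P]_w (expN (Nf w) * quot k (Ng w)).
have Lk0 k : 0 <= Lk k by apply: integral_ge0 => w _; exact: expN_ge0.
have L0 : 0 <= L by apply: integral_ge0 => w _; exact: expN_ge0.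
have eq0 x y : 0 <= x -> 0 <= y -> 0 <= expN x * y :> \bar R.
  by move=> x0 y0; rewrite mule_ge0// expN_ge0.
have D0 k : 0 <= D k.
  by apply: integral_ge0 => x _; apply: eq0 => //; exact: quot_ge0.
have c0 k : 0 <= c k.
  by apply: integral_ge0 => x _; apply: eq0 => //; exact: quot_ge0.
have s0 k : 0 <= (step k)%:E :> \bar R by rewrite lee_fin ltW// step_gt0.
have mqS k : measurable_fun setT (fun x => expN (f x) * quot k (g x)).
  apply: emeasurable_funM; first exact: mexpS.
  by apply: measurableT_comp => //; exact: measurable_quot.
have mqO k : measurable_fun setT (fun w => expN (Nf w) * quot k (Ng w)).
  apply: emeasurable_funM; first exact: mexp.
  by apply: measurableT_comp => //; exact: measurable_quot.
(* the two forms of the increment of the Laplace functional *)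
have Linc k : L = Lk k + (step k)%:E * c k.
  rewrite -ge0_integralZl//; last by move=> w _; apply: eq0 => //; exact: quot_ge0.
  rewrite -ge0_integralD//.
  - apply: eq_integral => w _; rewrite NfgE (expND (Nf0 w) (step_ge0 k (Ng0 w))).
    rewrite [X in _ + X]muleCA -ge0_muleDr ?expN_ge0//.
      by rewrite quotK// mule1.
    by rewrite mule_ge0// quot_ge0.
  - by move=> w _; exact: expN_ge0.
  - by apply: mexp; exact: measurable_kernel_integral.
  - by move=> w _; rewrite mule_ge0// eq0// quot_ge0.
  - exact: measurable_funeM.
have Lfac k : Lk k = L * expN ((step k)%:E * D k).
  rewrite /Lk /L !laplace_functional// -expND; last 2 first.
  - by apply: integral_ge0 => x _; exact: onemexpN_ge0.
  - exact: mule_ge0.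
  congr expN; rewrite -ge0_integralZl//; last first.
    by move=> x _; apply: eq0 => //; exact: quot_ge0.
  rewrite -ge0_integralD//.
  - apply: eq_integral => x _; rewrite (onemexpND (f0 x) (sg0 k x)); congr (_ + _).
    by rewrite [RHS]muleCA; congr (_ * _); rewrite /quot muleA -EFinM stepV mul1e.
  - by move=> x _; exact: onemexpN_ge0.
  - exact: measurableT_comp.
  - by move=> x _; rewrite mule_ge0// eq0// quot_ge0.
  - exact: measurable_funeM.
have cE k : c k = L * ((2%:R ^+ k)%:E * onemexpN ((step k)%:E * D k)).
  have Lf : Lk k \is a fin_num.
    rewrite ge0_fin_numE//; apply: (@le_lt_trans _ _ (\int[P]_w 1)).
      apply: ge0_le_integral => //.
      + by move=> w _; exact: expN_ge0.
      + by apply: mexp; exact: measurable_kernel_integral.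
      + by move=> w _; apply: expN_le1; exact: integral_ge0.
    by rewrite integral_cst//= probability_setT mule1 ltry.
  have sD0 : 0 <= (step k)%:E * D k by exact: mule_ge0.
  have : (step k)%:E * c k = L * onemexpN ((step k)%:E * D k).
    have : Lk k + (step k)%:E * c k = Lk k + L * onemexpN ((step k)%:E * D k).
      rewrite -Linc {1}Lfac -ge0_muleDr ?expN_ge0 ?onemexpN_ge0//.
      by rewrite onemexpNK// mule1.
    by move/(congr1 (fun x => x - Lk k)); rewrite !(addeC (Lk k)) !addeK.
  move/(congr1 (fun x => (2%:R ^+ k)%:E * x)); rewrite muleA -EFinM mulrC stepV.
  by rewrite mul1e => ->; rewrite muleCA.
have ndD : nondecreasing_seq D.
  move=> m n mn; apply: ge0_le_integral => //.
  - by move=> x _; apply: eq0 => //; exact: quot_ge0.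
  - by move=> x _; rewrite lee_wpmul2l ?expN_ge0// quot_nd.
have cvgquot (x y : \bar R) : 0 <= y -> expN x * quot k y @[k --> \oo] --> expN x * y.
  move=> y0; apply: ge0_cvgeZl => //; first exact: expN_ge0.
  - by move=> k; exact: quot_ge0.
  - exact: quot_nd.
  - exact: cvg_quot.
have cvgD : D k @[k --> \oo] --> \int[nu]_x (expN (f x) * g x).
  rewrite (eq_integral (fun x => limn (fun k => expN (f x) * quot k (g x)))).
    apply: cvg_monotone_convergence => //.
    - by move=> n x _; apply: eq0 => //; exact: quot_ge0.
    - by move=> x _ m n mn; rewrite lee_wpmul2l ?expN_ge0// quot_nd.
  by move=> x _; apply/esym/cvg_lim => //; exact: cvgquot.
have cvgc : c k @[k --> \oo] --> \int[P]_w (expN (Nf w) * Ng w).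
  rewrite (eq_integral (fun w => limn (fun k => expN (Nf w) * quot k (Ng w)))).
    apply: cvg_monotone_convergence => //.
    - by move=> n w _; apply: eq0 => //; exact: quot_ge0.
    - by move=> w _ m n mn; rewrite lee_wpmul2l ?expN_ge0// quot_nd.
  by move=> w _; apply/esym/cvg_lim => //; exact: cvgquot.
have step_le m n : (m <= n)%N -> (step n <= step m :> R)%R.
  by move=> mn; rewrite /step lef_pV2 ?posrE ?exprn_gt0// ler_eXn2l// ltr1n.
have ndLk : nondecreasing_seq Lk.
  move=> m n mn; apply: ge0_le_integral => //.
  - by move=> w _; exact: expN_ge0.
  - by apply: mexp; exact: measurable_kernel_integral.
  - by apply: mexp; exact: measurable_kernel_integral.
  - move=> w _; apply: expN_le; rewrite !NfgE leeD2l// lee_wpmul2r// lee_fin.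
    exact: step_le.
have cvgstep (y : \bar R) : 0 <= y -> y < +oo ->
    (step k)%:E * y @[k --> \oo] --> 0.
  case: y => [r| |]// r0 _; rewrite -(mul0e r%:E); apply: cvgeZr => //.
  exact: cvg_step.
have mexpfg k : measurable_fun setT (fun w => expN (\int[N w]_x fg k x)).
  by apply: mexp; exact: measurable_kernel_integral.
have ndexpfg w : nondecreasing_seq (fun k => expN (\int[N w]_x fg k x)).
  move=> m n mn; apply: expN_le; rewrite !NfgE leeD2l// lee_wpmul2r// lee_fin.
  exact: step_le.
have cvgLk : Lk k @[k --> \oo] --> L.
  have -> : L = \int[P]_w limn (fun k => expN (\int[N w]_x fg k x)).
    apply: ge0_ae_eq_integral => //.
    - exact: mexp.
    - apply: (emeasurable_fun_cvg (fun k w => expN (\int[N w]_x fg k x))) => // w _.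
      exact: ereal_nondecreasing_is_cvgn.
    - by move=> w _; exact: expN_ge0.
    - move=> w _; apply: lime_ge; first exact: ereal_nondecreasing_is_cvgn.
      by apply: nearW => k; exact: expN_ge0.
    - apply: filterS Ng_fin => w Ngw _; apply/esym/cvg_lim => //.
      apply: cvg_expN; first by move=> k; exact: integral_ge0.
      have : Nf w + (step k)%:E * Ng w @[k --> \oo] --> Nf w + 0.
        by apply: cvgeD; [rewrite fin_num_adde_defl|exact: cvg_cst|exact: cvgstep].
      by rewrite adde0; under eq_fun do rewrite -NfgE.
  apply: cvg_monotone_convergence => //.
  by move=> k w _; exact: expN_ge0.
apply: cvg_unique cvgc _ => //=.
apply: (@squeeze_cvge _ _ _ _ (fun k => Lk k * D k) _ (fun k => L * D k)).
- apply: nearW => k; rewrite cE; apply/andP; split.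
    rewrite Lfac -muleA lee_wpmul2l//.
    rewrite [leLHS](_ : _ = (2%:R ^+ k)%:E *
        ((step k)%:E * D k * expN ((step k)%:E * D k))).
      by rewrite lee_wpmul2l ?lee_fin ?exprn_ge0// onemexpN_ge// mule_ge0.
    by rewrite !muleA -EFinM mulrC stepV mul1e muleC.
  rewrite lee_wpmul2l//.
  apply: (@le_trans _ _ ((2%:R ^+ k)%:E * ((step k)%:E * D k))).
    by rewrite lee_wpmul2l ?lee_fin ?exprn_ge0// onemexpN_le_id// mule_ge0.
  by rewrite muleA -EFinM mulrC stepV mul1e.
- exact: ge0_nd_cvgeM.
- exact: ge0_cvgeZl.
Qed.

End poisson_random_measure.

(** * Laplace transforms of a kernel *)

Section kernel_laplace.
Context d (T : measurableType d) (R : realType).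
Variable rho : R.-ker T ~> measurableTypeR R.
Implicit Types (w : R -> \bar R) (z : T) (a : R).

Definition weight w := measurable_fun setT w /\ forall s, (0 < s)%R -> 0 <= w s.

(** The Laplace transform at [a] of the measure [w(s) rho_z(ds)] of the positive
    half-line; [tau_m] is the case [w(s) = s ^ m]. *)
Definition lap w z a : \bar R :=
  \int[rho z]_(s in `]0%R, +oo[) (w s * (expR (- (s * a)))%:E).

Definition lap_integrand w a (s : R) := if (0 < s)%R then w s * (expR (- (s * a)))%:E else 0.

Lemma lapE w z a : lap w z a = \int[rho z]_s lap_integrand w a s.
Proof.
rewrite /lap integral_mkcond; apply: eq_integral => s _.
by rewrite patchE mem_setE in_itv/= andbT /lap_integrand; case: ifP.
Qed.

Lemma lap_integrand_ge0 w a s : weight w -> 0 <= lap_integrand w a s.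
Proof.
move=> [_ w0]; rewrite /lap_integrand; case: ifPn => // s0.
by rewrite mule_ge0 ?w0// lee_fin expR_ge0.
Qed.

Lemma measurable_lap_integrand w a : weight w ->
  measurable_fun setT (lap_integrand w a).
Proof.
move=> [mw _]; apply: measurable_fun_ifT => //.
- by apply: measurable_fun_ltr; [exact: measurable_cst|exact: measurable_id].
- apply: emeasurable_funM => //; apply/measurable_EFinP.
  apply: measurableT_comp; first exact: measurable_expR.
  by apply: measurable_funN; exact: mulrr_measurable.
Qed.

Lemma lap_ge0 w z a : weight w -> 0 <= lap w z a.
Proof. by move=> w0; rewrite lapE; apply: integral_ge0 => s _; exact: lap_integrand_ge0. Qed.

Let measurable_lap1 w a : weight w -> measurable_fun setT (lap w ^~ a).
Proof.
move=> w0; under eq_fun do rewrite lapE.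
apply: measurable_fun_integral_kernel.
- by move=> U mU; exact: measurable_kernel.
- by move=> s; exact: lap_integrand_ge0.
- exact: measurable_lap_integrand.
Qed.

Lemma lap_nincr w z a b : weight w -> (a <= b)%R -> lap w z b <= lap w z a.
Proof.
move=> w0 ab; rewrite !lapE; apply: ge0_le_integral => //.
- by move=> s _; exact: lap_integrand_ge0.
- exact: measurable_lap_integrand.
- exact: measurable_lap_integrand.
- move=> s _; rewrite /lap_integrand; case: ifPn => // s0.
  rewrite lee_wpmul2l ?(proj2 w0)// lee_fin ler_expR lerN2.
  by rewrite ler_wpM2l// ltW.
Qed.

Lemma step_le (m n : nat) : (m <= n)%N -> (step n <= step m :> R)%R.
Proof.
by move=> mn; rewrite /step lef_pV2 ?posrE ?exprn_gt0// ler_eXn2l// ltr1n.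
Qed.

Lemma lap_rcont w z a : weight w -> lap w z (a + step k)%R @[k --> \oo] --> lap w z a.
Proof.
move=> w0; under eq_fun do rewrite lapE.
rewrite lapE (eq_integral (fun s : measurableTypeR R => limn (fun k => lap_integrand w (a + step k)%R s))).
  apply: cvg_monotone_convergence => //.
  - by move=> k; exact: measurable_lap_integrand.
  - by move=> k s _; exact: lap_integrand_ge0.
  - move=> s _ m n mn; rewrite /lap_integrand; case: ifPn => // s0.
    rewrite lee_wpmul2l ?(proj2 w0)// lee_fin ler_expR lerN2.
    by rewrite ler_wpM2l ?lerD2l ?step_le// ltW.
move=> s _; apply/esym/cvg_lim => //; rewrite /lap_integrand.
case: ifPn => s0; last exact: cvg_cst.
apply: ge0_cvgeZl.
- exact: (proj2 w0).
- by move=> k; rewrite lee_fin expR_ge0.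
- move=> m n mn; rewrite lee_fin ler_expR lerN2.
  by rewrite ler_wpM2l ?lerD2l ?step_le// ltW.
apply: cvg_EFin; first exact: nearW.
apply: (@continuous_cvg _ _ _ _ _ _ expR) => //; first exact: continuous_expR.
apply: cvgN; apply: cvgM; first exact: cvg_cst.
have /fine_cvgP[_ step0] := @cvg_step R.
have : (a + step k)%R @[k --> \oo] --> (a + 0)%R.
  by apply: cvgD; [exact: cvg_cst|exact: step0].
by rewrite addr0.
Qed.

(** The kernel is only assumed sigma-finite pointwise, so integrals depending on
    a parameter need not be measurable in general; here monotonicity and right
    continuity in the parameter give joint measurability. *)
Lemma measurable_lap w : weight w ->
  measurable_fun [set: T * R] (fun p => lap w p.1 p.2).
Proof.
move=> w0; apply: (measurability _ (ErealGenOInfty.measurableE R)).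
move=> _ [_ [c ->] <-]; rewrite setTI.
rewrite (_ : _ @^-1` _ = \bigcup_(q : rat)
    ([set z | c%:E < lap w z (ratr q)] `*` [set a | (a < ratr q)%R])).
  apply: bigcupT_measurable_rat => q; apply: measurableX.
    rewrite -[X in measurable X]setTI; apply: emeasurable_fun_o_infty => //.
    exact: measurable_lap1.
  have -> : [set a | (a < ratr q)%R] = `]-oo, (ratr q : R)[%classic.
    by apply/seteqP; split => a; rewrite /= in_itv/=.
  exact: measurable_itv.
apply/seteqP; split => [[z a]/=|[z a] [q _ [/= cq aq]]].
  rewrite in_itv/= andbT => ca.
  have [k ck] : exists k, c%:E < lap w z (a + step k)%R.
    apply/not_existsP => H; move: ca; apply/negP; rewrite -leNgt.
    rewrite -(cvg_lim _ (@lap_rcont w z a w0))//.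
    apply: lime_le; first by apply/cvg_ex; eexists; exact: lap_rcont.
    by apply: nearW => k; rewrite leNgt; apply/negP; exact: H.
  have /rat_in_itvoo[q] : (a < a + step k)%R by rewrite ltrDl step_gt0.
  rewrite in_itv/= => /andP[aq qa]; exists q; [by []|split; last exact: aq].
  by apply: (lt_le_trans ck); apply: lap_nincr => //; exact: ltW.
rewrite in_itv/= andbT; apply: (lt_le_trans cq); apply: lap_nincr => //.
exact: ltW.
Qed.

Lemma weight_quot w k : weight w -> weight (fun s => w s * quot k s%:E).
Proof.
move=> [mw w0]; split.
  apply: emeasurable_funM => //.
  by apply: measurableT_comp; [exact: measurable_quot|exact/measurable_EFinP].
by move=> s s0; rewrite mule_ge0 ?w0// quot_ge0// lee_fin ltW.
Qed.

Lemma weightX m : weight (fun s => (s ^+ m)%:E).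
Proof.
split; first by apply/measurable_EFinP; exact: exprn_measurable.
by move=> s s0; rewrite lee_fin exprn_ge0// ltW.
Qed.

(** Writing the increment over a step as a sum avoids subtracting possibly infinite
    transforms; the second term tends to the opposite of the derivative. *)
Lemma lap_increment w k z a : weight w ->
  lap w z a = lap w z (a + step k)%R +
              (step k)%:E * lap (fun s => w s * quot k s%:E) z a.
Proof.
move=> w0; have wq := weight_quot k w0.
have st0 : 0 <= (step k : R)%:E by rewrite lee_fin ltW// step_gt0.
rewrite !lapE -ge0_integralZl//; last 2 first.
- exact: measurable_lap_integrand.
- by move=> s _; exact: lap_integrand_ge0.
rewrite -ge0_integralD//; last 4 first.
- by move=> s _; exact: lap_integrand_ge0.
- exact: measurable_lap_integrand.
- by move=> s _; rewrite mule_ge0// lap_integrand_ge0.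
- by apply: measurable_funeM; exact: measurable_lap_integrand.
apply: eq_integral => s _; rewrite /lap_integrand; case: ifPn => s0; last first.
  by rewrite mule0 adde0.
have ws0 := proj2 w0 s s0.
have sE : 0 <= s%:E by rewrite lee_fin ltW.
have q0 : 0 <= quot k s%:E by exact: quot_ge0.
have e0 : 0 <= (expR (- (s * a)))%:E by rewrite lee_fin expR_ge0.
rewrite mulrDr opprD expRD EFinM.
rewrite [X in _ = _ + X](_ : _ =
    w s * ((expR (- (s * a)))%:E * ((step k)%:E * quot k s%:E))); last first.
  rewrite -(muleA (w s)) (muleCA _ (w s)); congr (_ * _).
  by rewrite (muleC (quot _ _)) (muleCA (step k)%:E).
rewrite -ge0_muleDr; last 2 first.
- by rewrite mule_ge0// lee_fin expR_ge0.
- by apply: mule_ge0 => //; exact: mule_ge0.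
rewrite -ge0_muleDr; last 2 first.
- by rewrite lee_fin expR_ge0.
- by rewrite mule_ge0.
rewrite [X in X + _](_ : _ = expN ((step k)%:E * s%:E)).
  by rewrite quotK// mule1.
by rewrite -EFinM expN_fin mulrC.
Qed.

Lemma lap_quot_nd w z a : weight w ->
  nondecreasing_seq (fun k => lap (fun s => w s * quot k s%:E) z a).
Proof.
move=> w0 m n mn; rewrite !lapE; apply: ge0_le_integral => //.
- by move=> s _; apply: lap_integrand_ge0; exact: weight_quot.
- by apply: measurable_lap_integrand; exact: weight_quot.
- by apply: measurable_lap_integrand; exact: weight_quot.
- move=> s _; rewrite /lap_integrand; case: ifPn => // s0.
  rewrite lee_wpmul2r ?lee_fin ?expR_ge0// lee_wpmul2l ?(proj2 w0)//.
  by rewrite quot_nd// lee_fin ltW.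
Qed.

Lemma cvg_lap_quot w z a : weight w ->
  lap (fun s => w s * quot k s%:E) z a @[k --> \oo] --> lap (fun s => w s * s%:E) z a.
Proof.
move=> w0; under eq_fun do rewrite lapE.
rewrite lapE (eq_integral (fun s : measurableTypeR R => limn (fun k =>
    lap_integrand (fun s => w s * quot k s%:E) a s))).
  apply: cvg_monotone_convergence => //.
  - by move=> k; apply: measurable_lap_integrand; exact: weight_quot.
  - by move=> k s _; apply: lap_integrand_ge0; exact: weight_quot.
  - move=> s _ m n mn; rewrite /lap_integrand; case: ifPn => // s0.
    rewrite lee_wpmul2r ?lee_fin ?expR_ge0// lee_wpmul2l ?(proj2 w0)//.
    by rewrite quot_nd// lee_fin ltW.
move=> s _; apply/esym/cvg_lim => //; rewrite /lap_integrand.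
case: ifPn => s0; last exact: cvg_cst.
have s0' : 0 <= s%:E by rewrite lee_fin ltW.
rewrite muleAC; under eq_fun do rewrite muleAC.
apply: ge0_cvgeZl.
- by rewrite mule_ge0 ?(proj2 w0)// lee_fin expR_ge0.
- by move=> k; exact: quot_ge0.
- exact: quot_nd.
- exact: cvg_quot.
Qed.

End kernel_laplace.

(** * Product intensities *)

Section step_functions.
Context d (T : measurableType d) (R : realType).

(** The exponents of the Laplace functional range over a class that is stable under
    the perturbations [t * \1_A] along which it is differentiated. *)
Inductive step_function : (T -> R) -> Prop :=
| step_function_cst c : step_function (fun=> c)
| step_function_add al t A : step_function al -> measurable A ->
    step_function (fun z => al z + t * \1_A z)%R.

Lemma measurable_step_function al : step_function al -> measurable_fun setT al.
Proof.
elim=> [c|{}al t A _ mal mA]; first exact: measurable_cst.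
by apply: measurable_funD => //; apply: measurable_funM.
Qed.

End step_functions.

Section product_intensity.
Context d (T : measurableType d) (R : realType).
Variables (eta : {measure set T -> \bar R}) (rho : R.-ker T ~> measurableTypeR R).
Variable nu : {measure set (T * measurableTypeR R) -> \bar R}.
Hypothesis nuE : forall (A : set T) (B : set (measurableTypeR R)),
  measurable A -> measurable B -> nu (A `*` B) = \int[eta]_(x in A) rho x B.

Lemma integral_intensity_prod (A : set T) (g : measurableTypeR R -> \bar R) :
  measurable A -> measurable_fun setT g -> (forall s, 0 <= g s) ->
  \int[nu]_p ((\1_A p.1)%:E * g p.2) = \int[eta]_(x in A) \int[rho x]_s g s.
Proof.
move=> mA mg g0.
have mA1 : measurable_fun [set: T * measurableTypeR R] (fun p => (\1_A p.1 : R)%:E).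
  apply/measurable_EFinP; exact: measurableT_comp.
have A0 (p : T * measurableTypeR R) : 0 <= (\1_A p.1 : R)%:E by rewrite lee_fin.
have mcomp (f : measurableTypeR R -> \bar R) : measurable_fun setT f ->
    measurable_fun setT (fun p : T * measurableTypeR R => (\1_A p.1)%:E * f p.2).
  by move=> mf; apply: emeasurable_funM => //; exact: measurableT_comp.
have mint (f : measurableTypeR R -> \bar R) : measurable_fun setT f ->
    (forall s, 0 <= f s) -> measurable_fun A (fun x => \int[rho x]_s f s).
  move=> mf f0; apply: measurable_funTS.
  apply: measurable_fun_integral_kernel => // U mU; exact: measurable_kernel.
have rA : A `<=` setT by [].
move: g mg g0; apply: ge0_measurable_ind.
- move=> B mB.
  transitivity (nu (A `*` B)).
    rewrite -[in RHS](setIT (A `*` B)) -integral_indic//; last exact: measurableX.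
    apply: eq_integral => -[x s] _ /=; rewrite -EFinM; congr EFin.
    by rewrite !indicE -natrM mulnb in_setX.
  rewrite nuE//; apply: eq_integral => x _.
  by rewrite integral_indic ?setIT.
- move=> k f k0 mf f0 IH /=.
  rewrite (eq_integral (fun p => k%:E * ((\1_A p.1)%:E * f p.2))); last first.
    by move=> p _; rewrite muleCA.
  rewrite ge0_integralZl_EFin; [|by []|by move=> p _; rewrite mule_ge0| |by []].
    rewrite IH -ge0_integralZl_EFin; [|by []| |exact: mint|by []].
      apply: eq_integral => x _.
      by rewrite ge0_integralZl_EFin; [|by []|move=> s _; exact: f0|exact: mf|by []].
    by move=> x _; exact: integral_ge0.
  exact: mcomp.
- move=> f g mf f0 mg g0 IHf IHg /=.
  rewrite (eq_integral (fun p => (\1_A p.1)%:E * f p.2 + (\1_A p.1)%:E * g p.2)); last first.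
    by move=> p _; rewrite ge0_muleDr.
  rewrite ge0_integralD; first last.
  + exact: mcomp.
  + by move=> p _; rewrite mule_ge0.
  + exact: mcomp.
  + by move=> p _; rewrite mule_ge0.
  + by [].
  rewrite IHf IHg -ge0_integralD; first last.
  + exact: mint.
  + by move=> x _; exact: integral_ge0.
  + exact: mint.
  + by move=> x _; exact: integral_ge0.
  + by [].
  apply: eq_integral => x _; rewrite ge0_integralD; first by [].
  + by [].
  + by move=> s _; exact: f0.
  + exact: mf.
  + by move=> s _; exact: g0.
  + exact: mg.
- move=> f mf f0 ndf IH /=.
  rewrite (eq_integral (fun p => limn (fun n => (\1_A p.1)%:E * f n p.2))); last first.
    by move=> p _; rewrite ge0_limnZl.
  rewrite monotone_convergence//; last 3 first.
  + by move=> n; exact: mcomp.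
  + by move=> n p _; rewrite mule_ge0.
  + by move=> p _ m n mn; rewrite lee_wpmul2l// ndf.
  transitivity (\int[eta]_(x in A) limn (fun n => \int[rho x]_s f n s)).
    rewrite monotone_convergence//.
    + by congr (limn _); apply/funext.
    + by move=> n; exact: mint.
    + by move=> n x _; exact: integral_ge0.
    + move=> x _ m n mn; apply: ge0_le_integral => // s _; exact: ndf.
  by apply: eq_integral => x _; rewrite monotone_convergence// => s _; exact: ndf.
Qed.

Lemma measurable_lap_comp w (al : T -> R) : weight w -> measurable_fun setT al ->
  measurable_fun setT (fun z => lap rho w z (al z)).
Proof.
move=> w0 mal.
apply: (measurableT_comp (measurable_lap rho w0) (g := fun z => (z, al z))).
exact: measurable_fun_pair.
Qed.

Lemma weight_expR w t : weight w ->
  weight (fun s : R => w s * (expR (- (s * t)))%:E).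
Proof.
move=> [mw w0]; split.
  apply: emeasurable_funM => //; apply/measurable_EFinP.
  apply: measurableT_comp; first exact: measurable_expR.
  by apply: measurable_funN; exact: mulrr_measurable.
by move=> s s0; rewrite mule_ge0 ?w0// lee_fin expR_ge0.
Qed.

Lemma lap_integrandD w (a t s : R) :
  lap_integrand w (a + t) s = lap_integrand (fun s => w s * (expR (- (s * t)))%:E) a s.
Proof.
rewrite /lap_integrand; case: ifP => // _.
by rewrite mulrDr opprD expRD EFinM -muleA (muleC (expR (- (s * t)))%:E).
Qed.

Lemma lapD w z (a t : R) :
  lap rho w z (a + t) = lap rho (fun s => w s * (expR (- (s * t)))%:E) z a.
Proof. by rewrite !lapE; apply: eq_integral => s _; rewrite lap_integrandD. Qed.

(** The kernel form [nu(dz, ds) = eta(dz) rho_z(ds)] is only known on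
    rectangles; for a step function the integrand is a finite sum of products,
    and splitting [A] along the last step gives the induction. *)
Lemma integral_intensity_lap (al : T -> R) : step_function al ->
  forall w A, weight w -> measurable A ->
  \int[nu]_p ((\1_A p.1)%:E * lap_integrand w (al p.1) p.2) =
  \int[eta]_(z in A) lap rho w z (al z).
Proof.
elim=> [c|{}al t B sal IH mB] w A w0 mA.
  rewrite (@integral_intensity_prod A (lap_integrand w c) mA); first last.
  - by move=> s; exact: lap_integrand_ge0.
  - exact: measurable_lap_integrand.
  by apply: eq_integral => z _; rewrite lapE.
have mal : measurable_fun setT al := measurable_step_function sal.
have wt := weight_expR t w0.
have mli A' w' : measurable A' -> weight w' -> measurable_fun
    [set: T * measurableTypeR R]
    (fun p => (\1_A' p.1)%:E * lap_integrand w' (al p.1) p.2).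
  move=> mA' [mw' w'0]; apply: emeasurable_funM.
    apply/measurable_EFinP; exact: measurableT_comp.
  apply: measurable_fun_ifT => //.
  - by apply: measurable_fun_ltr; [exact: measurable_cst|exact: measurable_snd].
  - apply: emeasurable_funM; first exact: (measurableT_comp mw' measurable_snd).
    apply/measurable_EFinP; apply: measurableT_comp; first exact: measurable_expR.
    apply: measurable_funN; apply: measurable_funM; first exact: measurable_snd.
    exact: measurableT_comp.
have li0 w' a s : weight w' -> 0 <= lap_integrand w' a s.
  by move=> w'0; exact: lap_integrand_ge0.
transitivity (\int[nu]_p (
   (\1_(A `&` B) p.1)%:E *
      lap_integrand (fun s => w s * (expR (- (s * t)))%:E) (al p.1) p.2 +
   (\1_(A `\` B) p.1)%:E * lap_integrand w (al p.1) p.2)).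
  apply: eq_integral => -[z s] _ /=; rewrite -lap_integrandD.
  rewrite !indicE in_setI in_setD.
  case: (z \in A) => /=; last by rewrite !mul0e adde0.
  case: (z \in B) => /=; first by rewrite mulr1 mul0e adde0.
  by rewrite mulr0 addr0 mul0e add0e.
have mAB := measurableI _ _ mA mB; have mADB := measurableD mA mB.
rewrite ge0_integralD; first last.
- exact: mli.
- by move=> p _; apply: mule_ge0; [rewrite lee_fin|exact: li0].
- exact: mli.
- by move=> p _; apply: mule_ge0; [rewrite lee_fin|exact: li0].
- by [].
have e1 : \int[eta]_(z in A `&` B) lap rho w z (al z + t * \1_B z)%R =
    \int[eta]_(z in A `&` B) lap rho (fun s => w s * (expR (- (s * t)))%:E) z (al z).
  apply: eq_integral => z /set_mem[zA zB].
  have zB1 : \1_B z = 1%R :> R by rewrite indicE mem_set.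
  rewrite zB1 mulr1; exact: lapD.
have e2 : \int[eta]_(z in A `\` B) lap rho w z (al z + t * \1_B z)%R =
    \int[eta]_(z in A `\` B) lap rho w z (al z).
  apply: eq_integral => z /set_mem[zA zB].
  have zB0 : \1_B z = 0%R :> R by rewrite indicE memNset.
  by rewrite zB0 mulr0 addr0.
have AE : (A `&` B) `|` (A `\` B) = A by rewrite setDE -setIUr setUv setIT.
rewrite -[in RHS]AE.
rewrite ge0_integral_setU; first last.
- by apply/disj_setPS => z [[_ zB] [_ /(_ zB)]].
- by move=> z _; exact: lap_ge0.
- apply: measurable_funTS; apply: measurable_lap_comp; first exact: w0.
  exact: (measurable_step_function (step_function_add t sal mB)).
- exact: mADB.
- exact: mAB.
rewrite e1 e2 IH; [|exact: wt|exact: mAB].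
by rewrite IH; [|exact: w0|exact: mADB].
Qed.

End product_intensity.

(** * Measurability of the values of a sample *)

Section separable_metric.
Context (R : realType) (X : completeMetricType R).

Lemma open_ball_metric (x : X) (r : R) : open (ball x r).
Proof.
rewrite openE => y; rewrite ballEmdist/= => xy.
have r0 : (0 < r - mdist x y)%R by rewrite subr_gt0.
apply: (filterS _ (nbhsx_ballx y _ r0)) => z.
rewrite !ballEmdist/= => yz; rewrite (le_lt_trans (metric_triangle x y z))//.
by rewrite -ltrBrDl.
Qed.

Lemma measurable_borel_ball (x : X) (r : R) : measurable (ball x r : set (borel X)).
Proof. by apply: sub_sigma_algebra; exact: open_ball_metric. Qed.

Lemma measurable_borel_open (A : set X) : open A -> measurable (A : set (borel X)).
Proof. by move=> oA; exact: sub_sigma_algebra. Qed.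

Lemma step_lt (e : R) : (0 < e)%R -> exists k, (step k < e)%R.
Proof.
move=> e0; have /fine_cvgP[_ /cvgrPdist_lt/(_ e e0)] := @cvg_step R.
move=> [k _ /(_ k (leqnn k))]/=; rewrite sub0r normrN ger0_norm; first by exists k.
by rewrite ltW// step_gt0.
Qed.

Lemma eq_ball_step (x y : X) :
  (forall k, exists z, ball z (step k : R) x /\ ball z (step k) y) -> x = y.
Proof.
move=> H; apply: (@mdist_positivity R X); apply/eqP; rewrite eq_le mdist_ge0 andbT.
apply/ler_addgt0Pl => e e0; rewrite addr0.
have e20 : (0 < e / 2)%R by rewrite divr_gt0.
have [k ke] := step_lt e20; have [z []] := H k.
rewrite !ballEmdist/= => zx zy; rewrite (le_trans (metric_triangle x z y))//.
rewrite metric_sym (splitr e) lerD// ltW//.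
  exact: lt_trans zx ke.
exact: lt_trans zy ke.
Qed.

Lemma measurable_borel_set1 (x : borel X) : measurable [set x].
Proof.
rewrite (_ : [set x] = \bigcap_k (ball (x : X) (step k : R) : set (borel X))).
  by apply: bigcapT_measurable => k; exact: measurable_borel_ball.
apply/seteqP; split => [_ -> k _|y H]/=; first exact/ballxx/step_gt0.
apply: (@eq_ball_step y x) => k; exists x; split; first exact: H.
exact/ballxx/step_gt0.
Qed.

Lemma separable_seq : separable X -> exists q : nat -> X,
  forall (x : X) (r : R), (0 < r)%R -> exists k, ball x r (q k).
Proof.
move=> [D cD dD].
have /pfcard_geP[D0|[q]] := cD.
  have [y []] := dD setT (ex_intro _ point I) openT.
  by rewrite D0.
exists q => x r r0.
have [y [xy Dy]] := dD _ (ex_intro _ x (ballxx x r0)) (open_ball_metric x r).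
have [k _ qk] : (q @` setT) y by apply: (@surj _ _ _ _ q).
by exists k; rewrite qk.
Qed.

Hypothesis X_separable : separable X.
Context d (Omega : measurableType d).

(** Separability makes the diagonal a countable combination of rectangles of
    balls, hence equality of random points a measurable event. *)
Lemma measurable_eq_point (f g : Omega -> borel X) :
  measurable_fun setT f -> measurable_fun setT g ->
  measurable_fun setT (fun w => f w == g w).
Proof.
move=> mf mg; apply: (measurable_fun_bool true); rewrite setTI.
have [q qP] := separable_seq X_separable.
rewrite (_ : _ @^-1` _ = \bigcap_k \bigcup_j
    (f @^-1` (ball (q j) (step k : R)) `&` g @^-1` (ball (q j) (step k)))).
  apply: bigcapT_measurable => k; apply: bigcupT_measurable => j.
  apply: measurableI; rewrite -[X in measurable X]setTI.
    by apply: mf => //; exact: measurable_borel_ball.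
  by apply: mg => //; exact: measurable_borel_ball.
apply/seteqP; split => w /=.
  move=> /eqP fg k _; have [j jP] := qP (f w) (step k) (step_gt0 R k).
  by exists j => //=; rewrite /preimage/= -fg; split; exact: ball_sym.
move=> H; apply/eqP; apply: eq_ball_step => k.
by have [j _ [fj gj]] := H k I; exists (q j).
Qed.

Variables (I : Type) (F : I -> Omega -> borel X).
Hypothesis mF : forall i, measurable_fun setT (F i).

Lemma measurable_in_map (f : Omega -> borel X) (r : seq I) :
  measurable_fun setT f ->
  measurable_fun setT (fun w => f w \in [seq F i w | i <- r]).
Proof.
move=> mf; elim: r => [|i r IH]; first exact: measurable_cst.
rewrite (_ : (fun w => _) = fun w =>
  (f w == F i w) || (f w \in [seq F i w | i <- r])).
  by apply: measurable_or => //; exact: measurable_eq_point.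
by apply/funext => w /=; rewrite inE.
Qed.

Lemma measurable_count_map (f : Omega -> borel X) (r : seq I) :
  measurable_fun setT f ->
  measurable_fun setT (fun w => count_mem (f w) [seq F i w | i <- r]).
Proof.
move=> mf; elim: r => [|i r IH]; first exact: measurable_cst.
apply: measurable_fun_addn => //.
apply: (@measurableT_comp _ _ _ _ _ _ (nat_of_bool)) => //.
exact: measurable_eq_point.
Qed.

Lemma measurable_foldr_undup d' (V : measurableType d')
    (f : Omega -> borel X -> V -> V) (v0 : V) (r : seq I) :
  (forall i u, measurable_fun setT u ->
    measurable_fun setT (fun w => f w (F i w) (u w))) ->
  measurable_fun setT (fun w => foldr (f w) v0 (undup [seq F i w | i <- r])).
Proof.
move=> mf; elim: r => [|i r IH] /=; first exact: measurable_cst.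
rewrite (_ : (fun w => _) = fun w => if F i w \in [seq F i w | i <- r]
    then foldr (f w) v0 (undup [seq F i w | i <- r])
    else f w (F i w) (foldr (f w) v0 (undup [seq F i w | i <- r]))).
  apply: measurable_fun_ifT => //; first exact: measurable_in_map.
  exact: mf.
by apply/funext => w; case: ifP.
Qed.

Lemma measurable_big_undup (op : \bar R -> \bar R -> \bar R) (idx : \bar R)
    (G : Omega -> borel X -> \bar R) (r : seq I) :
  (forall u v : Omega -> \bar R, measurable_fun setT u -> measurable_fun setT v ->
    measurable_fun setT (fun w => op (u w) (v w))) ->
  (forall i, measurable_fun setT (fun w => G w (F i w))) ->
  measurable_fun setT
    (fun w => \big[op/idx]_(y <- undup [seq F i w | i <- r]) G w y).
Proof.
move=> mop mG.
rewrite (_ : (fun w => _) = fun w => foldr (fun y => op (G w y)) idx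
    (undup [seq F i w | i <- r])); last by apply/funext => w; rewrite unlock.
apply: (@measurable_foldr_undup _ _ (fun w y => op (G w y))) => i u mu.
exact: mop.
Qed.

Lemma measurable_nth_undup (G : Omega -> borel X -> \bar R) (r : seq I) (k : nat) :
  (forall i, measurable_fun setT (fun w => G w (F i w))) ->
  measurable_fun setT (fun w => if (k < size (undup [seq F i w | i <- r]))%N
    then G w (nth point (undup [seq F i w | i <- r]) k) else 0).
Proof.
move=> mG; elim: r k => [|i r IH] k /=; first exact: measurable_cst.
rewrite (_ : (fun w => _) = fun w => if F i w \in [seq F i w | i <- r]
    then if (k < size (undup [seq F i w | i <- r]))%N
      then G w (nth point (undup [seq F i w | i <- r]) k) else 0
    else if k is k'.+1 then
      if (k' < size (undup [seq F i w | i <- r]))%N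
      then G w (nth point (undup [seq F i w | i <- r]) k') else 0
    else G w (F i w)).
  apply: measurable_fun_ifT => //; first exact: measurable_in_map.
  by case: k => [|k]; [exact: mG|exact: IH].
by apply/funext => w /=; case: k {IH} => [|k] /=; case: (F i w \in _).
Qed.

Lemma measurable_nat_index (c : Omega -> nat) (G : nat -> Omega -> \bar R) :
  measurable_fun setT c -> (forall m, measurable_fun setT (G m)) ->
  measurable_fun setT (fun w => G (c w) w).
Proof.
move=> mc mG.
have mE m : measurable (c @^-1` [set m]).
  by rewrite -[X in measurable X]setTI; exact: mc.
have -> : [set: Omega] = \bigcup_m c @^-1` [set m].
  by apply/seteqP; split => // w _; exists (c w).
apply/measurable_fun_bigcup => // m.
apply: (eq_measurable_fun (G m)).
  by move=> w /[!inE] /= <-.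
exact: measurable_funTS.
Qed.

End separable_metric.

(** * The seating measures *)

Section seating_measure.
Context (R : realType) (X : completeMetricType R).
Variable eta : probability (borel X) R.

(** Total value of [F] over the continuations of [x]: the new point, put in front,
    is fresh or repeats one of the distinct points of [x]. *)
Definition extend n (F : n.+1.-tuple (borel X) -> \bar R) (x : n.-tuple (borel X)) : \bar R :=
  \int[eta]_z F [tuple of z :: x] + \sum_(y <- undup x) F [tuple of y :: x].

Lemma extend_ge0 n (F : n.+1.-tuple (borel X) -> \bar R) x :
  (forall t, 0 <= F t) -> 0 <= extend F x.
Proof.
by move=> F0; rewrite adde_ge0//; [exact: integral_ge0|exact: sume_ge0].
Qed.

Section measurability.
Hypothesis X_separable : separable X.

Lemma measurable_cons_pair n : measurable_fun
  [set: n.-tuple (borel X) * borel X] (fun p => [tuple of p.2 :: p.1]).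
Proof. exact: measurable_cons. Qed.

Lemma measurable_extend n (F : n.+1.-tuple (borel X) -> \bar R) :
  measurable_fun setT F -> (forall t, 0 <= F t) -> measurable_fun setT (extend F).
Proof.
move=> mF F0; apply: emeasurable_funD.
  apply: (@measurable_fun_fubini_tonelli_F _ _ _ _ _ eta
    (fun p : n.-tuple (borel X) * borel X => F [tuple of p.2 :: p.1])) => //.
  by apply: measurableT_comp => //; exact: measurable_cons_pair.
rewrite (_ : (fun x => _) = fun x : n.-tuple (borel X) =>
    \sum_(y <- undup [seq tnth x i | i <- enum 'I_n]) F [tuple of y :: x]).
  apply: (@measurable_big_undup _ _ X_separable _ _ _
    (fun i (x : n.-tuple (borel X)) => tnth x i) _ _ _
    (fun x y => F [tuple of y :: x])).
  - by move=> i; exact: measurable_tnth.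
  - by move=> u v mu mv; exact: emeasurable_funD.
  - move=> i; apply: measurableT_comp => //; apply: measurable_cons => //.
    exact: measurable_tnth.
by apply/funext => x; rewrite map_tnth_enum.
Qed.

Lemma extendZl n (k : R) (F : n.+1.-tuple (borel X) -> \bar R) x :
  (0 <= k)%R -> measurable_fun setT F -> (forall t, 0 <= F t) ->
  extend (fun t => k%:E * F t) x = k%:E * extend F x.
Proof.
move=> k0 mF F0; rewrite /extend ge0_integralZl_EFin//; last first.
  by apply: measurableT_comp => //; exact: measurable_cons.
have I0 : 0 <= \int[eta]_z F [tuple of z :: x] by exact: integral_ge0.
have S0 : 0 <= \sum_(y <- undup x) F [tuple of y :: x] by exact: sume_ge0.
by rewrite [RHS]ge0_muleDr// -ge0_sume_distrr.
Qed.

Lemma extendD n (F G : n.+1.-tuple (borel X) -> \bar R) x :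
  measurable_fun setT F -> (forall t, 0 <= F t) ->
  measurable_fun setT G -> (forall t, 0 <= G t) ->
  extend (fun t => F t + G t) x = extend F x + extend G x.
Proof.
move=> mF F0 mG G0; rewrite /extend ge0_integralD//; last 2 first.
- by apply: measurableT_comp => //; exact: measurable_cons.
- by apply: measurableT_comp => //; exact: measurable_cons.
by rewrite big_split/= addeACA.
Qed.

Lemma extend_nd n (F : (n.+1.-tuple (borel X) -> \bar R)^nat) x :
  (forall k, measurable_fun setT (F k)) -> (forall k t, 0 <= F k t) ->
  (forall t, nondecreasing_seq (F ^~ t)) ->
  nondecreasing_seq (fun k => extend (F k) x).
Proof.
move=> mF F0 ndF k l kl; rewrite /extend leeD//.
  apply: ge0_le_integral => //.
  - by apply: measurableT_comp => //; exact: measurable_cons.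
  - by apply: measurableT_comp => //; exact: measurable_cons.
  - by move=> z _; exact: ndF.
by apply: lee_sum => y _; exact: ndF.
Qed.

Lemma extend_lim n (F : (n.+1.-tuple (borel X) -> \bar R)^nat) x :
  (forall k, measurable_fun setT (F k)) -> (forall k t, 0 <= F k t) ->
  (forall t, nondecreasing_seq (F ^~ t)) ->
  extend (fun t => limn (F ^~ t)) x = limn (fun k => extend (F k) x).
Proof.
move=> mF F0 ndF.
have cF t : cvgn (F ^~ t) by exact: ereal_nondecreasing_is_cvgn.
have mFz k : measurable_fun setT (fun z => F k [tuple of z :: x]).
  by apply: measurableT_comp => //; exact: measurable_cons.
apply/esym/cvg_lim => //; rewrite /extend.
apply: cvgeD.
- apply: ge0_adde_def; rewrite inE.
    by apply: integral_ge0 => z _; apply: lime_ge => //; exact: nearW.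
  by apply: sume_ge0 => y _; apply: lime_ge => //; exact: nearW.
- exact: cvg_monotone_convergence.
- apply: (@cvg_nnesum _ _ _ _ _ (undup x) (fun y k => F k [tuple of y :: x])
      (fun y => limn (F ^~ [tuple of y :: x])) xpredT) => y _.
    by apply: nearW => k; exact: F0.
  exact: cF.
Qed.

Section seating_step.
Variables (n : nat) (m : {finite_measure set (n.-tuple (borel X)) -> \bar R}).

(** One step of the seating process: a new point is a fresh draw from [eta] or
    repeats one of the distinct points already present, with unit weight each. *)
Definition seating_step of separable X : set (n.+1.-tuple (borel X)) -> \bar R :=
  fun D => \int[m]_x extend (fun t => (\1_D t)%:E) x.

Local Notation step := (seating_step X_separable).

Let mindicE D : measurable D ->
  measurable_fun [set: n.+1.-tuple (borel X)] (fun t => (\1_D t : R)%:E).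
Proof. by move=> mD; apply/measurable_EFinP; exact: measurable_indic. Qed.

Let step0 : step set0 = 0.
Proof.
apply: integral0_eq => x _; rewrite /extend integral0_eq ?add0e.
  by rewrite big1// => y _; rewrite indic0.
by move=> z _; rewrite indic0.
Qed.

Let step_ge0 D : 0 <= step D.
Proof. by apply: integral_ge0 => x _; apply: extend_ge0. Qed.

Let step_sigma_additive : semi_sigma_additive step.
Proof.
move=> F mF tF mUF; rewrite /seating_step.
pose G k t := \sum_(i < k) (\1_(F i) t : R)%:E.
have mG k : measurable_fun setT (G k).
  by apply: emeasurable_sum => i; exact: mindicE.
have G0 k t : 0 <= G k t by apply: sume_ge0 => i _.
have ndG t : nondecreasing_seq (G ^~ t).
  apply/nondecreasing_seqP => k; rewrite /G big_ord_recr/= leeDl//.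
have GE k x : extend (G k) x = \sum_(i < k) extend (fun t => (\1_(F i) t)%:E) x.
  elim: k => [|k IH].
    rewrite big_ord0 /extend /G integral0_eq ?add0e; last by move=> z _; rewrite big_ord0.
    by rewrite big1// => y _; rewrite big_ord0.
  rewrite big_ord_recr/= -IH -extendD//; last exact: mindicE.
  by congr extend; apply/funext => t; rewrite /G big_ord_recr.
have limG t : limn (G ^~ t) = (\1_(\bigcup_k F k) t)%:E.
  rewrite indic_bigcup//; apply: congr_lim; apply/funext => k.
  by rewrite /G big_mkord.
rewrite [X in _ --> X](_ : _ = \int[m]_x limn (fun k => extend (G k) x)); last first.
  apply: eq_integral => x _; rewrite -extend_lim//.
  by congr extend; apply/funext => t; rewrite limG.
rewrite (_ : (fun k => _) = fun k => \int[m]_x extend (G k) x); last first.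
  apply/funext => k; rewrite big_mkord -ge0_integral_sum//.
  - by apply: eq_integral => x _; rewrite GE.
  - by move=> i; apply: measurable_extend => //; exact: mindicE.
  - by move=> i x _; exact: extend_ge0.
apply: cvg_monotone_convergence => //.
- by move=> k; exact: measurable_extend.
- by move=> k x _; exact: extend_ge0.
- by move=> x _; exact: extend_nd.
Qed.

HB.instance Definition _ := isMeasure.Build _ _ _ step
  step0 step_ge0 step_sigma_additive.

Let step_fin : fin_num_fun step.
Proof.
apply: lty_fin_num_fun; rewrite /seating_step.
apply: (@le_lt_trans _ _ (\int[m]_x (1 + n%:R)%:E)); last first.
  by rewrite integral_cst// lte_mul_pinfty ?lee_fin// ?addr_ge0// -ge0_fin_numE//
    fin_num_measure.
apply: ge0_le_integral => //.
- by move=> x _; exact: extend_ge0.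
- by apply: measurable_extend => //; exact: mindicE.
move=> x _; rewrite EFinD leeD//.
  rewrite (eq_integral (cst 1)); last by move=> z _; rewrite indicT.
  by rewrite integral_cst//= mul1e probability_le1.
apply: (@le_trans _ _ (\sum_(y <- undup x) 1)).
  by apply: lee_sum => y _; rewrite indicT.
have -> (s : seq (borel X)) : \sum_(y <- s) 1 = (size s)%:R%:E :> \bar R.
  elim: s => [|y s IH]; first by rewrite big_nil.
  by rewrite big_cons IH /= -natr1 addrC EFinD.
by rewrite lee_fin ler_nat (leq_trans (size_undup _))// size_tuple.
Qed.

HB.instance Definition _ := Measure_isFinite.Build _ _ _ step step_fin.

Lemma integral_seating_step F : measurable_fun setT F -> (forall t, 0 <= F t) ->
  \int[step]_t F t = \int[m]_x extend F x.
Proof.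
move: F; apply: ge0_measurable_ind.
- by move=> D mD; rewrite integral_indic// setIT.
- move=> k F k0 mF F0 IH.
  rewrite ge0_integralZl_EFin// IH -ge0_integralZl_EFin//; last 2 first.
  + by move=> x _; exact: extend_ge0.
  + exact: measurable_extend.
  by apply: eq_integral => x _; rewrite extendZl.
- move=> F G mF F0 mG G0 IHF IHG.
  rewrite ge0_integralD// IHF IHG -ge0_integralD//; last 4 first.
  + by move=> x _; exact: extend_ge0.
  + exact: measurable_extend.
  + by move=> x _; exact: extend_ge0.
  + exact: measurable_extend.
  by apply: eq_integral => x _; rewrite extendD.
- move=> F mF F0 ndF IH.
  rewrite monotone_convergence//.
  transitivity (\int[m]_x limn (fun k => extend (F k) x)).
    rewrite monotone_convergence//.
    + by congr (limn _); apply/funext.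
    + by move=> k; exact: measurable_extend.
    + by move=> k x _; exact: extend_ge0.
    + by move=> x _; exact: extend_nd.
  by apply: eq_integral => x _; rewrite extend_lim.
Qed.

End seating_step.

(** A reference measure for samples from a discrete random measure: their laws have
    ties of positive probability, so they have no density with respect to powers of
    [eta], but they have one with respect to this measure. *)
Fixpoint seating (n : nat) : {finite_measure set (n.-tuple (borel X)) -> \bar R} :=
  if n is n'.+1 then seating_step (seating n') X_separable
  else \d_[tuple].

Lemma integral_seatingS n F : measurable_fun setT F -> (forall t, 0 <= F t) ->
  \int[seating n.+1]_t F t = \int[seating n]_x extend F x.
Proof. exact: integral_seating_step. Qed.

Lemma integral_seating0 F : measurable_fun setT F ->
  \int[seating 0]_t F t = F [tuple].
Proof. by move=> mF; rewrite integral_dirac// diracT mul1e. Qed.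

End measurability.
End seating_measure.

(** * Increments of products *)

Section product_increment.
Context (R : realType) (T : eqType).
Implicit Types (b del tau : T -> \bar R) (l : seq T).

(** The pair of the product of the [tau y] and of the telescoping sum
    of [del y] times the [b] of the points before [y] and the [tau] after it. *)
Definition prod_step b del tau (y : T) (pd : \bar R * \bar R) :=
  (tau y * pd.1, del y * pd.1 + b y * pd.2).

Definition prod_incr b del tau l : \bar R := (foldr (prod_step b del tau) (1, 0) l).2.

Lemma prod_step_fst b del tau l :
  (foldr (prod_step b del tau) (1, 0) l).1 = \prod_(y <- l) tau y.
Proof. by elim: l => [|y l IH]/=; rewrite ?big_nil// big_cons IH. Qed.

Lemma prod_incr_cons b del tau y l : prod_incr b del tau (y :: l) =
  del y * \prod_(z <- l) tau z + b y * prod_incr b del tau l.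
Proof. by rewrite /prod_incr /= prod_step_fst. Qed.

Lemma prod_incr_ge0 b del tau l : (forall y, 0 <= b y) -> (forall y, 0 <= del y) ->
  (forall y, 0 <= tau y) -> 0 <= prod_incr b del tau l.
Proof.
move=> b0 d0 t0; elim: l => [|y l IH]; first by rewrite /prod_incr.
by rewrite prod_incr_cons adde_ge0// mule_ge0// prode_ge0.
Qed.

(** The Leibniz rule for a finite increment, as a telescoping sum of nonnegative
    terms so that monotone convergence applies to it. *)
Lemma prod_incrE b del tau (e : R) l : (0 <= e)%R ->
  (forall y, 0 <= b y) -> (forall y, 0 <= del y) ->
  (forall y, tau y = b y + e%:E * del y) ->
  \prod_(y <- l) tau y = \prod_(y <- l) b y + e%:E * prod_incr b del tau l.
Proof.
move=> e0 b0 d0 tE.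
have t0 y : 0 <= tau y by rewrite tE adde_ge0// mule_ge0.
elim: l => [|y l IH]; first by rewrite !big_nil /prod_incr/= mule0 adde0.
rewrite prod_incr_cons !big_cons.
have P0 : 0 <= \prod_(z <- l) tau z by exact: prode_ge0.
have I0 := prod_incr_ge0 l b0 d0 t0.
have B0 : 0 <= \prod_(z <- l) b z by exact: prode_ge0.
rewrite {1}tE ge0_muleDl// ?mule_ge0// {1}IH.
rewrite [b y * (_ + _)]ge0_muleDr// ?mule_ge0//.
rewrite [e%:E * (_ + _)]ge0_muleDr ?mule_ge0// -addeA; congr (_ + _).
by rewrite addeC -muleA; congr (_ + _); rewrite muleCA.
Qed.

Lemma prod_incr_uniq del tau l : (forall y, 0 <= del y) -> (forall y, 0 <= tau y) ->
  uniq l -> prod_incr tau del tau l =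
  \sum_(y <- l) \prod_(z <- l) (if z == y then del z else tau z).
Proof.
move=> d0 t0; elim: l => [|y l IH]; first by rewrite big_nil /prod_incr.
move=> /= /andP[yl ul]; rewrite prod_incr_cons big_cons IH//; congr (_ + _).
  rewrite big_cons eqxx; congr (_ * _); apply: eq_big_seq => z zl.
  by case: eqP => // zy; rewrite -zy zl in yl.
rewrite ge0_sume_distrr; last first.
  by move=> z _; apply: prode_ge0 => u _; case: ifP.
apply: eq_big_seq => z zl; rewrite big_cons; congr (_ * _).
by case: eqP => // yz; rewrite yz zl in yl.
Qed.

Lemma prod_incr_nd (b del : nat -> T -> \bar R) tau l :
  (forall k y, 0 <= b k y) -> (forall k y, 0 <= del k y) ->
  (forall y, 0 <= tau y) ->
  (forall y, nondecreasing_seq (b ^~ y)) ->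
  (forall y, nondecreasing_seq (del ^~ y)) ->
  nondecreasing_seq (fun k => prod_incr (b k) (del k) tau l).
Proof.
move=> b0 d0 t0 ndb ndd m n mn; elim: l => [|y l IH]; first by [].
rewrite !prod_incr_cons leeD//.
  by rewrite lee_wpmul2r ?prode_ge0// ndd.
by rewrite lee_pmul// ?prod_incr_ge0// ndb.
Qed.

Lemma cvg_prod_incr (b del : nat -> T -> \bar R) tau (delta : T -> \bar R) l :
  (forall k y, 0 <= b k y) -> (forall k y, 0 <= del k y) ->
  (forall y, 0 <= tau y) ->
  (forall y, nondecreasing_seq (b ^~ y)) ->
  (forall y, nondecreasing_seq (del ^~ y)) ->
  (forall y, b k y @[k --> \oo] --> tau y) ->
  (forall y, del k y @[k --> \oo] --> delta y) ->
  prod_incr (b k) (del k) tau l @[k --> \oo] --> prod_incr tau delta tau l.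
Proof.
move=> b0 d0 t0 ndb ndd cb cd.
have de0 y : 0 <= delta y.
  by rewrite (le_trans (d0 0%N y))// (ereal_nd_le_lim (ndd y) (cd y)).
elim: l => [|y l IH]; first exact: cvg_cst.
rewrite prod_incr_cons; under eq_fun do rewrite prod_incr_cons.
have P0 : 0 <= \prod_(z <- l) tau z by exact: prode_ge0.
apply: cvgeD.
- apply: ge0_adde_def; rewrite inE mule_ge0//.
  exact: prod_incr_ge0.
- under eq_fun do rewrite muleC; rewrite muleC.
  by apply: ge0_cvgeZl => //; exact: ndd.
- apply: ge0_nd_cvgeM => //.
  + by move=> n; exact: prod_incr_ge0.
  + exact: prod_incr_nd.
Qed.

End product_increment.

Section moment_bound.
Context (R : realType).

(** One term of the exponential series bounds [x ^ n * exp (- a x)]; moments under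
    an exponential tilt are therefore finite. *)
Lemma expe_expN_bound (n : nat) (a : R) (x : \bar R) : (0 < a)%R -> 0 <= x ->
  \prod_(i < n) x * expN (a%:E * x) <= (n`!%:R / a ^+ n)%:E.
Proof.
move=> a0; have c0 : (0 <= n`!%:R / a ^+ n)%R.
  by rewrite divr_ge0// exprn_ge0// ltW.
case: x => [r| |]// r0; last first.
  by rewrite gt0_muley// /expN/= mule0 lee_fin.
rewrite lee_fin in r0.
rewrite -EFinM expN_fin prodEFin -EFinM lee_fin prodr_const card_ord.
have ar0 : (0 <= a * r)%R by rewrite mulr_ge0// ltW.
have H : ((a * r) ^+ n / n`!%:R <= expR (a * r))%R.
  case: n {c0} => [|n].
    by rewrite expr0 fact0 divr1 -expR0 ler_expR.
  by rewrite (le_trans _ (expR_ge1Dxn n ar0))// lerDr.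
rewrite expRN ler_pdivrMr ?expR_gt0//.
rewrite mulrAC ler_pdivlMr ?exprn_gt0// -exprMn (mulrC r).
by move: H; rewrite ler_pdivrMr ?ltr0n ?fact_gt0// (mulrC (expR _)).
Qed.

End moment_bound.

(** * Evaluations of measures *)

Section measurable_evaluation.
Context (R : realType) (X : completeMetricType R).
Implicit Types (A : set (borel X)).

Lemma measurable_continuous_borel (f : X -> R) : continuous f ->
  measurable_fun [set: borel X] (f : borel X -> R).
Proof.
move=> /continuousP cf.
apply: (measurability _ (RGenOpens.measurableE R)) => _ [_ [a [b ->] <-]].
rewrite setTI; apply: sub_sigma_algebra.
exact/cf/interval_open.
Qed.

Lemma measurable_weak_test (f : borel X -> R) : weak_test f ->
  measurable_fun [set: bfmeasures X] (fun m : bfmeasures X => \int[m]_x f x)%R.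
Proof.
move=> tf; apply: (measurability _ (RGenOpens.measurableE R)) => _ [_ [a [b ->] <-]].
rewrite setTI; apply: sub_sigma_algebra => /= m mab.
have : open (`]a, b[%classic : set R) by exact: interval_open.
rewrite openE => /(_ _ mab) /nbhs_ballP[e /= e0 eab].
exists 1%N, (fun=> f), e; split => // m' m'e; apply: eab.
by rewrite -ball_normE/= distrC; exact: (m'e ord0).
Qed.

Lemma bfm_ball_lty (m : bfmeasure X) A (x : X) (r : R) : measurable A ->
  m (A `&` (ball x r : set (borel X))) < +oo.
Proof.
move=> mA; apply: bfm_fin; first by apply: measurableI => //; exact: measurable_borel_ball.
by exists x, r; exact: subIsetr.
Qed.

(** An open set is exhausted by the continuous functions [1 - exp (- 2^k d)],
    with [d] the distance to its complement. *)
Lemma open_approx (A : set X) : open A -> exists f : nat -> X -> R,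
  [/\ forall k, continuous (f k), forall k x, (0 <= f k x <= 1)%R,
      forall k x, ~ A x -> f k x = 0%R,
      forall x, nondecreasing_seq (f ^~ x) &
      forall x, A x -> f k x @[k --> \oo] --> (1 : R)%R].
Proof.
move=> oA; have [AT|/existsNP[a0 Aa0]] := pselect (forall x, A x).
  exists (fun _ _ => 1%R); split => //.
  - by move=> k x; exact: cvg_cst.
  - by move=> k x; rewrite ler01 lexx.
  - by move=> x m k _; rewrite lexx.
  - by move=> x _; exact: cvg_cst.
pose D : X -> \bar R := edist_inf (~` A).
have Dfin x : D x \is a fin_num.
  rewrite ge0_fin_numE ?edist_inf_ge0//.
  apply: (@le_lt_trans _ _ (edist (x, a0))).
    by apply: ereal_inf_lbound; exists a0.
  apply: (@le_lt_trans _ _ (mdist x a0 + 1)%:E); last exact: ltry.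
  apply: edist_fin; first by rewrite ltr_wpDl// mdist_ge0.
  by rewrite /= ballEmdist/= ltrDl.
pose g x := fine (D x).
have g0 x : (0 <= g x)%R by rewrite fine_ge0// edist_inf_ge0.
have cg : continuous g.
  move=> x; apply: (@fine_cvg _ _ _ _ _ (g x)); rewrite fineK//.
  exact: edist_inf_continuous.
have gpos x : A x -> (0 < g x)%R.
  move=> Ax; have := oA; rewrite openE => /(_ x Ax) /nbhs_ballP[e /= e0 eA].
  apply: (lt_le_trans e0); rewrite -lee_fin fineK//.
  apply: le_ereal_inf_tmp => _ [y Ay <-]; rewrite leNgt; apply/negP => xye.
  exact/Ay/eA/(edist_lt_ball xye).
exists (fun k x => 1 - expR (- (2%:R ^+ k * g x)))%R; split.
- move=> k x; apply: cvgB; first exact: cvg_cst.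
  apply: (@continuous_cvg _ _ _ _ _ _ expR); first exact: continuous_expR.
  apply: cvgN; apply: cvgM; [exact: cvg_cst|exact: cg].
- move=> k x; apply/andP; split; last by rewrite gerBl expR_ge0.
  by rewrite subr_ge0 -[leRHS]expR0 ler_expR oppr_le0 mulr_ge0 ?exprn_ge0.
- by move=> k x Ax; rewrite /g /D edist_inf0//= mulr0 oppr0 expR0 subrr.
- move=> x m k mk; rewrite lerB// ler_expR lerN2 ler_wpM2r//.
  by rewrite ler_eXn2l// ltr1n.
- move=> x Ax; rewrite -[X in _ --> X]subr0; apply: cvgB; first exact: cvg_cst.
  have gx := gpos x Ax.
  have gy : quot k (+oo : \bar R) @[k --> \oo] --> (+oo : \bar R) by exact: cvg_quot.
  have u0 k : 0 <= (2%:R ^+ k * g x)%:E :> \bar R by rewrite lee_fin mulr_ge0// exprn_ge0.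
  have : expN (2%:R ^+ k * g x)%:E @[k --> \oo] --> expN (+oo : \bar R).
    apply: cvg_expN => //.
    rewrite (_ : (fun k => _) = (fun k => quot k +oo * (g x)%:E)).
      rewrite -[X in _ --> X](gt0_mulye (x := (g x)%:E)) ?lte_fin//.
      by apply: cvgeZr.
    apply/funext => k; rewrite /quot gt0_muley ?lte_fin ?step_gt0//.
    by rewrite /onemexpN /expN/= sube0 mule1 EFinM.
  by move=> /fine_cvgP[_].
Qed.

Let measurable_eval_open A : open (A : set X) -> mbounded (A : set X) ->
  measurable_fun [set: bfmeasures X] (fun m : bfmeasures X => m A).
Proof.
move=> oA bA; have [f [cf f01 fA0 ndf fA1]] := open_approx oA.
have tf k : weak_test (f k).
  split; [exact: cf| |by exists A => // x; exact: fA0].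
  by exists 1%R => x; have /andP[f0 f1] := f01 k x; rewrite ger0_norm.
have mA : measurable A by exact: measurable_borel_open.
have mf k : measurable_fun [set: borel X] (fun x => (f k x)%:E).
  by apply/measurable_EFinP; exact: measurable_continuous_borel.
have f0 k x : 0 <= (f k x)%:E by rewrite lee_fin; have /andP[] := f01 k x.
have int_fin (m : bfmeasures X) k : \int[m]_x (f k x)%:E \is a fin_num.
  rewrite ge0_fin_numE; last exact: integral_ge0.
  apply: (@le_lt_trans _ _ (\int[m]_x (\1_A x)%:E)).
    apply: ge0_le_integral => //; first exact/measurable_EFinP.
    move=> x _; rewrite lee_fin indicE; have /andP[_ f1] := f01 k x.
    by case: (boolP (x \in A)) => // /negP xA; rewrite fA0// => /mem_set.
  by rewrite integral_indic// setIT bfm_fin.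
apply: (emeasurable_fun_cvg (fun k (m : bfmeasures X) => (\int[m]_x f k x)%R%:E)).
  by move=> k; apply/measurable_EFinP; exact: measurable_weak_test.
move=> m _.
have mAE : \int[m]_x limn (fun k => (f k x)%:E) = (m : bfmeasure X) A.
  rewrite -[in RHS](setIT A) -integral_indic//; apply: eq_integral => x _.
  apply/cvg_lim => //; apply: cvg_EFin; first exact: nearW.
  rewrite indicE; case: (boolP (x \in A)) => [/set_mem xA|/negP xA].
    exact: fA1.
  rewrite (_ : _ \o _ = fun=> 0%R); first exact: cvg_cst.
  by apply/funext => k /=; rewrite fA0// => /mem_set.
have : \int[m]_x (f k x)%:E @[k --> \oo] --> \int[m]_x limn (fun k => (f k x)%:E).
  apply: cvg_monotone_convergence => //.
  by move=> x _ a b ab; rewrite lee_fin ndf.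
rewrite mAE; apply: cvg_trans; apply: near_eq_cvg; apply: nearW => k.
by rewrite /Rintegral fineK.
Qed.

Let measurable_eval_ball (x0 : X) (r : R) A : measurable A ->
  measurable_fun [set: bfmeasures X]
    (fun m : bfmeasures X => m (A `&` (ball x0 r : set (borel X)))).
Proof.
pose B : set (borel X) := ball x0 r.
have mB : measurable B by exact: measurable_borel_ball.
have bB A' : mbounded (A' `&` B : set X) by exists x0, r; exact: subIsetr.
pose H := [set A' : set (borel X) | measurable A' /\
  measurable_fun [set: bfmeasures X] (fun m : bfmeasures X => m (A' `&` B))].
suff : @measurable _ (borel X) `<=` H by move=> /[apply] -[].
apply: lambda_system_subset.
- by move=> C D oC oD; exact: openI.
- split.
  + by move=> C [].
  + split; first exact: measurableT.
    rewrite setTI; apply: measurable_eval_open; first exact: open_ball_metric.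
    by have := bB setT; rewrite setTI.
  + move=> C D DC [mC mCf] [mD mDf]; split; first exact: measurableD.
    rewrite (_ : (fun m : bfmeasures X => _) =
      fun m : bfmeasures X => m (C `&` B) - m (D `&` B)).
      exact: emeasurable_funB.
    apply/funext => m.
    have DCB : D `&` B `<=` C `&` B by apply: setSI.
    have -> : (m : bfmeasure X) (D `&` B) = (m : bfmeasure X) ((C `&` B) `&` (D `&` B)).
      by rewrite (setIidr DCB).
    rewrite -measureD.
    * congr (m _); apply/seteqP; split => x /=.
        by move=> [[Cx Dx] Bx]; split => // -[].
      by move=> [[Cx Bx] DB]; split => //; split => // Dx; exact: DB.
    * exact: measurableI.
    * exact: measurableI.
    * exact: bfm_ball_lty.
  + move=> F ndF HF; split; first by apply: bigcup_measurable => k _; exact: (HF k).1.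
    apply: (emeasurable_fun_cvg (fun k (m : bfmeasures X) => m (F k `&` B))).
      by move=> k; exact: (HF k).2.
    move=> m _; rewrite setI_bigcupl.
    apply: nondecreasing_cvg_mu.
    * by move=> k; apply: measurableI => //; exact: (HF k).1.
    * by apply: bigcup_measurable => k _; apply: measurableI => //; exact: (HF k).1.
    * by move=> a b ab; apply/subsetPset; apply: setSI; exact/subsetPset/ndF.
- move=> C oC; split; first exact: measurable_borel_open.
  apply: measurable_eval_open; last exact: bB.
  by apply: openI => //; exact: open_ball_metric.
- by [].
Qed.

(** On bounded open sets the evaluation is a monotone limit of integrals of test
    functions, which are measurable by the definition of the weak topology. A Dynkin
    class argument inside a ball extends this to all measurable sets of the ball,
    and increasing balls exhaust the space. *)
Lemma measurable_eval A : measurable A ->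
  measurable_fun [set: bfmeasures X] (fun m : bfmeasures X => m A).
Proof.
move=> mA; pose x0 : X := point.
pose B k : set (borel X) := ball x0 k%:R.
apply: (emeasurable_fun_cvg (fun k (m : bfmeasures X) => m (A `&` B k))).
  by move=> k; exact: measurable_eval_ball.
move=> m _.
have UB : \bigcup_k (A `&` B k) = A.
  rewrite -setI_bigcupr; apply: setIidl => x _.
  exists (Num.truncn (mdist x0 x)).+1 => //; rewrite /B ballEmdist/=.
  by rewrite truncnS_gt.
rewrite -[X in _ --> m X]UB; apply: nondecreasing_cvg_mu.
- by move=> k; apply: measurableI => //; exact: measurable_borel_ball.
- by rewrite UB.
- move=> a b ab; apply/subsetPset; apply: setIS; rewrite /B !ballEmdist => x /=.
  by move/lt_le_trans; apply; rewrite ler_nat.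
Qed.

Lemma measurable_total_mass :
  measurable_fun [set: bfmeasures X] (fun m : bfmeasures X => total_mass m).
Proof.
exact: (measurableT_comp (fine_measurable measurableT) (measurable_eval measurableT)).
Qed.

End measurable_evaluation.

(** * The gamma integral *)

Section lebesgue_scaling.
Context (R : realType) (c : R) (c_gt0 : (0 < c)%R).
Local Notation leb := (@lebesgue_measure R).

Let scal (u : measurableTypeR R) : measurableTypeR R := (c * u)%R.

Let mscal : measurable_fun setT scal.
Proof. exact: mulrl_measurable. Qed.

Let V : measurableTypeR R -> \bar R := fun=> c%:E.

Let mV : measurable_fun setT V. Proof. exact: measurable_cst. Qed.

Let V0 x : 0 <= V x. Proof. by rewrite lee_fin ltW. Qed.

Let wscal (A : set (measurableTypeR R)) : measurable A ->
  wmeasure leb mV V0 mscal A = leb A.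
Proof.
move=> mA; apply/esym/lebesgue_measure_unique => //= _ [[a b]] _ <-.
rewrite /wmeasure /V ge0_integralZl_EFin; first last.
- exact: ltW.
- apply/measurable_EFinP; apply: measurableT_comp => //; exact: measurable_indic.
- by move=> x _; rewrite lee_fin.
- by [].
rewrite (eq_integral (fun x : measurableTypeR R => (\1_(`](a / c)%R, (b / c)%R]%classic) x)%:E)); last first.
  move=> x _; rewrite /scal !indicE; congr (nat_of_bool _)%:R%:E.
  by apply/idP/idP; rewrite !inE/= !in_itv/= ltr_pdivrMr// ler_pdivlMr// (mulrC x).
rewrite integral_indic; [|by []|exact: (measurable_itv `](a / c)%R, (b / c)%R])].
have labc : leb `](a / c)%R, (b / c)%R] = (if (a / c < b / c)%R
    then (b / c - a / c)%R%:E else 0) by rewrite lebesgue_measure_itv/= lte_fin.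
rewrite setIT lebesgue_measure_itv/= lte_fin labc ltr_pM2r ?invr_gt0//.
case: ifPn => _; last by rewrite mule0.
by rewrite -!EFinB -EFinM -mulrBl mulrC divfK// gt_eqF.
Qed.

(** Lebesgue measure is characterized by its values on intervals, and its image under
    a homothety, rescaled, has the same values. *)
Lemma lebesgue_integral_scale (f : measurableTypeR R -> \bar R) :
  measurable_fun setT f -> (forall u, 0 <= f u) ->
  \int[leb]_u f u = c%:E * \int[leb]_u f (c * u)%R.
Proof.
move=> mf f0; rewrite -(@eq_measure_integral _ _ _ setT leb (wmeasure leb mV V0 mscal)).
  rewrite ge0_integral_wmeasure// ge0_integralZl_EFin//.
  - exact: measurableT_comp.
  - exact: ltW.
move=> A mA _; exact: (wscal mA).
Qed.

End lebesgue_scaling.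

Section gamma_integral.
Context (R : realType).
Local Notation leb := (@lebesgue_measure R).

Definition lebesgue_kernel of unit : {measure set (measurableTypeR R) -> \bar R} := leb.

Let measurable_lebesgue_kernel U : measurable U ->
  measurable_fun setT (lebesgue_kernel ^~ U).
Proof. by move=> mU; exact: measurable_cst. Qed.

HB.instance Definition _ := isKernel.Build _ _ unit (measurableTypeR R) R
  lebesgue_kernel measurable_lebesgue_kernel.

Definition poww (a : R) : R -> \bar R := fun s => (s `^ (a - 1))%:E.

Lemma weight_poww a : weight (poww a).
Proof.
split; last by move=> s _; rewrite lee_fin powR_ge0.
by apply/measurable_EFinP; exact: measurable_powR.
Qed.

(** The gamma integral of shape [a] and rate [t], read as a Laplace transform so
    that the increment formulas for Laplace transforms apply to it. *)
Definition gammaI (a t : R) : \bar R := lap lebesgue_kernel (poww a) tt t.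

Lemma gammaI_ge0 a t : 0 <= gammaI a t.
Proof. by apply: lap_ge0; exact: weight_poww. Qed.

Lemma gammaI_scale a t : (0 < a)%R -> (0 < t)%R -> gammaI a 1 = (t `^ a)%:E * gammaI a t.
Proof.
move=> a0 t0; rewrite /gammaI !lapE.
have mi b : measurable_fun setT (lap_integrand (poww a) b : measurableTypeR R -> \bar R).
  by apply: measurable_lap_integrand; exact: weight_poww.
have i0 b u : 0 <= lap_integrand (poww a) b u.
  by apply: lap_integrand_ge0; exact: weight_poww.
apply: (etrans (lebesgue_integral_scale t0 (mi 1%R) (i0 1%R))).
rewrite -ge0_integralZl_EFin; first last.
- exact: ltW.
- exact: (measurableT_comp (mi 1%R) (mulrl_measurable t)).
- by move=> u _; exact: i0.
- by [].
rewrite -ge0_integralZl_EFin; first last.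
- exact: powR_ge0.
- exact: mi.
- by move=> u _; exact: i0.
- by [].
apply: eq_integral => u _; rewrite /lap_integrand pmulr_rgt0//.
case: ifPn => u0; last by rewrite !mule0.
rewrite /poww -!EFinM; congr EFin; rewrite mulr1 powRM; [|exact: ltW|exact: ltW].
by rewrite -(mulr_powRB1 (ltW t0) a0) !mulrA (mulrC u).
Qed.

Lemma gammaI1 : gammaI 1 1 = 1.
Proof.
rewrite /gammaI /lap /=.
rewrite (eq_integral (fun x : measurableTypeR R => (expR (- x))%:E)); last first.
  by move=> x _; rewrite /poww subrr powRr0 mul1e mulr1.
rewrite integral_itv_obnd_cbnd; last first.
  apply: measurable_funTS; apply/measurable_EFinP.
  by apply: measurableT_comp; [exact: measurable_expR|exact: oppr_measurable].
have dF (x : R) : is_derive x 1%R (fun x : R => - expR (- x))%R (expR (- x)).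
  apply: is_derive_eq.
  by rewrite mulrN1 opprK.
have FTC := @ge0_continuous_FTC2y R (fun x => expR (- x)) (fun x => - expR (- x))%R 0 0.
rewrite FTC.
- by rewrite oppr0 expR0 EFinN oppeK add0e.
- by move=> x _; exact: expR_ge0.
- apply: continuous_subspaceT => x.
  by apply: continuous_comp; [exact: opp_continuous|exact: continuous_expR].
- by rewrite -oppr0; apply: cvgN; exact: cvgr_expR.
- by move=> x _; exact: (@ex_derive _ _ _ _ _ _ _ (dF x)).
- apply: cvg_at_right_filter; apply: cvgN.
  by apply: continuous_comp; [exact: opp_continuous|exact: continuous_expR].
- by move=> x _; rewrite derive1E; exact: (@derive_val _ _ _ _ _ _ _ (dF x)).
Qed.

(** The functional equation of the gamma function without integration by parts: the
    derivative of [t |-> gammaI a t] at 1 is minus [gammaI (a + 1) 1] as that of a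
    Laplace transform, and minus [a * gammaI a 1] as [gammaI a t] is proportional to
    [t ^ (- a)]. *)
Lemma gammaI_rec a : (0 < a)%R -> gammaI a 1 < +oo ->
  gammaI (a + 1) 1 = a%:E * gammaI a 1.
Proof.
move=> a0 fin; have wa := weight_poww a.
have -> : gammaI (a + 1) 1 = lap lebesgue_kernel (fun s => poww a s * s%:E) tt 1.
  rewrite /gammaI !lapE; apply: eq_integral => s _; rewrite /lap_integrand.
  case: ifPn => // s0; congr (_ * _); rewrite /poww -EFinM addrK.
  by rewrite mulrC mulr_powRB1// ltW.
have gN : gammaI a 1 \is a fin_num by rewrite ge0_fin_numE ?gammaI_ge0.
have cvgq := @cvg_lap_quot _ _ R lebesgue_kernel _ tt 1%R wa.
rewrite -(cvg_lim _ cvgq)//; apply/cvg_lim => //.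
have sE (k : nat) : lap lebesgue_kernel (fun s => poww a s * quot k s%:E) tt 1 =
    (- ((step k)^-1 * ((1 + step k) `^ (- a) - 1 `^ (- a))))%:E * gammaI a 1.
  have s0 : (0 < 1 + step k :> R)%R by rewrite addr_gt0 ?step_gt0.
  have wq := weight_quot k wa.
  have e1 := lap_increment lebesgue_kernel k tt 1%R wa.
  have e2 := gammaI_scale a0 s0.
  have l0 := gammaI_ge0 a (1 + step k).
  have q0 := lap_ge0 lebesgue_kernel tt 1%R wq.
  rewrite -/(gammaI a 1) -/(gammaI a (1 + step k)) in e1.
  move: e1 e2 l0 q0 gN; move: (gammaI a 1) (gammaI a (1 + step k)) (lap _ _ _ _).
  have st0 := @step_gt0 R k.
  have p0 : (0 < (1 + step k) `^ a)%R by exact: powR_gt0.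
  case=> [G||] [l||] [Q||]//= e1 e2 l0 q0 _.
  - have {}e1 : G = (l + step k * Q)%R by exact: EFin_inj e1.
    have {}e2 : G = ((1 + step k) `^ a * l)%R by exact: EFin_inj e2.
    congr EFin.
    rewrite powR1 powRN.
    have -> : Q = ((G - l) / step k)%R by rewrite e1; field; exact: lt0r_neq0.
    rewrite [in LHS]e2; move: e2 => ->; field.
    by apply/andP; split; exact: lt0r_neq0.
  - by move: e1; rewrite gt0_muley ?lte_fin// addey.
  - by move: e2; rewrite gt0_muley ?lte_fin.
suff : (- ((step k)^-1 * ((1 + step k) `^ (- a) - 1 `^ (- a))))%:E * gammaI a 1
    @[k --> \oo] --> a%:E * gammaI a 1.
  by apply: cvg_trans; apply: near_eq_cvg; apply: nearW => k; rewrite sE.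
apply: cvgeZr => //; apply: cvg_EFin; first exact: nearW.
have D := is_derive1_powR (- a) (@ltr01 R).
have hD := @ex_derive _ _ _ _ _ _ _ D.
have vD := @derive_val _ _ _ _ _ _ _ D.
rewrite powR1 mulr1 in vD.
suff : ((step k)^-1 * ((1 + step k) `^ (- a) - 1 `^ (- a)))%R @[k --> \oo] --> (- a)%R.
  by move/cvgN; rewrite opprK; exact.
have st : (step k : R) @[k --> \oo] --> (0%R : R)^'.
  have /fine_cvgP[_ step0] := @cvg_step R.
  move=> A [e /= e0 eA].
  have : \forall k \near \oo, ball (0%R : R) e (step k) by exact: (step0 _ (nbhsx_ballx _ _ e0)).
  by apply: filterS => k /= bk; apply: (eA (step k)) => //; exact/lt0r_neq0/step_gt0.
rewrite /derivable in hD; have := cvg_comp _ _ st hD; rewrite -/(derive _ _ _) vD.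
apply: cvg_trans; apply: near_eq_cvg; apply: nearW => k /=.
by rewrite [((step k)%:A)%R]mulr1 (addrC (step k)).
Qed.


Lemma gammaI_nat (m : nat) : gammaI m.+1%:R 1 < +oo.
Proof.
elim: m => [|m IH]; first by rewrite gammaI1 ltry.
rewrite -natr1 gammaI_rec ?ltr0n//.
by rewrite lte_mul_pinfty// lee_fin.
Qed.

(** Finiteness at integers follows from the functional equation; in between,
    [t ^ (a - 1) <= 1 + t ^ m] for [m >= a]. *)
Lemma gammaI_fin (a : R) : (1 <= a)%R -> gammaI a 1 < +oo.
Proof.
move=> a1; pose m := (Num.truncn a).+1.
have am : (a <= m%:R)%R by apply/ltW/Num.Theory.truncnS_gt.
have le : gammaI a 1 <= gammaI 1 1 + gammaI m.+1%:R 1.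
  rewrite /gammaI !lapE -ge0_integralD; first last.
  - by apply: measurable_lap_integrand; exact: weight_poww.
  - by move=> s _; apply: lap_integrand_ge0; exact: weight_poww.
  - by apply: measurable_lap_integrand; exact: weight_poww.
  - by move=> s _; apply: lap_integrand_ge0; exact: weight_poww.
  - by [].
  apply: ge0_le_integral.
  - by [].
  - by move=> s _; apply: lap_integrand_ge0; exact: weight_poww.
  - by apply: measurable_lap_integrand; exact: weight_poww.
  - by apply: emeasurable_funD; apply: measurable_lap_integrand; exact: weight_poww.
  move=> s _; rewrite /lap_integrand; case: ifPn => s0; last by rewrite adde0.
  rewrite /poww -!EFinM -EFinD lee_fin -mulrDl ler_wpM2r ?expR_ge0//.
  rewrite subrr powRr0 -(natr1 m) addrK.
  have [s1|s1] := leP s 1%R.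
    rewrite -[leLHS]addr0 lerD ?powR_ge0//.
    by rewrite -[leRHS](powRr0 s); apply: ger_powR; rewrite ?s0// subr_ge0.
  rewrite -[leLHS]add0r lerD//; apply: ler_powR; first exact: ltW.
  by apply: (le_trans _ am); rewrite lerBlDr lerDl.
apply: (le_lt_trans le); rewrite gammaI1 lte_add_pinfty ?ltry//.
exact: gammaI_nat.
Qed.

Lemma gammaI_gt0 (a : R) : (1 <= a)%R -> 0 < gammaI a 1.
Proof.
move=> a1; pose c := expR (- 2 : R).
apply: (@lt_le_trans _ _ (c%:E * leb `[1%R, 2%R]%classic)).
  rewrite lebesgue_measure_itv/= lte_fin ltr1n -EFinB -EFinM lte_fin.
  by rewrite mulr_gt0 ?expR_gt0// subr_gt0 ltr1n.
rewrite /gammaI lapE -(setIT `[1%R, 2%R]%classic) -integral_indic//.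
rewrite -ge0_integralZl_EFin; first last.
- exact: expR_ge0.
- by apply/measurable_EFinP; exact: measurable_indic.
- by move=> s _; rewrite lee_fin.
- by [].
apply: ge0_le_integral.
- by [].
- by move=> s _; rewrite mule_ge0// lee_fin ?expR_ge0.
- by apply: measurable_funeM; apply/measurable_EFinP; exact: measurable_indic.
- by apply: measurable_lap_integrand; exact: weight_poww.
move=> s _; rewrite indicE; case: (boolP (s \in _)) => [|_]; last first.
  rewrite mule0; apply: lap_integrand_ge0; exact: weight_poww.
rewrite inE/= in_itv/= => /andP[s1 s2].
rewrite /lap_integrand (lt_le_trans ltr01 s1) mule1 -EFinM lee_fin mulr1.
rewrite -[leLHS]mul1r ler_pM ?expR_ge0//.
  by rewrite -[leLHS](powRr0 s) ler_powR// subr_ge0.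
by rewrite ler_expR lerN2.
Qed.

Lemma Gamma_gammaI (a : R) : (1 <= a)%R -> (Gamma a)%:E = gammaI a 1.
Proof.
move=> a1; rewrite /Gamma /Rintegral fineK.
  by rewrite /gammaI /lap; apply: eq_integral => s _; rewrite /poww mulr1.
rewrite (_ : integral _ _ _ = gammaI a 1).
  by rewrite ge0_fin_numE ?gammaI_ge0 ?gammaI_fin.
by rewrite /gammaI /lap; apply: eq_integral => s _; rewrite /poww mulr1.
Qed.

Lemma Gamma_gt0 (a : R) : (1 <= a)%R -> (0 < Gamma a)%R.
Proof. by move=> a1; rewrite -lte_fin Gamma_gammaI// gammaI_gt0. Qed.

Lemma GammaS (a : R) : (1 <= a)%R -> Gamma (a + 1) = (a * Gamma a)%R.
Proof.
move=> a1; have a0 : (0 < a)%R by exact: lt_le_trans a1.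
apply: EFin_inj; rewrite Gamma_gammaI; last by rewrite (le_trans a1)// lerDl.
by rewrite gammaI_rec ?gammaI_fin// EFinM Gamma_gammaI.
Qed.

Lemma gamma_law_setT (a T : R) : (1 <= a)%R -> (0 < T)%R -> gamma_law a T setT = 1.
Proof.
move=> a1 T0; have a0 : (0 < a)%R by exact: lt_le_trans a1.
have G0 := Gamma_gt0 a1.
rewrite /gamma_law setTI.
rewrite (eq_integral (fun u : measurableTypeR R =>
   (T `^ a / Gamma a)%:E * (poww a u * (expR (- (u * T)))%:E))); last first.
  by move=> u _; rewrite /poww -!EFinM; congr EFin; rewrite mulrC !mulrA (mulrC _ (T `^ a))%R !mulrA.
rewrite ge0_integralZl_EFin; first last.
- by rewrite divr_ge0 ?powR_ge0// ltW.
- apply: measurable_funTS; apply: emeasurable_funM; first exact: (proj1 (weight_poww a)).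
  apply/measurable_EFinP; apply: measurableT_comp; first exact: measurable_expR.
  by apply: measurable_funN; exact: mulrr_measurable.
- by move=> u _; rewrite mule_ge0// lee_fin ?powR_ge0 ?expR_ge0.
- exact: measurable_itv.
rewrite -/(lap lebesgue_kernel (poww a) tt T) -/(gammaI a T).
rewrite mulrC EFinM -muleA -gammaI_scale// -Gamma_gammaI// -EFinM mulVf//.
exact: lt0r_neq0.
Qed.

End gamma_integral.

(** * Moments of a Poisson random measure *)

#[local] Opaque integral expN quot lap.

Section partition_weight.
Context (R : realType) (X : completeMetricType R).
Variable rho : R.-ker (borel X) ~> measurableTypeR R.
Implicit Types (al : borel X -> R) (x : seq (borel X)) (m : nat).

Definition powerw m (s : R) : \bar R := (s ^+ m)%:E.

Lemma powerwS m : (fun s => powerw m s * s%:E) = powerw m.+1.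
Proof. by apply/funext => s; rewrite /powerw exprSr EFinM. Qed.

Lemma weight_powerw m : weight (powerw m). Proof. exact: weightX. Qed.

(** The product of the moments [tau_{n_k, Y_k}] over the distinct values [Y_k] of
    a sample, the argument being allowed to depend on the value. *)
Definition pweight al x : \bar R :=
  \prod_(y <- undup x) lap rho (powerw (count_mem y x)) y (al y).

Lemma pweight_ge0 al x : 0 <= pweight al x.
Proof. by apply: prode_ge0 => y _; apply: lap_ge0; exact: weight_powerw. Qed.

Lemma pweight_new al z x : z \notin x ->
  pweight al (z :: x) = lap rho (powerw 1) z (al z) * pweight al x.
Proof.
move=> zx; rewrite /pweight /= (negbTE zx) big_cons eqxx.
rewrite (count_memPn zx) addn0; congr (_ * _).
apply: eq_big_seq => y; rewrite mem_undup => yx.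
by case: eqP => [zy|_//]; rewrite zy yx in zx.
Qed.

Lemma pweight_old al y x : y \in x -> pweight al (y :: x) =
  \prod_(z <- undup x) (if z == y
    then lap rho (powerw (count_mem z x).+1) z (al z)
    else lap rho (powerw (count_mem z x)) z (al z)).
Proof.
move=> yx; rewrite /pweight /= yx; apply: eq_bigr => z _.
by rewrite eq_sym; case: eqP => // ->; rewrite add1n.
Qed.

Hypothesis X_separable : separable X.
Context d (Omega : measurableType d) (I : Type) (F : I -> Omega -> borel X).
Hypothesis mF : forall i, measurable_fun setT (F i).

Lemma measurable_count_comp (H : nat -> Omega -> \bar R) i (r : seq I) :
  (forall m, measurable_fun setT (H m)) ->
  measurable_fun setT (fun w => H (count_mem (F i w) [seq F j w | j <- r]) w).
Proof.
move=> mH; apply: (@measurable_nat_index _ _ _ _ H) => //.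
exact: measurable_count_map.
Qed.

Lemma measurable_pweight (al : Omega -> borel X -> R) (r : seq I) :
  (forall i, measurable_fun setT (fun w => al w (F i w))) ->
  measurable_fun setT (fun w => pweight (al w) [seq F i w | i <- r]).
Proof.
move=> mal; apply: (@measurable_big_undup _ _ X_separable _ _ _ F mF *%E 1
  (fun w y => lap rho (powerw (count_mem y [seq F i w | i <- r])) y (al w y)) r).
  by move=> u v mu mv; exact: emeasurable_funM.
move=> i; apply: (@measurable_count_comp
  (fun m w => lap rho (powerw m) (F i w) (al w (F i w)))) => m.
apply: (measurableT_comp (measurable_lap rho (weight_powerw m))
  (g := fun w => (F i w, al w (F i w)))).
exact: measurable_fun_pair.
Qed.

End partition_weight.

Section size_functional.
Context (R : realType) d (T : measurableType d).
Implicit Types (al : T -> R) (B : set T).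

(** [sized al (z, s)] is [s * al z] for positive [s]: integrated against the
    Poisson measure it is the integral of [al] against the random measure. *)
Definition sized al (p : T * measurableTypeR R) : \bar R :=
  if (0 < (p.2 : R))%R then ((p.2 : R) * al p.1)%:E else 0.

Lemma sized_ge0 al p : (forall z, 0 <= al z)%R -> 0 <= sized al p.
Proof.
by move=> al0; rewrite /sized; case: ifP => // p0; rewrite lee_fin mulr_ge0// ltW.
Qed.

Lemma measurable_sized al : measurable_fun setT al -> measurable_fun setT (sized al).
Proof.
move=> mal; apply: measurable_fun_ifT => //.
- by apply: measurable_fun_ltr; [exact: measurable_cst|exact: measurable_snd].
- apply/measurable_EFinP; apply: measurable_funM; first exact: measurable_snd.
  exact: measurableT_comp.
Qed.

Lemma sizedD al (t : R) B p : sized (fun z => al z + t * \1_B z)%R p =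
  sized al p + t%:E * sized \1_B p.
Proof.
rewrite /sized; case: ifP => _; last by rewrite mule0 adde0.
by rewrite mulrDr EFinD -EFinM mulrCA.
Qed.

Lemma sized_indic_lap al B p :
  expN (sized al p) * sized \1_B p = (\1_B p.1)%:E * lap_integrand (powerw 1) (al p.1) p.2.
Proof.
rewrite /sized /lap_integrand; case: ifP => _; last by rewrite !mule0.
rewrite expN_fin /powerw expr1 -!EFinM; congr EFin; ring.
Qed.

End size_functional.

(** Two ways of writing the increment of a product, compared on abstract
    quantities: [L * I] before and [Lk * Ik] after a step [e = p^-1]. *)
Lemma increment_cancel (R : realType) (L Lk Ik I J c c0 : \bar R) (e p : R) :
  (p * e = 1)%R -> (0 <= e)%R -> 0 <= Lk -> 0 <= Ik -> 0 <= I -> 0 <= J -> 0 <= c ->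
  0 <= c0 -> L * I < +oo -> L * I = Lk * Ik + e%:E * c -> L = Lk + e%:E * c0 ->
  I = Ik + e%:E * J -> c = Lk * J + c0 * I.
Proof.
move=> pe e0 Lk0 Ik0 I0 J0 c_0 c00 fin E1 E2 E3.
have eE0 : 0 <= e%:E by rewrite lee_fin.
have LI0 : 0 <= Lk * Ik by exact: mule_ge0.
have fin' : Lk * Ik \is a fin_num.
  rewrite ge0_fin_numE//; apply: le_lt_trans fin.
  by rewrite E1 leeDl// mule_ge0.
have : Lk * Ik + e%:E * c = Lk * Ik + e%:E * (Lk * J + c0 * I).
  rewrite -E1 {1}E2 ge0_muleDl ?mule_ge0//.
  rewrite {1}E3 [Lk * (_ + _)]ge0_muleDr ?mule_ge0// -addeA.
  congr (_ + _); rewrite [RHS]ge0_muleDr ?mule_ge0//.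
  by rewrite [Lk * (_ * _)]muleCA -muleA.
move/(congr1 (fun x => x - Lk * Ik)); rewrite !(addeC (Lk * Ik)) !addeK//.
by move/(congr1 (fun x => p%:E * x)); rewrite !muleA -EFinM pe !mul1e.
Qed.

(** A difference quotient bounded by [M] forces the increments to vanish. *)
Lemma cvg_increment (R : realType) (L M : \bar R) (Lk c : nat -> \bar R) :
  L \is a fin_num -> M < +oo -> (forall k, 0 <= Lk k) -> (forall k, 0 <= c k) ->
  (forall k, c k <= M) -> (forall k, L = Lk k + (step k)%:E * c k) ->
  Lk k @[k --> \oo] --> L.
Proof.
move=> Lfin Mfin Lk0 c0 cM LE.
have se0 k : 0 <= (step k : R)%:E by rewrite lee_fin ltW// step_gt0.
have M0 : 0 <= M := le_trans (c0 0%N) (cM 0%N).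
have sc0 : (step k)%:E * c k @[k --> \oo] --> 0.
  apply: (@squeeze_cvge _ _ _ _ (cst 0) _ (fun k => (step k)%:E * M)).
  - by apply: nearW => k; rewrite /= mule_ge0//= lee_wpmul2l.
  - exact: cvg_cst.
  - have lf : M \is a fin_num by rewrite ge0_fin_numE.
    by rewrite -(mul0e M); apply: cvgeZr => //; exact: cvg_step.
have -> : Lk = fun k => L - (step k)%:E * c k.
  apply/funext => k; rewrite (LE k) addeK// ge0_fin_numE ?mule_ge0//.
  apply: (@le_lt_trans _ _ L); first by rewrite (LE k) leeDr.
  by rewrite -ge0_fin_numE// (LE k) adde_ge0// mule_ge0.
have : L - (step k)%:E * c k @[k --> \oo] --> L - 0.
  by apply: cvgeB => //; [rewrite fin_num_adde_defl|exact: cvg_cst].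
by rewrite sube0.
Qed.

Section moment_formula.
Context (R : realType) (X : completeMetricType R) (X_separable : separable X).
Variables (eta : probability (borel X) R) (rho : R.-ker (borel X) ~> measurableTypeR R).
Variable nu : {measure set (borel X * measurableTypeR R) -> \bar R}.
Hypothesis nuE : forall (A : set (borel X)) (B : set (measurableTypeR R)),
  measurable A -> measurable B -> nu (A `*` B) = \int[eta]_(x in A) rho x B.
Hypothesis eta_diffuse : forall z, eta [set z] = 0.
Context d (Omega : measurableType d) (P : probability Omega R).
Variable N : R.-ker Omega ~> (borel X * measurableTypeR R)%type.
Hypothesis N_poisson : is_poisson_random_measure P N nu.

(** The integral of [al] against the random measure. *)
Definition rmass (al : borel X -> R) (w : Omega) : \bar R := \int[N w]_p sized al p.

Hypothesis N_fin : {ae P, forall w, rmass (fun=> 1%R) w < +oo}.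

Lemma rmass_ge0 al w : (forall z, 0 <= al z)%R -> 0 <= rmass al w.
Proof. by move=> al0; apply: integral_ge0 => p _; exact: sized_ge0. Qed.

Lemma measurable_rmass (al : borel X -> R) : measurable_fun setT al -> (forall z, 0 <= al z)%R ->
  measurable_fun setT (rmass al).
Proof.
move=> mal al0; apply: measurable_kernel_integral; first exact: measurable_sized.
by move=> p; exact: sized_ge0.
Qed.

Lemma rmassD (al : borel X -> R) (t : R) (B : set (borel X)) w : measurable_fun setT al ->
  (forall z, 0 <= al z)%R -> (0 <= t)%R -> measurable B ->
  rmass (fun z => al z + t * \1_B z)%R w = rmass al w + t%:E * rmass \1_B w.
Proof.
move=> mal al0 t0 mB; rewrite /rmass.
have mBs : measurable_fun setT (sized (\1_B : borel X -> R)).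
  by apply: measurable_sized; exact: measurable_indic.
have Bs0 p : 0 <= sized (\1_B : borel X -> R) p by exact: sized_ge0.
rewrite (eq_integral (fun p => sized al p + t%:E * sized \1_B p)); last first.
  by move=> p _; exact: sizedD.
rewrite ge0_integralD; first last.
- exact: measurable_funeM.
- by move=> p _; rewrite mule_ge0.
- exact: measurable_sized.
- by move=> p _; exact: sized_ge0.
- by [].
rewrite ge0_integralZl_EFin; [by []|by []|by []|by []|exact: t0].
Qed.

Lemma rmass_le (al be : borel X -> R) w : measurable_fun setT al -> measurable_fun setT be ->
  (forall z, 0 <= al z)%R -> (forall z, al z <= be z)%R -> rmass al w <= rmass be w.
Proof.
move=> mal mbe al0 ab; have be0 z : (0 <= be z)%R by rewrite (le_trans _ (ab z)).
apply: ge0_le_integral.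
- by [].
- by move=> p _; exact: sized_ge0.
- exact: measurable_sized.
- exact: measurable_sized.
- move=> p _; rewrite /sized; case: ifP => // p0.
  by rewrite lee_fin ler_wpM2l// ltW.
Qed.

Lemma ae_notin (x : seq (borel X)) : {ae eta, forall z, z \notin x}.
Proof.
elim: x => [|y x IH]; first exact: nearW.
have Hy : {ae eta, forall z, z != y}.
  exists [set y]; split; [exact: measurable_borel_set1|exact: eta_diffuse|].
  by move=> z /= /negP; rewrite negbK => /eqP.
apply: filterS2 IH Hy => z zx zy.
by rewrite inE negb_or zy.
Qed.

(** The positive lower bound makes the exponential dominate all the moments. *)
Definition admissible (al : borel X -> R) : Prop :=
  step_function al /\ exists2 a : R, (0 < a)%R & forall z, (a <= al z)%R.

Lemma admissible_ge0 al z : admissible al -> (0 <= al z)%R.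
Proof. by move=> [_ [a a0 /(_ z)]]; apply: le_trans; exact: ltW. Qed.

Lemma admissible_measurable al : admissible al -> measurable_fun setT al.
Proof. by move=> [sal _]; exact: measurable_step_function. Qed.

Lemma admissible_add al (t : R) B : admissible al -> (0 <= t)%R -> measurable B ->
  admissible (fun z => al z + t * \1_B z)%R.
Proof.
move=> [sal [a a0 aal]] t0 mB; split; first exact: step_function_add.
by exists a => // z; rewrite (le_trans (aal z))// lerDl mulr_ge0.
Qed.

Definition laplace al : \bar R := \int[P]_w expN (rmass al w).

Lemma laplace_ge0 al : 0 <= laplace al.
Proof. by apply: integral_ge0 => w _; exact: expN_ge0. Qed.

(** The Mecke formula turns the Poisson integral into a factor [tau_1] integrated
    against [eta]. *)
Lemma first_moment al B : admissible al -> measurable B ->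
  \int[P]_w (expN (rmass al w) * rmass \1_B w) =
  laplace al * \int[eta]_(z in B) lap rho (powerw 1) z (al z).
Proof.
move=> aal mB; have mal := admissible_measurable aal.
have B0 (z : borel X) : (0 <= \1_B z :> R)%R by [].
have mB1 : measurable_fun setT (\1_B : borel X -> R) by exact: measurable_indic.
rewrite (mecke_formula N_poisson); first last.
- apply: filterS N_fin => w; apply: le_lt_trans.
  apply: rmass_le; [exact: mB1|exact: measurable_cst|exact: B0|].
  by move=> z; rewrite indicE lern1 leq_b1.
- by move=> p; exact: sized_ge0.
- exact: measurable_sized.
- by move=> p; apply: sized_ge0 => z; exact: admissible_ge0.
- exact: measurable_sized.
congr (_ * _).
rewrite (eq_integral (fun p : borel X * measurableTypeR R =>
    (\1_B p.1)%:E * lap_integrand (powerw 1) (al p.1) p.2)).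
  apply: (integral_intensity_lap nuE) => //; first exact: (proj1 aal).
  exact: weight_powerw.
by move=> p _; exact: sized_indic_lap.
Qed.

Lemma measurable_pweight_tuple n (be : borel X -> R) : measurable_fun setT be ->
  measurable_fun [set: n.-tuple (borel X)] (fun x => pweight rho be x).
Proof.
move=> mbe; rewrite (_ : (fun x => _) = fun x : n.-tuple (borel X) =>
  pweight rho be [seq tnth x i | i <- enum 'I_n]).
  apply: (@measurable_pweight _ _ rho X_separable _ _ _
    (fun i (x : n.-tuple (borel X)) => tnth x i) _ (fun=> be)).
    by move=> i; exact: measurable_tnth.
  move=> i; apply: (measurableT_comp mbe); exact: measurable_tnth.
by apply/funext => x; rewrite map_tnth_enum.
Qed.

Lemma measurable_indic_box n (A : 'I_n -> set (borel X)) :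
  (forall i, measurable (A i)) ->
  measurable_fun [set: n.-tuple (borel X)] (fun x => (\1_(box A) x : R)%:E).
Proof.
by move=> mA; apply/measurable_EFinP; apply: measurable_indic; exact: measurable_box.
Qed.

Lemma lee_prod (I : Type) (r : seq I) (x y : I -> \bar R) :
  (forall i, 0 <= x i) -> (forall i, x i <= y i) ->
  \prod_(i <- r) x i <= \prod_(i <- r) y i.
Proof.
move=> x0 xy; elim: r => [|i r IHr]; first by rewrite !big_nil.
by rewrite !big_cons; apply: lee_pmul => //; exact: prode_ge0.
Qed.

Lemma moment_fin n (A : 'I_n -> set (borel X)) (be : borel X -> R) :
  (forall i, measurable (A i)) -> admissible be ->
  \int[P]_w (expN (rmass be w) * \prod_(i < n) rmass \1_(A i) w) < +oo.
Proof.
move=> mA abe; have [_ [a a0 ab]] := abe.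
have mbe := admissible_measurable abe.
have mA1 i : measurable_fun setT (\1_(A i) : borel X -> R) by exact: measurable_indic.
apply: (@le_lt_trans _ _ (\int[P]_w (n`!%:R / a ^+ n)%:E)); last first.
  by rewrite integral_cst//= probability_setT mule1 ltry.
have W0 w : 0 <= \prod_(i < n) rmass \1_(A i) w.
  by apply: prode_ge0 => i _; apply: rmass_ge0.
apply: ge0_le_integral.
- by [].
- by move=> w _; rewrite mule_ge0// expN_ge0.
- apply: emeasurable_funM.
    apply: measurableT_comp; first exact: measurable_expN.
    by apply: measurable_rmass => // z; exact: admissible_ge0.
  by apply: emeasurable_prod => i; apply: measurable_rmass.
- exact: measurable_cst.
move=> w _; have T0 : 0 <= rmass (fun=> 1%R) w by apply: rmass_ge0.
apply: le_trans (expe_expN_bound n a0 T0); rewrite muleC.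
apply: lee_pmul => //; first exact: expN_ge0.
- apply: lee_prod => i; first exact: rmass_ge0.
  apply: rmass_le; [exact: mA1|exact: measurable_cst|by []|].
  by move=> z; rewrite indicE lern1 leq_b1.
- apply: expN_le.
  have -> : a%:E * rmass (fun=> 1%R) w = rmass (fun=> a) w.
    rewrite -ge0_integralZl_EFin; first last.
    + exact: ltW.
    + by apply: measurable_sized; exact: measurable_cst.
    + by move=> p _; exact: sized_ge0.
    + by [].
    apply: eq_integral => p _; rewrite /sized; case: ifP => _; last by rewrite mule0.
    by rewrite -EFinM mulr1 mulrC.
  apply: rmass_le => //.
  by move=> z; exact: ltW.
Qed.

Section induction_step.
Variables (n : nat) (A : 'I_n -> set (borel X)) (B : set (borel X)) (al : borel X -> R).
Hypotheses (mA : forall i, measurable (A i)) (mB : measurable B) (aal : admissible al).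

Let alk k : borel X -> R := (fun z => al z + step k * \1_B z)%R.
Let W w : \bar R := \prod_(i < n) rmass \1_(A i) w.

Let lapk k (x : seq (borel X)) y := lap rho (powerw (count_mem y x)) y (alk k y).
Let lapq k (x : seq (borel X)) y := (\1_B y)%:E *
  lap rho (fun s => powerw (count_mem y x) s * quot k s%:E) y (al y).
Let lap0 (x : seq (borel X)) y := lap rho (powerw (count_mem y x)) y (al y).
Let lapS (x : seq (borel X)) y := (\1_B y)%:E *
  lap rho (powerw (count_mem y x).+1) y (al y).

Definition pweight_quot k (x : seq (borel X)) : \bar R :=
  prod_incr (lapk k x) (lapq k x) (lap0 x) (undup x).

Let lapk_ge0 k x y : 0 <= lapk k x y.
Proof. by apply: lap_ge0; exact: weight_powerw. Qed.

Let lapq_ge0 k x y : 0 <= lapq k x y.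
Proof.
rewrite mule_ge0 ?lee_fin//.
by apply: lap_ge0; apply: weight_quot; exact: weight_powerw.
Qed.

Let lap0_ge0 x y : 0 <= lap0 x y.
Proof. by apply: lap_ge0; exact: weight_powerw. Qed.

Let lapS_ge0 x y : 0 <= lapS x y.
Proof. by rewrite mule_ge0 ?lee_fin//; apply: lap_ge0; exact: weight_powerw. Qed.

Let lap_incr k x y : lap0 x y = lapk k x y + (step k)%:E * lapq k x y.
Proof.
rewrite /lap0 /lapk /lapq /alk indicE; case: (y \in B) => /=.
  by rewrite mulr1 mul1e; apply: lap_increment; exact: weight_powerw.
by rewrite mulr0 addr0 mul0e mule0 adde0.
Qed.

Lemma pweight_quot_ge0 k x : 0 <= pweight_quot k x.
Proof. exact: prod_incr_ge0. Qed.

Lemma pweight_incr k x :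
  pweight rho al x = pweight rho (alk k) x + (step k)%:E * pweight_quot k x.
Proof.
apply: prod_incrE.
- by rewrite ltW// step_gt0.
- exact: lapk_ge0.
- exact: lapq_ge0.
- exact: lap_incr.
Qed.

Let step_le' := @step_le R.

Lemma pweight_quot_nd x : nondecreasing_seq (pweight_quot ^~ x).
Proof.
apply: prod_incr_nd => //.
- move=> y m k mk; apply: lap_nincr; first exact: weight_powerw.
  by rewrite /alk lerD2l ler_wpM2r// step_le'.
- move=> y m k mk; apply: lee_wpmul2l; first by rewrite lee_fin.
  by apply: lap_quot_nd; [exact: weight_powerw|exact: mk].
Qed.

Lemma cvg_pweight_quot x : pweight_quot k x @[k --> \oo] -->
  \sum_(y <- undup x) (\1_B y)%:E * pweight rho al (y :: x).
Proof.
rewrite [X in _ --> X](_ : _ = prod_incr (lap0 x) (lapS x) (lap0 x) (undup x)).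
  apply: cvg_prod_incr => //.
  - move=> y m k mk; apply: lap_nincr; first exact: weight_powerw.
    by rewrite /alk lerD2l ler_wpM2r// step_le'.
  - move=> y m k mk; apply: lee_wpmul2l; first by rewrite lee_fin.
    by apply: lap_quot_nd; [exact: weight_powerw|exact: mk].
  - move=> y; rewrite /lapk /alk indicE; case: (y \in B) => /=.
      under eq_fun do rewrite mulr1.
      by apply: lap_rcont; exact: weight_powerw.
    by under eq_fun do rewrite mulr0 addr0; exact: cvg_cst.
  - move=> y; rewrite /lapq /lapS indicE; case: (y \in B) => /=.
      rewrite mul1e; under eq_fun do rewrite mul1e.
      rewrite -powerwS; apply: cvg_lap_quot; exact: weight_powerw.
    by rewrite mul0e; under eq_fun do rewrite mul0e; exact: cvg_cst.
rewrite prod_incr_uniq ?undup_uniq//.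
apply: eq_big_seq => y yx; rewrite pweight_old; last by rewrite -mem_undup.
rewrite (bigD1_seq y yx (undup_uniq x)) [in RHS](bigD1_seq y yx (undup_uniq x)).
rewrite /= eqxx -muleA; congr (_ * (_ * _)).
by apply: eq_bigr => z /negbTE ->.
Qed.

Lemma measurable_pweight_quot k :
  measurable_fun [set: n.-tuple (borel X)] (fun x => pweight_quot k x).
Proof.
have mal := admissible_measurable aal.
have malk : measurable_fun setT (alk k).
  by apply: measurable_funD => //; apply: measurable_funM.
pose F (i : 'I_n) (x : n.-tuple (borel X)) := tnth x i.
have mF i : measurable_fun setT (F i) by exact: measurable_tnth.
rewrite (_ : (fun x => _) = fun x : n.-tuple (borel X) => snd
  (foldr (prod_step (lapk k x) (lapq k x) (lap0 x)) (1, 0)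
    (undup [seq F i x | i <- enum 'I_n]))); last first.
  by apply/funext => x; rewrite /pweight_quot /prod_incr /F map_tnth_enum.
apply: measurableT_comp; first exact: measurable_snd.
apply: (@measurable_foldr_undup _ _ X_separable _ _ _ F mF _ _
  (fun x => prod_step (lapk k x) (lapq k x) (lap0 x))) => i u mu.
have mlap w be : (forall m, weight (w m)) -> measurable_fun setT be ->
    measurable_fun setT (fun x : n.-tuple (borel X) =>
      lap rho (w (count_mem (F i x) x)) (F i x) (be (F i x))).
  move=> ww mbe.
  rewrite (_ : (fun x => _) = fun x : n.-tuple (borel X) =>
      lap rho (w (count_mem (F i x) [seq F j x | j <- enum 'I_n])) (F i x) (be (F i x))).
    apply: (@measurable_count_comp _ _ X_separable _ _ _ F mF
      (fun m x => lap rho (w m) (F i x) (be (F i x)))) => m.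
    exact: (measurableT_comp (measurable_lap_comp rho (ww m) mbe) (mF i)).
  by apply/funext => x; rewrite /F map_tnth_enum.
have wp := @weight_powerw R.
apply: measurable_fun_pair; rewrite /=.
  apply: emeasurable_funM; first exact: mlap.
  by apply: measurableT_comp => //; exact: measurable_fst.
apply: emeasurable_funD.
  apply: emeasurable_funM; last by apply: measurableT_comp => //; exact: measurable_fst.
  apply: emeasurable_funM.
    by apply/measurable_EFinP; apply: measurableT_comp => //; exact: measurable_indic.
  by apply: (mlap (fun m s => powerw m s * quot k s%:E) al) => // m; exact: weight_quot.
apply: emeasurable_funM; first exact: mlap.
by apply: measurableT_comp => //; exact: measurable_snd.
Qed.

Local Notation seat := (seating eta X_separable n).
Local Notation boxA := (fun x : n.-tuple (borel X) => (\1_(box A) x : R)%:E).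

Hypothesis IH : forall be, admissible be ->
  \int[P]_w (expN (rmass be w) * W w) =
  laplace be * \int[seat]_x (boxA x * pweight rho be x).

(** Increasing [al] on [B] by a small step, the induction hypothesis before and
    after the change gives two expressions of the same increment; divided by the
    step, both converge monotonically. The new sample point either opens a cell
    (the increment of the Laplace functional) or joins one (the increment of the
    partition weight). *)
Lemma moment_induction_step :
  \int[P]_w (expN (rmass al w) * W w * rmass \1_B w) =
  laplace al * \int[seat]_x (boxA x *
    (pweight rho al x * \int[eta]_(z in B) lap rho (powerw 1) z (al z) +
     \sum_(y <- undup x) (\1_B y)%:E * pweight rho al (y :: x))).
Proof.
have mal := admissible_measurable aal.
have al0 z : (0 <= al z)%R by exact: admissible_ge0.
have s0 k : (0 <= step k :> R)%R by rewrite ltW// step_gt0.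
have aalk k : admissible (alk k) by exact: admissible_add.
have B1m : measurable_fun setT (\1_B : borel X -> R) by exact: measurable_indic.
have A1m i : measurable_fun setT (\1_(A i) : borel X -> R) by exact: measurable_indic.
pose E be w := expN (rmass be w).
pose MB w := rmass \1_B w.
have MB0 w : 0 <= MB w by exact: rmass_ge0.
have mMB : measurable_fun setT MB by exact: measurable_rmass.
have W0 w : 0 <= W w by apply: prode_ge0 => i _; exact: rmass_ge0.
have mW : measurable_fun setT W by apply: emeasurable_prod => i; exact: measurable_rmass.
have E0 be w : 0 <= E be w by exact: expN_ge0.
have mE be : admissible be -> measurable_fun setT (E be).
  move=> abe; apply: measurableT_comp; first exact: measurable_expN.
  apply: measurable_rmass; first exact: admissible_measurable.
  by move=> z; exact: admissible_ge0.
have mEal := mE _ aal.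
have q0 k w : 0 <= quot k (MB w) by exact: quot_ge0.
have mq k : measurable_fun setT (fun w => quot k (MB w)).
  by apply: measurableT_comp => //; exact: measurable_quot.
have Ealk k w : E al w = E (alk k) w + (step k)%:E * (E al w * quot k (MB w)).
  rewrite /E /alk rmassD// expND ?rmass_ge0 ?step_ge0//.
  rewrite [X in _ + X]muleCA -ge0_muleDr ?expN_ge0//.
    by rewrite quotK// mule1.
  by rewrite mule_ge0// lee_fin.
pose V w := E al w * W w.
have V0 w : 0 <= V w by rewrite mule_ge0.
have mV : measurable_fun setT V by exact: emeasurable_funM.
have finV : \int[P]_w V w < +oo by exact: moment_fin.
pose c k := \int[P]_w (V w * quot k (MB w)).
pose c0 k := \int[P]_w (E al w * quot k (MB w)).
pose I0 := \int[seat]_x (boxA x * pweight rho al x).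
pose Ik k := \int[seat]_x (boxA x * pweight rho (alk k) x).
pose J k := \int[seat]_x (boxA x * pweight_quot k x).
have b0 (x : n.-tuple (borel X)) : 0 <= boxA x by rewrite lee_fin.
have mb : measurable_fun setT boxA by exact: measurable_indic_box.
have c_ge0 k : 0 <= c k by apply: integral_ge0 => w _; rewrite mule_ge0.
have c0_ge0 k : 0 <= c0 k by apply: integral_ge0 => w _; rewrite mule_ge0.
have J_ge0 k : 0 <= J k.
  by apply: integral_ge0 => x _; rewrite mule_ge0// pweight_quot_ge0.
have I0_ge0 : 0 <= I0.
  by apply: integral_ge0 => x _; rewrite mule_ge0// pweight_ge0.
have Ik_ge0 k : 0 <= Ik k.
  by apply: integral_ge0 => x _; rewrite mule_ge0// pweight_ge0.
have sE0 k : 0 <= (step k)%:E :> \bar R by rewrite lee_fin.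
have eq1 k : \int[P]_w V w = laplace (alk k) * Ik k + (step k)%:E * c k.
  rewrite -IH// -ge0_integralZl_EFin; first last.
  - exact: s0.
  - exact: emeasurable_funM.
  - by move=> w _; rewrite mule_ge0.
  - by [].
  rewrite -ge0_integralD; first last.
  - by apply: measurable_funeM; exact: emeasurable_funM.
  - by move=> w _; rewrite mule_ge0// mule_ge0.
  - by apply: emeasurable_funM; [apply: mE; exact: aalk|exact: mW].
  - by move=> w _; rewrite mule_ge0// E0.
  - by [].
  apply: eq_integral => w _; rewrite /V {1}(Ealk k w).
  rewrite ge0_muleDl//; last by rewrite mule_ge0// mule_ge0.
  by congr (_ + _); rewrite -muleA; congr (_ * _); rewrite muleAC.
have eq2 k : laplace al = laplace (alk k) + (step k)%:E * c0 k.
  rewrite -ge0_integralZl_EFin; first last.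
  - exact: s0.
  - exact: emeasurable_funM.
  - by move=> w _; rewrite mule_ge0.
  - by [].
  rewrite -ge0_integralD; first last.
  - by apply: measurable_funeM; exact: emeasurable_funM.
  - by move=> w _; rewrite mule_ge0// mule_ge0.
  - exact: mE.
  - by move=> w _; exact: E0.
  - by [].
  by apply: eq_integral => w _; exact: Ealk.
have mpw be : admissible be ->
    measurable_fun setT (fun x : n.-tuple (borel X) => boxA x * pweight rho be x).
  move=> abe; apply: emeasurable_funM; first exact: mb.
  by apply: measurable_pweight_tuple; exact: admissible_measurable.
have mpq k : measurable_fun setT (fun x : n.-tuple (borel X) => boxA x * pweight_quot k x).
  by apply: emeasurable_funM; [exact: mb|exact: measurable_pweight_quot].
have eq3 k : I0 = Ik k + (step k)%:E * J k.
  rewrite -ge0_integralZl_EFin; first last.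
  - exact: s0.
  - exact: mpq.
  - by move=> x _; rewrite mule_ge0// pweight_quot_ge0.
  - by [].
  rewrite -ge0_integralD; first last.
  - by apply: measurable_funeM; exact: mpq.
  - by move=> x _; rewrite mule_ge0// mule_ge0// pweight_quot_ge0.
  - exact: mpw.
  - by move=> x _; rewrite mule_ge0// pweight_ge0.
  - by [].
  apply: eq_integral => x _; rewrite (pweight_incr k) ge0_muleDr.
  - by rewrite [X in _ + X]muleCA.
  - exact: pweight_ge0.
  - by rewrite mule_ge0// pweight_quot_ge0.
have cE k : c k = laplace (alk k) * J k + c0 k * I0.
  apply: (@increment_cancel _ (laplace al) _ (Ik k) _ _ _ _ (step k) (2%:R ^+ k)).
  - by rewrite mulrC; exact: stepV.
  - exact: s0.
  - exact: laplace_ge0.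
  - exact: Ik_ge0.
  - exact: I0_ge0.
  - exact: J_ge0.
  - exact: c_ge0.
  - exact: c0_ge0.
  - by move: finV; rewrite (IH aal).
  - by rewrite -(eq1 k); exact/esym/(IH aal).
  - exact: eq2.
  - exact: eq3.
have ndq w : nondecreasing_seq (quot ^~ (MB w)) by exact: quot_nd.
have cvgc : c k @[k --> \oo] --> \int[P]_w (V w * MB w).
  rewrite (eq_integral (fun w => limn (fun k => V w * quot k (MB w)))).
    apply: cvg_monotone_convergence.
    - by [].
    - by move=> k; exact: emeasurable_funM.
    - by move=> k w _; rewrite mule_ge0.
    - by move=> w _ m k mk; apply: lee_wpmul2l; [exact: V0|exact: ndq].
  move=> w _; apply/esym/cvg_lim; first by [].
  apply: ge0_cvgeZl; [exact: V0|by move=> k; exact: q0|exact: ndq|exact: cvg_quot].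
pose kap := \int[eta]_(z in B) lap rho (powerw 1) z (al z).
have kap0 : 0 <= kap.
  by apply: integral_ge0 => z _; apply: lap_ge0; exact: weight_powerw.
have cvgc0 : c0 k @[k --> \oo] --> laplace al * kap.
  rewrite -first_moment// (eq_integral (fun w => limn (fun k => E al w * quot k (MB w)))).
    apply: cvg_monotone_convergence.
    - by [].
    - by move=> k; exact: emeasurable_funM.
    - by move=> k w _; rewrite mule_ge0.
    - by move=> w _ m k mk; apply: lee_wpmul2l; [exact: E0|exact: ndq].
  move=> w _; apply/esym/cvg_lim; first by [].
  apply: ge0_cvgeZl; [exact: E0|by move=> k; exact: q0|exact: ndq|exact: cvg_quot].
have nd_c0 : nondecreasing_seq c0.
  move=> m k mk; apply: ge0_le_integral.
  - by [].
  - by move=> w _; rewrite mule_ge0.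
  - exact: emeasurable_funM.
  - exact: emeasurable_funM.
  - by move=> w _; apply: lee_wpmul2l; [exact: E0|exact: ndq].
have Lfin be : admissible be -> laplace be \is a fin_num.
  move=> abe; rewrite ge0_fin_numE ?laplace_ge0//.
  have := @moment_fin 0 (fun=> set0) be (fun=> measurable0) abe.
  by under eq_integral do rewrite big_ord0 mule1.
have c0_fin : laplace al * kap < +oo.
  rewrite -first_moment//.
  have := @moment_fin 1 (fun=> B) al (fun=> mB) aal.
  by under eq_integral do rewrite big_ord1.
have cvgL : laplace (alk k) @[k --> \oo] --> laplace al.
  apply: (cvg_increment (Lfin _ aal) c0_fin _ c0_ge0 _ eq2).
    by move=> k; exact: laplace_ge0.
  by move=> k; exact: (ereal_nd_le_lim nd_c0 cvgc0).
have nd_L : nondecreasing_seq (fun k => laplace (alk k)).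
  move=> m k mk; apply: ge0_le_integral.
  - by [].
  - by move=> w _; exact: E0.
  - exact: mE.
  - exact: mE.
  - move=> w _; apply: expN_le; rewrite /alk !rmassD// leeD2l//.
    by apply: lee_wpmul2r => //; rewrite lee_fin step_le'.
pose S (x : n.-tuple (borel X)) := \sum_(y <- undup x) (\1_B y)%:E * pweight rho al (y :: x).
have ndJx x : nondecreasing_seq (fun k => boxA x * pweight_quot k x).
  by move=> m k mk; apply: lee_wpmul2l; [exact: b0|exact: pweight_quot_nd].
have cvgJ : J k @[k --> \oo] --> \int[seat]_x (boxA x * S x).
  rewrite (eq_integral (fun x => limn (fun k => boxA x * pweight_quot k x))).
    apply: cvg_monotone_convergence.
    - by [].
    - exact: mpq.
    - by move=> k x _; rewrite mule_ge0// pweight_quot_ge0.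
    - by move=> x _; exact: ndJx.
  move=> x _; apply/esym/cvg_lim; first by [].
  apply: ge0_cvgeZl; first exact: b0.
  - by move=> k; exact: pweight_quot_ge0.
  - exact: pweight_quot_nd.
  - exact: cvg_pweight_quot.
have nd_J : nondecreasing_seq J.
  move=> m k mk; apply: ge0_le_integral.
  - by [].
  - by move=> x _; rewrite mule_ge0// pweight_quot_ge0.
  - exact: mpq.
  - exact: mpq.
  - by move=> x _; exact: ndJx.
have S0 x : 0 <= S x.
  by apply: sume_ge0 => y _; rewrite mule_ge0// ?lee_fin// pweight_ge0.
have mS : measurable_fun setT (fun x => boxA x * S x).
  apply: (emeasurable_fun_cvg (fun k x => boxA x * pweight_quot k x)).
    by move=> k; exact: mpq.
  move=> x _; apply: ge0_cvgeZl; first exact: b0.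
  - by move=> k; exact: pweight_quot_ge0.
  - exact: pweight_quot_nd.
  - exact: cvg_pweight_quot.
have L0 := laplace_ge0 al.
have JS0 : 0 <= \int[seat]_x (boxA x * S x).
  by apply: integral_ge0 => x _; apply: mule_ge0; [exact: b0|exact: S0].
transitivity (laplace al * \int[seat]_x (boxA x * S x) + laplace al * kap * I0).
  apply: (cvg_unique _ cvgc) => //=.
  rewrite (_ : c = fun k => laplace (alk k) * J k + c0 k * I0); last exact/funext.
  apply: cvgeD.
  - apply: ge0_adde_def; rewrite inE.
      by apply: mule_ge0; [exact: L0|exact: JS0].
    by apply: mule_ge0; [apply: mule_ge0; [exact: L0|exact: kap0]|exact: I0_ge0].
  - apply: ge0_nd_cvgeM.
    + by move=> k; exact: laplace_ge0.
    + exact: J_ge0.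
    + exact: nd_L.
    + exact: nd_J.
    + exact: cvgL.
    + exact: cvgJ.
  - rewrite muleC; under eq_fun do rewrite muleC.
    apply: ge0_cvgeZl; [exact: I0_ge0|exact: c0_ge0|exact: nd_c0|exact: cvgc0].
rewrite -muleA -ge0_muleDr; first last.
- by apply: mule_ge0; [exact: kap0|exact: I0_ge0].
- exact: JS0.
apply: (congr1 (fun x => laplace al * x)).
rewrite muleC /I0 -ge0_integralZr; first last.
- exact: kap0.
- by move=> x _; apply: mule_ge0; [exact: b0|exact: pweight_ge0].
- exact: mpw.
- by [].
rewrite -ge0_integralD; first last.
- apply: emeasurable_funM; [exact: mpw|exact: measurable_cst].
- move=> x _; apply: mule_ge0; last exact: kap0.
  by apply: mule_ge0; [exact: b0|exact: pweight_ge0].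
- exact: mS.
- by move=> x _; apply: mule_ge0; [exact: b0|exact: S0].
- by [].
apply: eq_integral => x _; rewrite addeC -muleA -ge0_muleDr; [by []| |exact: S0].
by apply: mule_ge0; [exact: pweight_ge0|exact: kap0].
Qed.

End induction_step.

(** Joint moments of the random measure on sets [A i] under an exponential tilt. By
    induction on the number of sets: differentiating the identity for [n] sets in
    the direction of the indicator of one more set gives the identity for [n + 1].
    The exponent has to be a function, not only a constant, for this to work. *)
Theorem moment_formula n (A : 'I_n -> set (borel X)) (al : borel X -> R) :
  (forall i, measurable (A i)) -> admissible al ->
  \int[P]_w (expN (rmass al w) * \prod_(i < n) rmass \1_(A i) w) =
  laplace al * \int[seating eta X_separable n]_x
                 ((\1_(box A) x)%:E * pweight rho al x).
Proof.
elim: n A al => [|n IH] A al mA aal.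
  rewrite integral_seating0; last first.
    apply: emeasurable_funM; first exact: measurable_indic_box.
    by apply: measurable_pweight_tuple; exact: admissible_measurable.
  rewrite /pweight /= big_nil indicE mem_set; last by move=> /= [].
  by rewrite !mule1; apply: eq_integral => w _; rewrite big_ord0 mule1.
pose B := A ord0; pose A' i := A (lift ord0 i).
have mB : measurable B by exact: mA.
have mA' i : measurable (A' i) by exact: mA.
have mal := admissible_measurable aal.
rewrite (eq_integral (fun w => expN (rmass al w) *
    \prod_(i < n) rmass \1_(A' i) w * rmass \1_B w)); last first.
  by move=> w _; rewrite big_ord_recl -muleA (muleC (\prod_(_ < _) _)).
rewrite (moment_induction_step mA' mB aal); last by move=> be abe; exact: IH.
congr (_ * _).
rewrite integral_seatingS; first last.
- by move=> t; rewrite mule_ge0// ?lee_fin// pweight_ge0.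
- apply: emeasurable_funM; first exact: measurable_indic_box.
  exact: measurable_pweight_tuple.
apply: eq_integral => x _; rewrite /extend.
have boxE z : (\1_(box A) [tuple of z :: x] : R) = (\1_B z * \1_(box A') x)%R.
  rewrite !indic_box big_ord_recl tnth0; congr (_ * _)%R.
  by apply: eq_bigr => i _; rewrite tnthS.
rewrite ge0_muleDr; first last.
- by apply: sume_ge0 => y _; rewrite mule_ge0// ?lee_fin// pweight_ge0.
- rewrite mule_ge0 ?pweight_ge0//.
  by apply: integral_ge0 => z _; apply: lap_ge0; exact: weight_powerw.
have ml : measurable_fun setT (fun z => lap rho (powerw 1) z (al z)).
  by apply: measurable_lap_comp => //; exact: weight_powerw.
have mlB : measurable_fun setT ((fun z => lap rho (powerw 1) z (al z)) \_ B).
  by apply/(measurable_restrictT _ mB)/measurable_funTS.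
congr (_ + _).
  rewrite integral_mkcond muleA -ge0_integralZl; first last.
  - by rewrite mule_ge0 ?lee_fin// pweight_ge0.
  - move=> z _; rewrite patchE; case: ifP => // _.
    by apply: lap_ge0; exact: weight_powerw.
  - exact: mlB.
  - by [].
  apply: ge0_ae_eq_integral => //.
  - by apply: measurable_funeM; exact: mlB.
  - apply: (measurableT_comp (f := fun t : n.+1.-tuple (borel X) =>
      (\1_(box A) t : R)%:E * pweight rho al t)).
      apply: emeasurable_funM; first exact: measurable_indic_box.
      exact: measurable_pweight_tuple.
    exact: measurable_cons.
  - move=> z _; rewrite mule_ge0//; first by rewrite mule_ge0// ?lee_fin// pweight_ge0.
    rewrite patchE; case: ifP => // _.
    by apply: lap_ge0; exact: weight_powerw.
  - by move=> z _; rewrite mule_ge0// ?lee_fin// pweight_ge0.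
  apply: filterS (ae_notin x) => z zx _.
  rewrite boxE pweight_new// patchE [\1_B z]indicE; case: (z \in B) => /=;
    last by rewrite mule0 mul0r mul0e.
  by rewrite mul1r -muleA; congr (_ * _); rewrite muleC.
rewrite ge0_sume_distrr; last first.
  by move=> y _; rewrite mule_ge0// ?lee_fin// pweight_ge0.
apply: eq_bigr => y _; rewrite boxE EFinM muleA; congr (_ * _).
by rewrite muleC.
Qed.

End moment_formula.

(** * Moments of a completely random measure *)

(** A point of positive mass would be an atom. *)
Lemma nonatomic_set1 (R : realType) (X : completeMetricType R)
  (eta : probability (borel X) R) (z : borel X) : nonatomic eta -> eta [set z] = 0.
Proof.
move=> na; apply/eqP; rewrite eq_le measure_ge0 andbT leNgt; apply/negP => z0.
apply: na; exists [set z]; split=> //; first exact: measurable_borel_set1.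
move=> B mB /subset_set1[->|->]; [by left; rewrite measure0|by right].
Qed.

Section random_measure_moments.
Context (R : realType) (X : completeMetricType R) (X_separable : separable X).
Variables (eta : probability (borel X) R) (rho : R.-sigmafker (borel X) ~> measurableTypeR R).
Variable nu : {measure set (borel X * measurableTypeR R) -> \bar R}.
Hypothesis nuE : forall (A : set (borel X)) (B : set (measurableTypeR R)),
  measurable A -> measurable B -> nu (A `*` B) = \int[eta]_(x in A) rho x B.
Hypothesis eta_diffuse : forall z, eta [set z] = 0.
Context d (Omega : measurableType d) (P : probability Omega R).
Variable N : R.-ker Omega ~> (borel X * measurableTypeR R)%type.
Hypothesis N_poisson : is_poisson_random_measure P N nu.
Variable mu : {mfun Omega >-> bfmeasures X}.
Hypothesis muN : {ae P, forall w, forall A : set (borel X), measurable A ->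
  mu w A = \int[N w]_(p in A `*` `]0%R, +oo[) (p.2 : R)%:E}.
Hypothesis mu_total : {ae P, forall w, 0 < (mu w : bfmeasure X) setT < +oo}.

Let rmass_indic w A : measurable A ->
  \int[N w]_(p in A `*` `]0%R, +oo[) (p.2 : R)%:E = rmass N \1_A w.
Proof.
move=> mA; rewrite integral_mkcond; apply: eq_integral => -[z s] _.
rewrite patchE in_setX mem_setE in_itv/= andbT /sized/= indicE.
case: ifPn => [/andP[-> ->]|]; first by rewrite mulr1.
rewrite negb_and => /orP[/negbTE ->|/negbTE ->]; last by [].
by rewrite mulr0 if_same.
Qed.

Let mu_rmass : {ae P, forall w, forall A : set (borel X), measurable A ->
  mu w A = rmass N \1_A w}.
Proof. by apply: filterS muN => w H A mA; rewrite H// rmass_indic. Qed.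

Let rmass1 w : rmass N \1_[set: borel X] w = rmass N (fun=> 1%R) w.
Proof. by rewrite /rmass; apply: eq_integral => p _; rewrite /sized indicT. Qed.

Let N_fin : {ae P, forall w, rmass N (fun=> 1%R) w < +oo}.
Proof.
by apply: filterS2 mu_rmass mu_total => w H /andP[_]; rewrite H// rmass1.
Qed.

Let rmass_cst (a : R) w : (0 <= a)%R -> rmass N (fun=> a) w = a%:E * rmass N (fun=> 1%R) w.
Proof.
move=> a0; rewrite /rmass -ge0_integralZl_EFin; first last.
- exact: a0.
- by apply: measurable_sized; exact: measurable_cst.
- by move=> p _; apply: sized_ge0 => _; exact: ler01.
- by [].
apply: eq_integral => p _; rewrite /sized; case: ifP => _; last by rewrite mule0.
by rewrite -EFinM mulr1 mulrC.
Qed.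

(** The Laplace transform of the total mass, equal to [exp (- psi_0 a)] for [a >= 0];
    as an expectation it is measurable in [a] by Tonelli's theorem. *)
Definition mass_laplace (a : R) : \bar R := \int[P]_w expN (a%:E * mu w [set: borel X]).

Let laplace_cst (a : R) : (0 <= a)%R -> laplace P N (fun=> a) = mass_laplace a.
Proof.
move=> a0; rewrite /laplace /mass_laplace; apply: ge0_ae_eq_integral.
- by [].
- apply: measurableT_comp; first exact: measurable_expN.
  by apply: measurable_rmass => //; exact: measurable_cst.
- apply: measurableT_comp; first exact: measurable_expN.
  apply: measurable_funeM.
  exact: (measurableT_comp (measurable_eval measurableT) (@measurable_funPT _ _ _ _ mu)).
- by move=> w _; exact: expN_ge0.
- by move=> w _; exact: expN_ge0.
by apply: filterS mu_rmass => w H _; rewrite rmass_cst// H// rmass1.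
Qed.

Lemma mass_laplaceE (a : R) : (0 <= a)%R -> mass_laplace a = expeR (- psi eta rho 0 a).
Proof.
move=> a0; rewrite -laplace_cst// /laplace /rmass (laplace_functional N_poisson); first last.
- by move=> p; apply: sized_ge0.
- by apply: measurable_sized; exact: measurable_cst.
rewrite -/(expN _); congr expN.
pose g (s : measurableTypeR R) : \bar R := if (0 < (s : R))%R then onemexpN (a * s)%:E else 0.
have mg : measurable_fun setT g.
  apply: measurable_fun_ifT.
  - by apply: measurable_fun_ltr; [exact: measurable_cst|exact: measurable_id].
  - apply: measurableT_comp; first exact: measurable_onemexpN.
    by apply/measurable_EFinP; exact: mulrl_measurable.
  - exact: measurable_cst.
have g0 s : 0 <= g s.
  rewrite /g; case: ifPn => s0; last by [].
  by apply: onemexpN_ge0; rewrite lee_fin mulr_ge0// ltW.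
rewrite (eq_integral (fun p : borel X * measurableTypeR R => (\1_[set: borel X] p.1)%:E * g p.2)); last first.
  move=> p _; rewrite indicT mul1e /sized /g; case: ifP => _; first by rewrite mulrC.
  by rewrite /onemexpN expN0 subee.
rewrite (integral_intensity_prod nuE measurableT mg g0); apply: eq_integral => z _.
rewrite [RHS]integral_mkcond; apply: eq_integral => s _.
rewrite patchE mem_setE in_itv/= andbT /g; case: ifP => // _.
by rewrite mul0r oppr0 expR0 mulr1 /onemexpN expN_fin.
Qed.

Lemma random_measure_moment n (A : 'I_n -> set (borel X)) (a : R) :
  (forall i, measurable (A i)) -> (0 < a)%R ->
  \int[P]_w (expN (a%:E * mu w [set: borel X]) * \prod_(i < n) mu w (A i)) =
  mass_laplace a * \int[seating eta X_separable n]_x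
    ((\1_(box A) x)%:E * pweight rho (fun=> a) x).
Proof.
move=> mA a0; rewrite -laplace_cst; last exact: ltW.
rewrite -(moment_formula X_separable nuE eta_diffuse N_poisson N_fin mA); last first.
  by split; [exact: step_function_cst|exists a].
have mmu B : measurable B -> measurable_fun setT (fun w => mu w B).
  move=> mB.
  exact: (measurableT_comp (measurable_eval mB) (@measurable_funPT _ _ _ _ mu)).
apply: ge0_ae_eq_integral.
- by [].
- apply: emeasurable_funM.
    apply: measurableT_comp; first exact: measurable_expN.
    by apply: measurable_funeM; exact: mmu.
  by apply: emeasurable_prod => i; exact: mmu.
- apply: emeasurable_funM.
    apply: measurableT_comp; first exact: measurable_expN.
    apply: measurable_rmass; first exact: measurable_cst.
    by move=> _; exact: ltW.
  apply: emeasurable_prod => i; apply: measurable_rmass; first exact: measurable_indic.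
  by [].
- move=> w _; apply: mule_ge0; first exact: expN_ge0.
  by apply: prode_ge0 => i _; exact: measure_ge0.
- move=> w _; apply: mule_ge0; first exact: expN_ge0.
  by apply: prode_ge0 => i _; exact: rmass_ge0.
apply: filterS mu_rmass => w H _; rewrite rmass_cst; last exact: ltW.
rewrite H// rmass1; congr (_ * _); apply: eq_bigr => i _; exact: H.
Qed.

Lemma measurable_mass_laplace : measurable_fun setT mass_laplace.
Proof.
apply: (@measurable_fun_fubini_tonelli_F _ _ _ _ _ P
  (fun p : measurableTypeR R * Omega => expN (p.1%:E * mu p.2 [set: borel X]))).
  apply: measurableT_comp; first exact: measurable_expN.
  apply: emeasurable_funM; first by apply/measurable_EFinP; exact: measurable_fst.
  apply: (measurableT_comp (measurable_eval measurableT)).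
  exact: (measurableT_comp (@measurable_funPT _ _ _ _ mu) measurable_snd).
by move=> p; exact: expN_ge0.
Qed.

End random_measure_moments.

(** * Tilting and gamma laws *)

Lemma measurable_inve_ge0 (R : realType) d (T : measurableType d) (f : T -> \bar R) :
  measurable_fun setT f -> (forall x, 0 <= f x) -> measurable_fun setT (fun x => (f x)^-1).
Proof.
move=> mf f0.
rewrite (_ : (fun x => _) = fun x => if f x == 0 then +oo else
    if f x == +oo then 0 else ((fine (f x)) `^ (- 1))%:E).
  have meq (c : \bar R) : measurable_fun setT (fun x => f x == c).
    by apply: measurable_fun_eqe => //; exact: measurable_cst.
  apply: measurable_fun_ifT; [exact: meq|exact: measurable_cst|].
  apply: measurable_fun_ifT; [exact: meq|exact: measurable_cst|].
  apply/measurable_EFinP.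
  have mfine : measurable_fun setT (fun x => fine (f x)).
    exact: (measurableT_comp (fine_measurable measurableT) mf).
  exact: (measurableT_comp (measurable_powR (- 1)) mfine).
apply/funext => x; have := f0 x; case: (f x) => [r| |]//= r0.
by rewrite inver eqe; case: ifP => // _; rewrite powR_inv1.
Qed.

Section tilting.
Context (R : realType) (X : completeMetricType R).
Context d0 (Omega0 : measurableType d0) (P0 : probability Omega0 R).
Variables (mu : {mfun Omega0 >-> bfmeasures X}) (h : R -> R).
Hypothesis mu_total : {ae P0, forall w, 0 < (mu w : bfmeasure X) setT < +oo}.
Hypothesis mh : measurable_fun setT h.
Hypothesis h_ge0 : forall x, (0 <= h x)%R.
Hypothesis h_fin : \int[P0]_w (h (total_mass (mu w)))%:E < +oo.
Context d (Omega : measurableType d) (P : probability Omega R).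
Variable mut : {mfun Omega >-> bfmeasures X}.
Hypothesis mut_tilted : is_tilted P0 mu h P mut.

Definition tilt_norm : R := fine (\int[P0]_w (h (total_mass (mu w)))%:E).

Let mmu : measurable_fun setT (mu : Omega0 -> bfmeasures X).
Proof. exact: measurable_funPT. Qed.

Let mmut : measurable_fun setT (mut : Omega -> bfmeasures X).
Proof. exact: measurable_funPT. Qed.

Let mhT : measurable_fun [set: bfmeasures X] (fun m : bfmeasures X => (h (total_mass m))%:E).
Proof.
apply/measurable_EFinP.
exact: (measurableT_comp mh (@measurable_total_mass R X)).
Qed.

Let hT0 (m : bfmeasures X) : 0 <= (h (total_mass m))%:E.
Proof. by rewrite lee_fin. Qed.

Let cE : \int[P0]_w (h (total_mass (mu w)))%:E = tilt_norm%:E.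
Proof.
by rewrite /tilt_norm fineK// ge0_fin_numE//; apply: integral_ge0 => w _; exact: hT0.
Qed.

(** The tilted law has total mass 1, whereas a vanishing norming constant would give
    it mass [+oo * 0 = 0]. *)
Lemma tilt_norm_gt0 : (0 < tilt_norm)%R.
Proof.
have := mut_tilted measurableT.
rewrite cE probability_setT ge0_integral_distribution; first last.
- exact: hT0.
- exact: mhT.
rewrite /comp cE lt_neqAle => e1; apply/andP; split; last first.
  by rewrite /tilt_norm fine_ge0//; apply: integral_ge0 => w _; exact: hT0.
by apply/eqP => c0; move/eqP: e1; rewrite -c0 mule0 onee_eq0.
Qed.

Lemma tilted_integral (G : bfmeasures X -> \bar R) : measurable_fun setT G ->
  (forall m, 0 <= G m) ->
  \int[P]_w G (mut w) =
  (tilt_norm^-1)%:E * \int[P0]_w ((h (total_mass (mu w)))%:E * G (mu w)).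
Proof.
move=> mG G0; have c0 := tilt_norm_gt0.
have mhG : measurable_fun setT (fun w => (h (total_mass (mu w)))%:E * G (mu w)).
  by apply: emeasurable_funM; [exact: (measurableT_comp mhT mmu)|exact: (measurableT_comp mG mmu)].
have ci0 : (0 <= tilt_norm^-1)%R by rewrite invr_ge0 ltW.
rewrite -ge0_integralZl_EFin; first last.
- exact: ci0.
- exact: mhG.
- by move=> w _; apply: mule_ge0; [exact: hT0|exact: G0].
- by [].
transitivity (\int[P]_w (1 * G (mut w))).
  by apply: eq_integral => w _; rewrite mul1e.
rewrite (@ge0_integral_weight_eq _ _ _ _ _ _ R P P0 (fun=> 1)
  (fun w => (tilt_norm^-1)%:E * (h (total_mass (mu w)))%:E) mut mu).
- by apply: eq_integral => w _; rewrite muleA.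
- exact: measurable_cst.
- by move=> _; exact: lee01.
- exact: mmut.
- by apply: measurable_funeM; exact: (measurableT_comp mhT mmu).
- by move=> w; apply: mule_ge0; [rewrite lee_fin|exact: hT0].
- exact: mmu.
- move=> A mA; transitivity (distribution P mut A).
    transitivity (\int[P]_w (\1_(mut @^-1` A) w)%:E).
      by apply: eq_integral => w _; rewrite mul1e.
    rewrite integral_indic ?setIT//.
    by have := mmut measurableT mA; rewrite setTI.
  rewrite (mut_tilted mA) cE inver gt_eqF//.
  rewrite [in LHS]integral_mkcond ge0_integral_distribution; first last.
  + by move=> m; rewrite patchE; case: ifP => // _; exact: hT0.
  + by apply/(measurable_restrictT _ mA)/measurable_funTS.
  rewrite -ge0_integralZl_EFin; first last.
  + exact: ci0.
  + apply: (measurableT_comp _ mmu).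
    by apply/(measurable_restrictT _ mA)/measurable_funTS.
  + by move=> w _; rewrite /= patchE; case: ifP => // _; exact: hT0.
  + by [].
  apply: eq_integral => w _; rewrite /= patchE indicE -muleA; congr (_ * _).
  by case: ifP => _; rewrite ?mule1 ?mule0.
- exact: mG.
- exact: G0.
Qed.

Lemma tilted_total : {ae P, forall w, 0 < (mut w : bfmeasure X) setT < +oo}.
Proof.
have mev := @measurable_eval R X _ measurableT.
pose bad : set (bfmeasures X) := ~` [set m | 0 < (m : bfmeasure X) setT < +oo].
have mbad : measurable bad.
  apply: measurableC; rewrite (_ : [set _ | _] =
      (fun m : bfmeasures X => m [set: borel X]) @^-1` (`]0, +oo[ `\` [set +oo])).
    rewrite -[X in measurable X]setTI; apply: mev => //.
    by apply: measurableD; [exact: emeasurable_itv|exact: emeasurable_set1].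
  apply/seteqP; split => m /=; rewrite in_itv/= andbT.
    by move=> /andP[m0 my]; split => // e; rewrite e in my.
  by move=> [-> /eqP my]; rewrite ltey.
exists (mut @^-1` bad); split.
- by rewrite -[X in measurable X]setTI; exact: mmut.
- have mbadP : measurable (mut @^-1` bad).
    by rewrite -[X in measurable X]setTI; exact: mmut.
  transitivity (\int[P]_w (\1_bad (mut w))%:E).
    by rewrite -[in LHS](setIT (mut @^-1` bad)) -integral_indic.
  rewrite (tilted_integral (G := fun m => (\1_bad m)%:E)); first last.
  + by move=> m; rewrite lee_fin.
  + by apply/measurable_EFinP; exact: measurable_indic.
  rewrite (ge0_ae_eq_integral _ (g := fun=> 0)).
  + by rewrite integral0 mule0.
  + by [].
  + apply: emeasurable_funM; first exact: (measurableT_comp mhT mmu).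
    apply/measurable_EFinP; apply: measurableT_comp mmu; exact: measurable_indic.
  + exact: measurable_cst.
  + by move=> w _; apply: mule_ge0; [exact: hT0|rewrite lee_fin].
  + by [].
  apply: filterS mu_total => w H _; rewrite indicE memNset ?mule0//.
- by move=> w /=.
Qed.


End tilting.

Section gamma_density.
Context (R : realType).
Local Notation leb := (@lebesgue_measure R).

(** [u ^ (a - 1)] on the half-line of positive [u], extended by zero: carrying the
    indicator in the integrand keeps all integrals over the whole line. *)
Definition powp (a u : R) : \bar R := if (0 < u)%R then poww a u else 0.

Lemma powp_ge0 a u : 0 <= powp a u.
Proof. by rewrite /powp; case: ifP => // u0; rewrite lee_fin powR_ge0. Qed.

Lemma powp_fin a u : powp a u \is a fin_num.
Proof. by rewrite /powp; case: ifP. Qed.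

Lemma measurable_powp a : measurable_fun setT (powp a : measurableTypeR R -> \bar R).
Proof.
apply: measurable_fun_ifT.
- by apply: measurable_fun_ltr; [exact: measurable_cst|exact: measurable_id].
- exact: (proj1 (weight_poww a)).
- exact: measurable_cst.
Qed.

Definition gamma_density (a t u : R) : \bar R :=
  powp a u * (expR (- (u * t)) * t `^ a / Gamma a)%:E.

Lemma gamma_density_ge0 a t u : (1 <= a)%R -> 0 <= gamma_density a t u.
Proof.
move=> a1; apply: mule_ge0; first exact: powp_ge0.
rewrite lee_fin divr_ge0//; first by rewrite mulr_ge0 ?expR_ge0 ?powR_ge0.
by apply: ltW; exact: Gamma_gt0.
Qed.

Lemma gamma_lawE a t (B : set (measurableTypeR R)) :
  gamma_law a t B = \int[leb]_u ((\1_B u)%:E * gamma_density a t u).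
Proof.
rewrite /gamma_law integral_mkcond; apply: eq_integral => u _.
rewrite patchE in_setI mem_setE in_itv/= andbT indicE /gamma_density /powp.
case: (u \in B); last by rewrite mul0e.
rewrite mul1e /=; case: ifPn => u0; last by rewrite mul0e.
by rewrite /poww -EFinM !mulrA.
Qed.

Lemma measurable_gamma_density a d (T : measurableType d) (t : T -> R) :
  measurable_fun setT t ->
  measurable_fun setT (fun p : T * measurableTypeR R => gamma_density a (t p.1) p.2).
Proof.
move=> mt.
have mt1 : measurable_fun setT (fun p : T * measurableTypeR R => t p.1).
  exact: (measurableT_comp mt measurable_fst).
apply: emeasurable_funM.
  exact: (measurableT_comp (measurable_powp a) measurable_snd).
apply/measurable_EFinP; apply: measurable_funM; last exact: measurable_cst.
apply: measurable_funM.
  apply: measurableT_comp; first exact: measurable_expR.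
  by apply: measurable_funN; apply: measurable_funM; [exact: measurable_snd|exact: mt1].
exact: (measurableT_comp (measurable_powR a) mt1).
Qed.

Lemma measurable_gamma_law a d (T : measurableType d) (t : T -> R)
    (B : set (measurableTypeR R)) : (1 <= a)%R ->
  measurable_fun setT t -> measurable B ->
  measurable_fun setT (fun x => gamma_law a (t x) B).
Proof.
move=> a1 mt mB; under eq_fun do rewrite gamma_lawE.
apply: (@measurable_fun_fubini_tonelli_F _ _ _ _ _ leb
  (fun p : T * measurableTypeR R => (\1_B p.2)%:E * gamma_density a (t p.1) p.2)).
  apply: emeasurable_funM; last exact: measurable_gamma_density.
  apply/measurable_EFinP.
  exact: (measurableT_comp (measurable_indic mB) measurable_snd).
by move=> p; apply: mule_ge0; [rewrite lee_fin|exact: gamma_density_ge0].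
Qed.

Lemma gamma_law_ge0 a t (B : set (measurableTypeR R)) : (1 <= a)%R -> 0 <= gamma_law a t B.
Proof.
move=> a1; rewrite gamma_lawE; apply: integral_ge0 => u _.
by apply: mule_ge0; [rewrite lee_fin|exact: gamma_density_ge0].
Qed.

End gamma_density.

(** * Augmented moments of the tilted measure *)

Section joint_moment.
Context (R : realType) (X : completeMetricType R) (X_separable : separable X).
Local Notation leb := (@lebesgue_measure R).
Variables (eta : probability (borel X) R) (rho : R.-sigmafker (borel X) ~> measurableTypeR R).
Context d0 (Omega0 : measurableType d0) (P0 : probability Omega0 R).
Variables (mu : {mfun Omega0 >-> bfmeasures X}) (gamma q : R).
Hypotheses (q_ge0 : (0 <= q)%R) (gamma_ge0 : (0 <= gamma)%R).
Hypothesis mu_total : {ae P0, forall w, 0 < (mu w : bfmeasure X) setT < +oo}.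
Hypothesis mu_moment : forall n (A : 'I_n -> set (borel X)) (a : R),
  (forall i, measurable (A i)) -> (0 < a)%R ->
  \int[P0]_w (expN (a%:E * mu w [set: borel X]) * \prod_(i < n) mu w (A i)) =
  mass_laplace P0 mu a * \int[seating eta X_separable n]_x
    ((\1_(box A) x)%:E * pweight rho (fun=> a) x).
Variable h : R -> R.
Hypothesis hE : forall x : R, h x = (expR (- (gamma * x)) * x `^ (- q))%R.
Hypothesis h_fin : \int[P0]_w (h (total_mass (mu w)))%:E < +oo.
Context d (Omega : measurableType d) (P : probability Omega R).
Variable mut : {mfun Omega >-> bfmeasures X}.
Hypothesis mut_tilted : is_tilted P0 mu h P mut.

(** Up to a constant, the joint density at [(x, u)] of a sample [x] of size [m]
    and of the augmenting variable, with respect to the product of the seating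
    measure and the Lebesgue measure. *)
Definition joint_density (m : nat) (x : seq (borel X)) (u : R) : \bar R :=
  powp (m%:R + q) u * (mass_laplace P0 mu (gamma + u) * pweight rho (fun=> gamma + u)%R x).

Lemma mass_laplace_ge0 a : 0 <= mass_laplace P0 mu a.
Proof. by apply: integral_ge0 => w _; exact: expN_ge0. Qed.

Lemma joint_density_ge0 m x u : 0 <= joint_density m x u.
Proof.
apply: mule_ge0; first exact: powp_ge0.
by apply: mule_ge0; [exact: mass_laplace_ge0|exact: pweight_ge0].
Qed.

Lemma measurable_joint_density m d' (T : measurableType d') (I : Type)
    (F : I -> T -> borel X) (u : T -> R) (r : seq I) :
  (forall i, measurable_fun setT (F i)) -> measurable_fun setT u ->
  measurable_fun setT (fun w => joint_density m [seq F i w | i <- r] (u w)).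
Proof.
move=> mF mu'.
have mg : measurable_fun setT (fun w => gamma + u w)%R.
  by apply: measurable_funD; [exact: measurable_cst|exact: mu'].
apply: emeasurable_funM.
  exact: (measurableT_comp (measurable_powp (m%:R + q)) mu').
apply: emeasurable_funM.
  exact: (measurableT_comp (measurable_mass_laplace P0 mu) mg).
by apply: (@measurable_pweight _ _ rho X_separable _ _ _ F mF (fun w _ => gamma + u w)%R).
Qed.

Lemma measurable_joint_density_tuple m k d' (T : measurableType d')
    (t : T -> k.-tuple (borel X)) (u : T -> R) :
  measurable_fun setT t -> measurable_fun setT u ->
  measurable_fun setT (fun w => joint_density m (t w) (u w)).
Proof.
move=> mt mu'; rewrite (_ : (fun w => _) = fun w =>
    joint_density m [seq tnth (t w) i | i <- enum 'I_k] (u w)).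
  apply: (@measurable_joint_density _ _ _ _ (fun i w => tnth (t w) i)).
    by move=> i; exact: (measurableT_comp (measurable_tnth i) mt).
  exact: mu'.
by apply/funext => w; rewrite map_tnth_enum.
Qed.

Definition joint_const (m : nat) : R := ((tilt_norm P0 mu h * Gamma (m%:R + q))^-1)%R.

Let h_ge0 x : (0 <= h x)%R. Proof. by rewrite hE mulr_ge0 ?expR_ge0 ?powR_ge0. Qed.

Let mh : measurable_fun setT h.
Proof.
rewrite (_ : h = fun x => (expR (- (gamma * x)) * x `^ (- q))%R); last exact/funext.
apply: measurable_funM; last exact: measurable_powR.
apply: measurableT_comp; first exact: measurable_expR.
by apply: measurable_funN; exact: mulrl_measurable.
Qed.

Let shape_ge1 m : (1 <= m)%N -> (1 <= m%:R + q)%R.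
Proof. by move=> m1; rewrite -[leLHS]addr0 lerD// ler1n. Qed.

Let mmu : measurable_fun setT (mu : Omega0 -> bfmeasures X).
Proof. exact: measurable_funPT. Qed.

Let mut_total := tilted_total mu_total mh h_ge0 h_fin mut_tilted.

Section fixed_sets.
Variables (m : nat) (A : 'I_m -> set (borel X)) (B : set (measurableTypeR R)).
Hypotheses (m_ge1 : (1 <= m)%N) (mA : forall i, measurable (A i)) (mB : measurable B).
Local Notation a := (m%:R + q)%R.

Let W (M : bfmeasures X) (u : R) : \bar R :=
  expN ((gamma + u)%:E * M [set: borel X]) * \prod_(i < m) M (A i).

Let W0 M u : 0 <= W M u.
Proof.
apply: mule_ge0; first exact: expN_ge0.
by apply: prode_ge0 => i _; exact: measure_ge0.
Qed.

Let mW d' (T : measurableType d') (M : T -> bfmeasures X) (u : T -> R) :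
  measurable_fun setT M -> measurable_fun setT u ->
  measurable_fun setT (fun w => W (M w) (u w)).
Proof.
move=> mM mu'; apply: emeasurable_funM.
  apply: measurableT_comp; first exact: measurable_expN.
  apply: emeasurable_funM; last exact: (measurableT_comp (measurable_eval measurableT) mM).
  by apply/measurable_EFinP; apply: measurable_funD; [exact: measurable_cst|exact: mu'].
by apply: emeasurable_prod => i; exact: (measurableT_comp (measurable_eval (mA i)) mM).
Qed.

Let tilt_cancel (t u Q z : R) : (0 < t)%R ->
  ((expR (- (gamma * t)) * t `^ (- q)) * (Q * (t^-1) ^+ m) *
    (z * (expR (- (u * t)) * t `^ a / Gamma a)) =
   (Gamma a)^-1 * (z * (expR (- ((gamma + u) * t)) * Q)))%R.
Proof.
move=> t0; have -> : (expR (- ((gamma + u) * t)) = expR (- (gamma * t)) * expR (- (u * t)))%R.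
  by rewrite -expRD mulrDl opprD.
have e1 : (t `^ (- q) * ((t^-1) ^+ m * t `^ a) = 1)%R.
  have t0' := ltW t0; have tn : t != 0%R by rewrite gt_eqF.
  rewrite exprVn powRD; last by rewrite tn implybT.
  rewrite powR_mulrn// mulKf ?expf_neq0// powRN.
  by rewrite mulVf// gt_eqF// powR_gt0.
have -> : ((expR (- (gamma * t)) * t `^ (- q)) * (Q * (t^-1) ^+ m) *
    (z * (expR (- (u * t)) * t `^ a / Gamma a)) =
  (t `^ (- q) * ((t^-1) ^+ m * t `^ a)) * ((Gamma a)^-1 * (z * (expR (- (gamma * t)) * expR (- (u * t)) * Q))))%R.
  by ring.
by rewrite e1 mul1r.
Qed.

Let pointwise (M : bfmeasures X) : 0 < (M : bfmeasure X) setT < +oo ->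
  (h (total_mass M))%:E * (\prod_(i < m) normalized M (A i) * gamma_law a (total_mass M) B) =
  ((Gamma a)^-1)%:E * \int[leb]_u ((\1_B u)%:E * powp a u * W M u).
Proof.
move=> /andP[t0 toy]; have a1 := shape_ge1 m_ge1.
have tE : (M : bfmeasure X) setT = (total_mass M)%:E.
  by rewrite /total_mass fineK// ge0_fin_numE// ltW.
have tM0 : (0 < total_mass M)%R by rewrite -lte_fin -tE.
have finA i : (M : bfmeasure X) (A i) = (fine (M (A i)))%:E.
  rewrite fineK// ge0_fin_numE ?measure_ge0//.
  by apply: le_lt_trans toy; apply: le_measure; rewrite ?inE//.
pose Q : R := (\prod_(i < m) fine (M (A i)))%R.
have QE : \prod_(i < m) M (A i) = Q%:E.
  by rewrite /Q -prodEFin; apply: eq_bigr => i _.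
have nE : \prod_(i < m) normalized M (A i) = (Q * (total_mass M)^-1 ^+ m)%:E.
  rewrite /Q (_ : (_ ^-1 ^+ m)%R = (\prod_(i < m) (total_mass M)^-1)%R); last first.
    by rewrite prodr_const card_ord.
  rewrite -big_split/= -prodEFin; apply: eq_bigr => i _.
  by rewrite /normalized tE finA inver gt_eqF// -EFinM.
rewrite nE muleA -EFinM gamma_lawE.
rewrite -ge0_integralZl_EFin; first last.
- rewrite mulr_ge0// mulr_ge0 ?exprn_ge0 ?invr_ge0 ?(ltW tM0)//.
  by apply: prodr_ge0 => i _; exact: fine_ge0.
- apply: emeasurable_funM; first by apply/measurable_EFinP; exact: measurable_indic.
  have := @measurable_gamma_density R a _ _ (fun _ : measurableTypeR R => total_mass M)
    (@measurable_cst _ _ _ _ _ _).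
  move=> H; exact: (measurableT_comp H (pair1_measurable (point : measurableTypeR R))).
- by move=> u _; apply: mule_ge0; [rewrite lee_fin|exact: gamma_density_ge0].
- by [].
rewrite -ge0_integralZl_EFin; first last.
- by rewrite invr_ge0 ltW// Gamma_gt0.
- apply: emeasurable_funM.
    apply: emeasurable_funM; last exact: measurable_powp.
    by apply/measurable_EFinP; exact: measurable_indic.
  by apply: (@mW _ _ (fun=> M) id); [exact: measurable_cst|exact: measurable_id].
- move=> u _; apply: mule_ge0; last exact: W0.
  by apply: mule_ge0; [rewrite lee_fin|exact: powp_ge0].
- by [].
apply: eq_integral => u _.
have -> : W M u = (expR (- ((gamma + u) * total_mass M)) * Q)%:E by rewrite /W QE tE.
rewrite /gamma_density -(fineK (powp_fin a u)).
have e := @tilt_cancel (total_mass M) u Q (\1_B u * fine (powp a u)) tM0.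
rewrite -!EFinM; congr EFin; rewrite hE; move: e; rewrite !mulrA => ->.
by [].
Qed.

(** With [T] the total mass, the normalizations contribute [T ^ (- m)], the tilt
    [exp (- gamma T) T ^ (- q)] and the gamma density [T ^ (m + q)]: all powers of
    [T] cancel, which is what the augmenting variable is for, and
    [u ^ (m + q - 1) exp (- (gamma + u) T)] remains. Tonelli's theorem and the
    moments of the completely random measure conclude. *)
Lemma joint_moment :
  \int[P]_w (\prod_(i < m) normalized (mut w) (A i) * gamma_law a (total_mass (mut w)) B) =
  (joint_const m)%:E * \int[seating eta X_separable m]_x
    ((\1_(box A) x)%:E * \int[leb]_u ((\1_B u)%:E * joint_density m x u)).
Proof.
have a1 := shape_ge1 m_ge1; have G0 := Gamma_gt0 a1.
have c0 := tilt_norm_gt0 mh h_ge0 h_fin mut_tilted.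
have mt : measurable_fun [set: bfmeasures X] (fun M : bfmeasures X => total_mass M).
  exact: measurable_total_mass.
pose G (M : bfmeasures X) : \bar R :=
  \prod_(i < m) normalized M (A i) * gamma_law a (total_mass M) B.
have mG : measurable_fun setT G.
  apply: emeasurable_funM; last exact: measurable_gamma_law.
  apply: emeasurable_prod => i; apply: emeasurable_funM; first exact: measurable_eval.
  apply: measurable_inve_ge0; first exact: measurable_eval.
  by move=> M; exact: measure_ge0.
have G0' M : 0 <= G M.
  apply: mule_ge0; last exact: gamma_law_ge0.
  apply: prode_ge0 => i _; apply: mule_ge0; first exact: measure_ge0.
  by rewrite inve_ge0 measure_ge0.
rewrite (tilted_integral mh h_ge0 h_fin mut_tilted mG G0').
pose V (u : R) : \bar R := (\1_B u)%:E * powp a u.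
have V0 u : 0 <= V u by apply: mule_ge0; [rewrite lee_fin|exact: powp_ge0].
have mV : measurable_fun setT (V : measurableTypeR R -> \bar R).
  apply: emeasurable_funM; last exact: measurable_powp.
  by apply/measurable_EFinP; exact: measurable_indic.
have VW0 M u : 0 <= V u * W M u by apply: mule_ge0; [exact: V0|exact: W0].
have mVW : measurable_fun setT (fun p : Omega0 * measurableTypeR R => V p.2 * W (mu p.1) p.2).
  apply: emeasurable_funM; first exact: (measurableT_comp mV measurable_snd).
  by apply: mW; [exact: (measurableT_comp mmu measurable_fst)|exact: measurable_snd].
have mI : measurable_fun setT (fun w => \int[leb]_u (V u * W (mu w) u)).
  apply: (@measurable_fun_fubini_tonelli_F _ _ _ _ _ leb
    (fun p : Omega0 * measurableTypeR R => V p.2 * W (mu p.1) p.2) mVW).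
  by move=> p; exact: VW0.
have step1 : \int[P0]_w ((h (total_mass (mu w)))%:E * G (mu w)) =
    ((Gamma a)^-1)%:E * \int[P0]_w \int[leb]_u (V u * W (mu w) u).
  rewrite -ge0_integralZl_EFin; first last.
  - by rewrite invr_ge0 ltW.
  - exact: mI.
  - by move=> w _; apply: integral_ge0 => u _; exact: VW0.
  - by [].
  apply: ge0_ae_eq_integral.
  - by [].
  - apply: emeasurable_funM; last exact: (measurableT_comp mG mmu).
    apply/measurable_EFinP; apply: (measurableT_comp mh).
    exact: (measurableT_comp mt mmu).
  - by apply: measurable_funeM; exact: mI.
  - by move=> w _; apply: mule_ge0; [rewrite lee_fin; exact: h_ge0|exact: G0'].
  - move=> w _; apply: mule_ge0; first by rewrite lee_fin invr_ge0 ltW.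
    by apply: integral_ge0 => u _; exact: VW0.
  by apply: filterS mu_total => w H _; exact: pointwise.
rewrite step1 muleA -EFinM -invfM -/(joint_const m); congr (_ * _).
have fub := @fubini_tonelli _ _ _ _ R P0 leb (fun p : Omega0 * measurableTypeR R => V p.2 * W (mu p.1) p.2).
apply: (etrans (fub mVW (fun p => VW0 (mu p.1) p.2))).
have mD : measurable_fun setT (fun p : m.-tuple (borel X) * measurableTypeR R =>
    (\1_(box A) p.1)%:E * ((\1_B p.2)%:E * joint_density m p.1 p.2)).
  apply: emeasurable_funM.
    exact: (measurableT_comp (measurable_indic_box mA) measurable_fst).
  apply: emeasurable_funM.
    apply/measurable_EFinP; exact: (measurableT_comp (measurable_indic mB) measurable_snd).
  by apply: (@measurable_joint_density_tuple m m); [exact: measurable_fst|exact: measurable_snd].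
have D0 (x : m.-tuple (borel X)) u : 0 <= (\1_(box A) x : R)%:E * ((\1_B u)%:E * joint_density m x u).
  apply: mule_ge0; first by rewrite lee_fin.
  by apply: mule_ge0; [rewrite lee_fin|exact: joint_density_ge0].
have fub2 := @fubini_tonelli _ _ _ _ R (seating eta X_separable m) leb
  (fun p : m.-tuple (borel X) * measurableTypeR R =>
    (\1_(box A) p.1)%:E * ((\1_B p.2)%:E * joint_density m p.1 p.2)) mD (fun p => D0 p.1 p.2).
transitivity (\int[leb]_u \int[seating eta X_separable m]_x
    ((\1_(box A) x)%:E * ((\1_B u)%:E * joint_density m x u))); last first.
  apply: (etrans (esym fub2)); apply: eq_integral => x _.
  rewrite -ge0_integralZl_EFin; first last.
  - by [].
  - apply: emeasurable_funM; first by apply/measurable_EFinP; exact: measurable_indic.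
    apply: (@measurable_joint_density_tuple m m); last exact: measurable_id.
    exact: measurable_cst.
  - by move=> u _; apply: mule_ge0; [rewrite lee_fin|exact: joint_density_ge0].
  - by [].
  by [].
apply: eq_integral => u _.
have [u0|u0] := boolP (0 < u)%R; last first.
  rewrite (eq_integral (fun=> 0)); last first.
    by move=> w _; rewrite /V /powp (negbTE u0) mule0 mul0e.
  rewrite integral0; apply/esym/integral0_eq => x _.
  by rewrite /joint_density /powp (negbTE u0) mul0e !mule0.
rewrite (eq_integral (fun w => V u * W (mu w) u)); last by move=> w _.
rewrite ge0_integralZl; first last.
- exact: V0.
- by move=> w _; exact: W0.
- by apply: mW; [exact: mmu|exact: measurable_cst].
- by [].
rewrite (mu_moment mA); last by rewrite ltr_wpDl.
have bp0 (x : m.-tuple (borel X)) : 0 <= (\1_(box A) x : R)%:E * pweight rho (fun=> gamma + u)%R x.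
  by apply: mule_ge0; [rewrite lee_fin|exact: pweight_ge0].
rewrite muleA -ge0_integralZl; first last.
- by apply: mule_ge0; [exact: V0|exact: mass_laplace_ge0].
- by move=> x _; exact: bp0.
- apply: emeasurable_funM; first exact: measurable_indic_box.
  by apply: measurable_pweight_tuple => //; exact: measurable_cst.
- by [].
apply: eq_integral => x _; rewrite /joint_density /V.
have perm (b p L y w : \bar R) : (b * p) * L * (y * w) = y * (b * (p * (L * w))).
  by rewrite (muleCA y b) (muleCA y p) (muleCA y L) !muleA.
exact: perm.
Qed.

End fixed_sets.

End joint_moment.

(** * Laws of samples *)

Section reversed_tuple.
Context d (Omega : Type) (T : measurableType d).

(** The seating measures put the newest point first. *)
Definition revtuple m (S : 'I_m -> Omega -> T) (w : Omega) : m.-tuple T :=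
  [tuple S (rev_ord i) w | i < m].

Lemma box_revtuple m (S : 'I_m -> Omega -> T) (A : 'I_m -> set T) w :
  box A (revtuple S w) <-> forall i, A (rev_ord i) (S i w).
Proof.
split => H i; last by rewrite tnth_mktuple -[A i]/(A i) -{1}(rev_ordK i); exact: H.
by have := H (rev_ord i); rewrite tnth_mktuple rev_ordK.
Qed.

End reversed_tuple.

Section sample_laws.
Context (R : realType) (X : completeMetricType R) (X_separable : separable X).
Local Notation leb := (@lebesgue_measure R).
Variables (eta : probability (borel X) R) (rho : R.-sigmafker (borel X) ~> measurableTypeR R).
Context d0 (Omega0 : measurableType d0) (P0 : probability Omega0 R).
Variables (mu : {mfun Omega0 >-> bfmeasures X}) (gamma q : R) (h : R -> R).
Context d (Omega : measurableType d) (P : probability Omega R).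
Variable mut : {mfun Omega >-> bfmeasures X}.
Variables (m : nat) (S : 'I_m -> {mfun Omega >-> borel X}).
Local Notation kappa := (joint_const P0 mu q h m).
Local Notation dens := (joint_density rho P0 mu gamma q m).
Local Notation seat := (seating eta X_separable m).
Local Notation Tm := (revtuple (fun i => S i : Omega -> borel X)).
Hypothesis kappa_ge0 : (0 <= kappa)%R.
Hypothesis mut_total : {ae P, forall w, 0 < (mut w : bfmeasure X) setT < +oo}.
Hypothesis shape_ge1 : (1 <= m%:R + q)%R.
Hypothesis moment : forall (A : 'I_m -> set (borel X)) (B : set (measurableTypeR R)),
  (forall i, measurable (A i)) -> measurable B ->
  \int[P]_w (\prod_(i < m) normalized (mut w) (A i) * gamma_law (m%:R + q) (total_mass (mut w)) B) =
  kappa%:E * \int[seat]_x ((\1_(box A) x)%:E * \int[leb]_u ((\1_B u)%:E * dens x u)).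

Lemma measurable_revtuple : measurable_fun setT Tm.
Proof.
apply/measurable_fun_tnthP => i; rewrite (_ : _ \o _ = S (rev_ord i)).
  exact: measurable_funPT.
by apply/funext => w /=; rewrite tnth_mktuple.
Qed.

Let dens_pair : measurable_fun setT
  (fun p : m.-tuple (borel X) * measurableTypeR R => dens p.1 p.2).
Proof.
by apply: (@measurable_joint_density_tuple _ _ _ _ _ _ _ _ _ _ m m);
  [exact: X_separable|exact: measurable_fst|exact: measurable_snd].
Qed.

Let mdens_int : measurable_fun [set: m.-tuple (borel X)] (fun x => \int[leb]_u dens x u).
Proof.
apply: (@measurable_fun_fubini_tonelli_F _ _ _ _ _ leb _ dens_pair).
by move=> p; exact: joint_density_ge0.
Qed.

Let moment_rev (A : 'I_m -> set (borel X)) (B : set (measurableTypeR R)) :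
  (forall i, measurable (A i)) -> measurable B ->
  \int[P]_w (\prod_(i < m) normalized (mut w) (A (rev_ord i)) *
    gamma_law (m%:R + q) (total_mass (mut w)) B) =
  kappa%:E * \int[seat]_x ((\1_(box A) x)%:E * \int[leb]_u ((\1_B u)%:E * dens x u)).
Proof.
move=> mA mB; rewrite -(moment mA mB); apply: eq_integral => w _; congr (_ * _).
by rewrite [RHS](reindex_inj rev_ord_inj).
Qed.

Lemma augmented_law (U : {mfun Omega >-> measurableTypeR R})
    (F : m.-tuple (borel X) * measurableTypeR R -> \bar R) :
  is_augmenting P mut q (fun i => S i : Omega -> borel X) U ->
  measurable_fun setT F -> (forall p, 0 <= F p) ->
  \int[P]_w F (Tm w, U w) = kappa%:E * \int[seat]_x \int[leb]_u (F (x, u) * dens x u).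
Proof.
move=> [U0 aug] mF F0.
have mU : measurable_fun setT (U : Omega -> measurableTypeR R) by exact: measurable_funPT.
have mTU : measurable_fun setT (fun w => (Tm w, U w)).
  by apply: measurable_fun_pair; [exact: measurable_revtuple|exact: mU].
have m1 : measurable_fun [set: Omega] (fun _ : Omega => 1 : \bar R) by exact: measurable_cst.
have p1 (w : Omega) : 0 <= (1 : \bar R) by exact: lee01.
pose V (p : m.-tuple (borel X) * measurableTypeR R) : \bar R := kappa%:E * dens p.1 p.2.
have mV : measurable_fun setT V by apply: measurable_funeM; exact: dens_pair.
have V0 p : 0 <= V p by apply: mule_ge0; [rewrite lee_fin|exact: joint_density_ge0].
have VF (G : m.-tuple (borel X) * measurableTypeR R -> \bar R) :
    measurable_fun setT G -> (forall p, 0 <= G p) ->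
    \int[seat \x leb]_p (V p * G p) = kappa%:E * \int[seat]_x \int[leb]_u (G (x, u) * dens x u).
  move=> mG G0; have GD0 p : 0 <= G p * dens p.1 p.2.
    by apply: mule_ge0; [exact: G0|exact: joint_density_ge0].
  have mGD : measurable_fun setT (fun p : m.-tuple (borel X) * measurableTypeR R =>
      G p * dens p.1 p.2) by apply: emeasurable_funM; [exact: mG|exact: dens_pair].
  rewrite (eq_integral (fun p => kappa%:E * (G p * dens p.1 p.2))); last first.
    by move=> p _; rewrite /V -muleA (muleC (dens _ _)).
  rewrite ge0_integralZl_EFin; first last.
  - exact: kappa_ge0.
  - exact: mGD.
  - by move=> p _; exact: GD0.
  - by [].
  by rewrite (@fubini_tonelli1 _ _ _ _ R seat leb _ mGD GD0).
have mid := @measurable_id _ (m.-tuple (borel X) * measurableTypeR R)%type setT.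
have key D : measurable D -> wmeasure P m1 p1 mTU D = wmeasure (seat \x leb) mV V0 mid D.
  apply: eq_finite_measure_tuple_prod.
    apply: (@le_lt_trans _ _ (\int[P]_w 1)); last first.
      by rewrite integral_cst//= mul1e (le_lt_trans (probability_le1 _ _))// ltry.
    by rewrite le_eqVlt; apply/orP; left; apply/eqP; apply: eq_integral => w _; rewrite indicT mule1.
  move=> A B mA mB; rewrite /wmeasure.
  transitivity (\int[P]_w (\prod_(i < m) normalized (mut w) (A (rev_ord i)) *
      gamma_law (m%:R + q) (total_mass (mut w)) B)).
    have mA' i : measurable (A (rev_ord i)) by exact: mA.
    have [_ _ cond] := aug (fun i => A (rev_ord i)) B mA' mB.
    rewrite (cond setT); last by exists setT => //; rewrite preimage_setT setTI.
    apply: eq_integral => w _; rewrite mul1e !indicE in_setX; congr (nat_of_bool _)%:R%:E.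
    apply/idP/idP; first by move=> /andP[/set_mem/box_revtuple wA /set_mem wB]; exact: mem_set.
    move=> /set_mem[wA wB]; apply/andP; split; last exact: mem_set.
    by apply: mem_set; exact/box_revtuple.
  rewrite (moment_rev mA mB).
  have mAB : measurable (box A `*` B) by apply: measurableX => //; exact: measurable_box.
  have mI : measurable_fun setT (fun p => (\1_(box A `*` B) p : R)%:E).
    by apply/measurable_EFinP; exact: measurable_indic.
  have I0 p : 0 <= (\1_(box A `*` B) p : R)%:E by rewrite lee_fin.
  apply/esym/(etrans (VF _ mI I0)); congr (_ * _); apply: eq_integral => x _; apply/esym.
  rewrite -ge0_integralZl_EFin; first last.
  - by [].
  - apply: emeasurable_funM; first by apply/measurable_EFinP; exact: measurable_indic.
    exact: (measurableT_comp dens_pair (pair1_measurable x)).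
  - by move=> u _; apply: mule_ge0; [rewrite lee_fin|exact: joint_density_ge0].
  - by [].
  apply: eq_integral => u _; rewrite muleA -EFinM; congr (_%:E * _).
  by rewrite !indicE in_setX -natrM mulnb.
transitivity (\int[wmeasure P m1 p1 mTU]_p F p).
  by rewrite ge0_integral_wmeasure//; apply: eq_integral => w _; rewrite mul1e.
rewrite (@eq_measure_integral _ _ _ setT (wmeasure (seat \x leb) mV V0 mid)); last first.
  by move=> D mD _; exact: key.
rewrite ge0_integral_wmeasure; [exact: (VF F mF F0)|exact: mF|exact: F0].
Qed.

(** The augmenting variable is reintroduced by inserting the total mass 1 of its gamma
    law, and then integrated out. *)
Lemma sample_law (F : m.-tuple (borel X) -> \bar R) :
  is_iid_normalized P mut (fun i => S i : Omega -> borel X) ->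
  measurable_fun setT F -> (forall p, 0 <= F p) ->
  \int[P]_w F (Tm w) = kappa%:E * \int[seat]_x (F x * \int[leb]_u dens x u).
Proof.
move=> iid mF F0.
have m1 : measurable_fun [set: Omega] (fun _ : Omega => 1 : \bar R) by exact: measurable_cst.
have p1 (w : Omega) : 0 <= (1 : \bar R) by exact: lee01.
have I0 (x : m.-tuple (borel X)) : 0 <= \int[leb]_u dens x u.
  by apply: integral_ge0 => u _; exact: joint_density_ge0.
pose V (x : m.-tuple (borel X)) : \bar R := kappa%:E * \int[leb]_u dens x u.
have mV : measurable_fun setT V by apply: measurable_funeM; exact: mdens_int.
have V0 x : 0 <= V x by apply: mule_ge0; [rewrite lee_fin|exact: I0].
have VF (G : m.-tuple (borel X) -> \bar R) :
    measurable_fun setT G -> (forall p, 0 <= G p) ->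
    \int[seat]_x (V x * G x) = kappa%:E * \int[seat]_x (G x * \int[leb]_u dens x u).
  move=> mG G0; rewrite -ge0_integralZl_EFin; first last.
  - exact: kappa_ge0.
  - by apply: emeasurable_funM; [exact: mG|exact: mdens_int].
  - by move=> x _; apply: mule_ge0; [exact: G0|exact: I0].
  - by [].
  by apply: eq_integral => x _; rewrite /V -muleA (muleC (\int[leb]_u _)).
have mid := @measurable_id _ (m.-tuple (borel X)) setT.
have key D : measurable D -> wmeasure P m1 p1 measurable_revtuple D = wmeasure seat mV V0 mid D.
  apply: eq_finite_measure_tuple.
    apply: (@le_lt_trans _ _ (\int[P]_w 1)); last first.
      by rewrite integral_cst//= mul1e (le_lt_trans (probability_le1 _ _))// ltry.
    by rewrite le_eqVlt; apply/orP; left; apply/eqP; apply: eq_integral => w _; rewrite indicT mule1.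
  move=> A mA; rewrite /wmeasure.
  transitivity (\int[P]_w (\prod_(i < m) normalized (mut w) (A (rev_ord i)) *
      gamma_law (m%:R + q) (total_mass (mut w)) setT)).
    have mA' i : measurable (A (rev_ord i)) by exact: mA.
    have [_ _ cond] := iid (fun i => A (rev_ord i)) mA'.
    transitivity (\int[P]_w \prod_(i < m) normalized (mut w) (A (rev_ord i))).
      rewrite (cond setT); last by rewrite -setC0; apply: sigma_algebraC; exact: sigma_algebra0.
      apply: eq_integral => w _; rewrite mul1e !indicE; congr (nat_of_bool _)%:R%:E.
      apply/idP/idP; first by move=> /set_mem/box_revtuple wA; exact: mem_set.
      by move=> /set_mem wA; apply: mem_set; exact/box_revtuple.
    have mmut : measurable_fun setT (mut : Omega -> bfmeasures X) by exact: measurable_funPT.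
    have mprod : measurable_fun setT (fun w => \prod_(i < m) normalized (mut w) (A (rev_ord i))).
      apply: emeasurable_prod => i; apply: emeasurable_funM.
        exact: (measurableT_comp (measurable_eval (mA' i)) mmut).
      apply: measurable_inve_ge0; last by move=> w; exact: measure_ge0.
      exact: (measurableT_comp (measurable_eval measurableT) mmut).
    have prod0 w : 0 <= \prod_(i < m) normalized (mut w) (A (rev_ord i)).
      apply: prode_ge0 => i _; apply: mule_ge0; first exact: measure_ge0.
      by rewrite inve_ge0 measure_ge0.
    apply: ge0_ae_eq_integral.
    - by [].
    - exact: mprod.
    - apply: emeasurable_funM; first exact: mprod.
      apply: measurable_gamma_law; [exact: shape_ge1| |exact: measurableT].
      exact: (measurableT_comp (@measurable_total_mass R X) mmut).
    - by move=> w _; exact: prod0.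
    - by move=> w _; apply: mule_ge0; [exact: prod0|exact: gamma_law_ge0].
    apply: filterS mut_total => w /andP[t0 ty] _; rewrite gamma_law_setT ?mule1//.
    by rewrite -lte_fin /total_mass fineK// ge0_fin_numE// ltW.
  rewrite (moment_rev mA measurableT).
  have bI0 x : 0 <= (\1_(box A) x : R)%:E by rewrite lee_fin.
  apply/esym/(etrans (VF _ (measurable_indic_box mA) bI0)).
  congr (_ * _); apply: eq_integral => x _; congr (_ * _); apply/esym.
  by apply: eq_integral => u _; rewrite indicT mul1e.
transitivity (\int[wmeasure P m1 p1 measurable_revtuple]_p F p).
  by rewrite ge0_integral_wmeasure//; apply: eq_integral => w _; rewrite mul1e.
rewrite (@eq_measure_integral _ _ _ setT (wmeasure seat mV V0 mid)); last first.
  by move=> D mD _; exact: key.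
rewrite ge0_integral_wmeasure; [exact: (VF F mF F0)|exact: mF|exact: F0].
Qed.

End sample_laws.

(** * Clusters *)

Section cells.
Context (X : pointedType) (n : nat) (x : 'I_n -> X).
Local Notation t := [tuple x (rev_ord i) | i < n].

Let perm_values : perm_eq [seq x i | i : 'I_n] t.
Proof.
rewrite /= [X in perm_eq _ X](_ : _ = [seq x i | i <- [seq rev_ord i | i <- enum 'I_n]]).
  apply: perm_map; apply: uniq_perm; first exact: enum_uniq.
    by rewrite (map_inj_uniq rev_ord_inj) enum_uniq.
  move=> i; rewrite mem_enum; apply/esym/mapP.
  by exists (rev_ord i); rewrite ?mem_enum// rev_ordK.
by rewrite -map_comp.
Qed.

Lemma ncellE k : ncell x k = count_mem (Yval x k) t.
Proof.
rewrite -(permP perm_values) /image_mem count_map /ncell /cell cardsE cardE size_filter.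
by rewrite enumT; apply: eq_count.
Qed.

(** Sums and products over the cells of the partition, indexed by distinct values; the
    order of the sample is irrelevant. *)
Lemma big_cells (R : Type) (idx : R) (op : Monoid.com_law idx) (F : nat -> X -> R) :
  \big[op/idx]_(k < ncells x) F (ncell x k) (Yval x k) =
  \big[op/idx]_(y <- undup t) F (count_mem y t) y.
Proof.
rewrite -(perm_big _ (perm_undup (perm_mem perm_values))) /= (big_nth point) big_mkord.
by apply: eq_bigr => k _; rewrite ncellE.
Qed.

End cells.

(** The multiplicative update of a product of weights when one factor [a] becomes
    [b]; the ratio [b / a] recovers it also in the degenerate cases [a = 0] and
    [a = +oo], as long as the product is finite. *)
Lemma weight_update (R : realType) (p L a b r v : \bar R) :
  0 <= p -> 0 <= L -> 0 <= a -> 0 <= b -> 0 <= r -> 0 <= v ->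
  (a = 0 -> b = 0) -> p * (L * (a * r)) < +oo ->
  (v * p) * (L * (b * r)) = (p * (L * (a * r))) * (v * (b / a)).
Proof.
move=> p0 L0 a0 b0 r0 v0 ab fin.
have [az|an0] := eqVneq a 0; first by rewrite (ab az) az !(mul0e, mule0).
have [ay|any] := eqVneq a +oo; last first.
  have af : a \is a fin_num by rewrite ge0_fin_numE// ltey.
  set c := b / a; have -> : b = a * c by rewrite /c muleCA (muleC a) mulVe// mule1.
  have perm (c' : \bar R) : v * p * (L * (a * c' * r)) = p * (L * (a * r)) * (v * c').
    rewrite -(muleA a c' r) (muleC c' r) !muleA; congr (_ * c').
    by rewrite [RHS]muleC !muleA.
  exact: perm.
rewrite ay invey mule0 mule0 mule0.
have [->|rn0] := eqVneq r 0; first by rewrite !mule0.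
have [->|Ln0] := eqVneq L 0; first by rewrite mul0e !mule0.
have [->|pn0] := eqVneq p 0; first by rewrite mule0 mul0e.
by move: fin; rewrite ay !gt0_mulye ?gt0_muley ?lt0e ?rn0 ?Ln0 ?pn0.
Qed.

(** * Predictive weights *)

Section predictive_weights.
Context (R : realType) (X : completeMetricType R) (X_separable : separable X).
Local Notation leb := (@lebesgue_measure R).
Variables (eta : probability (borel X) R) (rho : R.-sigmafker (borel X) ~> measurableTypeR R).
Hypothesis eta_diffuse : forall z, eta [set z] = 0.
Context d0 (Omega0 : measurableType d0) (P0 : probability Omega0 R).
Variables (mu : {mfun Omega0 >-> bfmeasures X}) (gamma q : R).
Local Notation dens := (joint_density rho P0 mu gamma q).

(** When [tau_c] vanishes, so does [tau_(c+1)]: then [tau_(c+1) / tau_c] is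
    [0 * +oo = 0] and the weight of the cell is right. *)
Lemma lap_powerw_eq0 c z a : lap rho (powerw c) z a = 0 -> lap rho (powerw c.+1) z a = 0.
Proof.
move=> l0; rewrite -powerwS; have wc := @weight_powerw R c.
have cvgq := @cvg_lap_quot _ _ R rho _ z a wc.
rewrite -(cvg_lim _ cvgq)//; apply/cvg_lim => //.
have q0 k : lap rho (fun s => powerw c s * quot k s%:E) z a = 0.
  have := lap_increment rho k z a wc; rewrite l0 => /esym/eqP.
  have lq0 := lap_ge0 rho z a (weight_quot k wc).
  have sp : 0 < (step k : R)%:E by rewrite lte_fin step_gt0.
  rewrite padde_eq0; first last.
  - by apply: mule_ge0; [exact: ltW|exact: lq0].
  - by apply: lap_ge0.
  by rewrite mule_eq0 (gt_eqF sp) => /andP[_ /eqP].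
rewrite (_ : (fun k => _) = fun=> 0); first exact: cvg_cst.
exact/funext.
Qed.

(** The positive part keeps the weights nonnegative on the whole line. *)
Definition upos (u : R) : \bar R := (Num.max u 0)%:E.

Lemma upos_ge0 u : 0 <= upos u. Proof. by rewrite lee_fin le_max lexx orbT. Qed.

Lemma upos_gt0E u : (0 < u)%R -> upos u = u%:E.
Proof. by move=> u0; rewrite /upos max_l// ltW. Qed.

Lemma measurable_upos : measurable_fun setT (upos : measurableTypeR R -> \bar R).
Proof. by apply/measurable_EFinP; apply: measurable_maxr. Qed.

Lemma powpS a u : (0 < a)%R -> powp (a + 1) u = upos u * powp a u.
Proof.
move=> a0; rewrite /powp; case: ifPn => u0; last by rewrite mule0.
by rewrite upos_gt0E// /poww -EFinM addrK mulr_powRB1// ltW.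
Qed.

Definition new_weight (u : R) z : \bar R := upos u * lap rho (powerw 1) z (gamma + u).

Definition old_weight (u : R) (t : seq (borel X)) y : \bar R :=
  upos u * (lap rho (powerw (count_mem y t).+1) y (gamma + u) /
            lap rho (powerw (count_mem y t)) y (gamma + u)).

Lemma new_weight_ge0 u z : 0 <= new_weight u z.
Proof. by apply: mule_ge0; [exact: upos_ge0|apply: lap_ge0; exact: weight_powerw]. Qed.

Lemma old_weight_ge0 u t y : 0 <= old_weight u t y.
Proof.
apply: mule_ge0; first exact: upos_ge0.
by apply: mule_ge0; rewrite ?inve_ge0; apply: lap_ge0; exact: weight_powerw.
Qed.

Let shapeS m : (m.+1%:R + q = m%:R + q + 1 :> R)%R. Proof. by rewrite -natr1; ring. Qed.

Lemma joint_density_new m (t : seq (borel X)) z u : (0 < m%:R + q)%R -> z \notin t ->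
  dens m.+1 (z :: t) u = dens m t u * new_weight u z.
Proof.
move=> a0 zt; rewrite /joint_density shapeS powpS// pweight_new// /new_weight.
move: (powp _ _) (mass_laplace _ _ _) (pweight _ _ _) (upos u) (lap _ _ _ _).
by move=> p L r v l; rewrite [RHS]muleC -!muleA; congr (_ * _);
  rewrite [RHS]muleCA; congr (_ * _); rewrite [RHS]muleCA.
Qed.

(** Where the density is infinite the ratio of the [tau] need not account for the
    change of the factor of the cell. *)
Lemma joint_density_old m (t : seq (borel X)) y u : (0 < m%:R + q)%R -> y \in t ->
  dens m t u < +oo -> dens m.+1 (y :: t) u = dens m t u * old_weight u t y.
Proof.
move=> a0 yt; have yu : y \in undup t by rewrite mem_undup.
have pE : pweight rho (fun=> gamma + u)%R t = lap rho (powerw (count_mem y t)) y (gamma + u) *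
    \prod_(z <- undup t | z != y) lap rho (powerw (count_mem z t)) z (gamma + u).
  by rewrite /pweight (bigD1_seq y)//= undup_uniq.
have pSE : pweight rho (fun=> gamma + u)%R (y :: t) =
    lap rho (powerw (count_mem y t).+1) y (gamma + u) *
    \prod_(z <- undup t | z != y) lap rho (powerw (count_mem z t)) z (gamma + u).
  rewrite pweight_old// (bigD1_seq y)//= ?undup_uniq// eqxx; congr (_ * _).
  by apply: eq_bigr => z /negbTE ->.
rewrite /joint_density shapeS powpS// pSE pE => fin; apply: weight_update.
- exact: powp_ge0.
- exact: mass_laplace_ge0.
- by apply: lap_ge0; exact: weight_powerw.
- by apply: lap_ge0; exact: weight_powerw.
- by apply: prode_ge0 => z _; apply: lap_ge0; exact: weight_powerw.
- exact: upos_ge0.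
- exact: lap_powerw_eq0.
- exact: fin.
Qed.

Lemma measurable_new_weight d (T : measurableType d) (u : T -> R) (z : T -> borel X) :
  measurable_fun setT u -> measurable_fun setT z ->
  measurable_fun setT (fun w => new_weight (u w) (z w)).
Proof.
move=> mu' mz; apply: emeasurable_funM; first exact: (measurableT_comp measurable_upos mu').
have mp : measurable_fun setT (fun w => (z w, (gamma + u w)%R)).
  apply: measurable_fun_pair; first exact: mz.
  by apply: measurable_funD; [exact: measurable_cst|exact: mu'].
exact: (measurableT_comp (measurable_lap rho (@weight_powerw R 1)) mp).
Qed.

Lemma measurable_old_weight d (T : measurableType d) (I : Type) (F : I -> T -> borel X)
    (u : T -> R) i (r : seq I) :
  (forall j, measurable_fun setT (F j)) -> measurable_fun setT u ->
  measurable_fun setT (fun w => old_weight (u w) [seq F j w | j <- r] (F i w)).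
Proof.
move=> mF mu'; apply: emeasurable_funM; first exact: (measurableT_comp measurable_upos mu').
have mp : measurable_fun setT (fun w => (F i w, (gamma + u w)%R)).
  apply: measurable_fun_pair; first exact: mF.
  by apply: measurable_funD; [exact: measurable_cst|exact: mu'].
apply: (@measurable_count_comp _ _ X_separable _ _ _ F mF (fun c w =>
  lap rho (powerw c.+1) (F i w) (gamma + u w) / lap rho (powerw c) (F i w) (gamma + u w))).
move=> c; apply: emeasurable_funM.
  exact: (measurableT_comp (measurable_lap rho (@weight_powerw R c.+1)) mp).
apply: measurable_inve_ge0; last by move=> w; apply: lap_ge0; exact: weight_powerw.
exact: (measurableT_comp (measurable_lap rho (@weight_powerw R c)) mp).
Qed.

(** Integral of [G] over the next observation against the unnormalized predictive
    rule at the value [p.2] of the augmenting variable. *)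
Definition continuation m (G : m.+1.-tuple (borel X) * measurableTypeR R -> \bar R)
    (p : m.-tuple (borel X) * measurableTypeR R) : \bar R :=
  \int[eta]_z (new_weight p.2 z * G ([tuple of z :: p.1], p.2)) +
  \sum_(y <- undup p.1) (old_weight p.2 p.1 y * G ([tuple of y :: p.1], p.2)).

Section continuation_identity.
Variables (m : nat) (G : m.+1.-tuple (borel X) * measurableTypeR R -> \bar R).
Hypotheses (mG : measurable_fun setT G) (G0 : forall p, 0 <= G p).

Lemma continuation_ge0 p : 0 <= continuation G p.
Proof.
apply: adde_ge0.
  by apply: integral_ge0 => z _; apply: mule_ge0; [exact: new_weight_ge0|exact: G0].
by apply: sume_ge0 => y _; apply: mule_ge0; [exact: old_weight_ge0|exact: G0].
Qed.

Let mGnew : measurable_fun setT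
  (fun p : (m.-tuple (borel X) * measurableTypeR R) * borel X =>
    new_weight p.1.2 p.2 * G ([tuple of p.2 :: p.1.1], p.1.2)).
Proof.
have m12 : measurable_fun setT
    (fun p : (m.-tuple (borel X) * measurableTypeR R) * borel X => p.1.2).
  exact: (measurableT_comp measurable_snd measurable_fst).
apply: emeasurable_funM.
  by apply: measurable_new_weight; [exact: m12|exact: measurable_snd].
apply: (measurableT_comp mG); apply: measurable_fun_pair; last exact: m12.
apply: measurable_cons; first exact: measurable_snd.
exact: (measurableT_comp measurable_fst measurable_fst).
Qed.

Lemma measurable_continuation : measurable_fun setT (continuation G).
Proof.
apply: emeasurable_funD.
  apply: (@measurable_fun_fubini_tonelli_F _ _ _ _ _ eta _ mGnew).
  by move=> p; apply: mule_ge0; [exact: new_weight_ge0|exact: G0].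
rewrite (_ : (fun x => _) = fun p : m.-tuple (borel X) * measurableTypeR R =>
    \sum_(y <- undup [seq tnth p.1 i | i <- enum 'I_m])
      (old_weight p.2 [seq tnth p.1 i | i <- enum 'I_m] y * G ([tuple of y :: p.1], p.2))).
  have mt i : measurable_fun setT
      (fun p : m.-tuple (borel X) * measurableTypeR R => tnth p.1 i).
    exact: (measurableT_comp (measurable_tnth i) measurable_fst).
  apply: (@measurable_big_undup _ _ X_separable _ _ _
    (fun i (p : m.-tuple (borel X) * measurableTypeR R) => tnth p.1 i) mt _ _
    (fun p y => old_weight p.2 [seq tnth p.1 i | i <- enum 'I_m] y * G ([tuple of y :: p.1], p.2))).
    by move=> u v; exact: emeasurable_funD.
  move=> i; apply: emeasurable_funM.
    apply: (@measurable_old_weight _ _ _ (fun i (p : m.-tuple (borel X) * measurableTypeR R) => tnth p.1 i)).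
      exact: mt.
    exact: measurable_snd.
  apply: (measurableT_comp mG); apply: measurable_fun_pair; last exact: measurable_snd.
  by apply: measurable_cons; [exact: mt|exact: measurable_fst].
by apply/funext => p; rewrite map_tnth_enum.
Qed.

End continuation_identity.

End predictive_weights.

(** * Adding an observation *)

Lemma ge0_finite_integral_ae (R : realType) d (T : measurableType d)
    (m : {measure set T -> \bar R}) (f : T -> \bar R) :
  measurable_fun setT f -> (forall x, 0 <= f x) -> \int[m]_x f x < +oo ->
  {ae m, forall x, f x < +oo}.
Proof.
move=> mf f0 fin.
have intf : m.-integrable setT f.
  apply/integrableP; split => //.
  rewrite (eq_integral f)// => x _; exact: gee0_abs.
have := integrable_ae measurableT intf; apply: filterS => x /(_ I).
by rewrite ge0_fin_numE.
Qed.

Section continuation_identity.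
Context (R : realType) (X : completeMetricType R) (X_separable : separable X).
Local Notation leb := (@lebesgue_measure R).
Variables (eta : probability (borel X) R) (rho : R.-sigmafker (borel X) ~> measurableTypeR R).
Hypothesis eta_diffuse : forall z, eta [set z] = 0.
Context d0 (Omega0 : measurableType d0) (P0 : probability Omega0 R).
Variables (mu : {mfun Omega0 >-> bfmeasures X}) (gamma q : R) (m : nat).
Hypothesis shape_gt0 : (0 < m%:R + q)%R.
Local Notation dens := (joint_density rho P0 mu gamma q).
Local Notation seat := (seating eta X_separable).
Hypothesis dens_fin : {ae seat m, forall t : m.-tuple (borel X), \int[leb]_u dens m t u < +oo}.

Let mdens k d (T : measurableType d) (t : T -> k.-tuple (borel X)) (u : T -> R) :
  measurable_fun setT t -> measurable_fun setT u ->
  measurable_fun setT (fun w => dens k (t w) (u w)).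
Proof. exact: measurable_joint_density_tuple. Qed.

Variable G : m.+1.-tuple (borel X) * measurableTypeR R -> \bar R.
Hypotheses (mG : measurable_fun setT G) (G0 : forall p, 0 <= G p).
Local Notation cont := (continuation eta rho gamma G).

Let mH : measurable_fun setT
  (fun p : m.+1.-tuple (borel X) * measurableTypeR R => G p * dens m.+1 p.1 p.2).
Proof.
apply: emeasurable_funM; first exact: mG.
by apply: mdens; [exact: measurable_fst|exact: measurable_snd].
Qed.

Let H0 (s : m.+1.-tuple (borel X)) u : 0 <= G (s, u) * dens m.+1 s u.
Proof. by apply: mule_ge0; [exact: G0|exact: joint_density_ge0]. Qed.

Let newG_ge0 (t : m.-tuple (borel X)) u z :
  0 <= new_weight rho gamma u z * G ([tuple of z :: t], u) * dens m t u.
Proof.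
apply: mule_ge0; last exact: joint_density_ge0.
by apply: mule_ge0; [exact: new_weight_ge0|exact: G0].
Qed.

Let mGt (t : m.-tuple (borel X)) (z : borel X) :
  measurable_fun setT (fun u : measurableTypeR R => G ([tuple of z :: t], u)).
Proof. exact: (measurableT_comp mG (pair1_measurable _)). Qed.

Let mdt (t : m.-tuple (borel X)) :
  measurable_fun setT (fun u : measurableTypeR R => dens m t u).
Proof. by apply: (@mdens m); [exact: measurable_cst|exact: measurable_id]. Qed.

Let mnew (t : m.-tuple (borel X)) : measurable_fun setT
  (fun p : borel X * measurableTypeR R =>
    new_weight rho gamma p.2 p.1 * G ([tuple of p.1 :: t], p.2) * dens m t p.2).
Proof.
apply: emeasurable_funM; last exact: (measurableT_comp (mdt t) measurable_snd).
apply: emeasurable_funM.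
  by apply: measurable_new_weight; [exact: measurable_snd|exact: measurable_fst].
apply: (measurableT_comp mG); apply: measurable_fun_pair; last exact: measurable_snd.
by apply: measurable_cons; [exact: measurable_fst|exact: measurable_cst].
Qed.

Let mold (t : m.-tuple (borel X)) y : measurable_fun setT
  (fun u : measurableTypeR R => old_weight rho gamma u t y * G ([tuple of y :: t], u)).
Proof.
apply: emeasurable_funM; last exact: mGt.
have -> : (fun u => old_weight rho gamma u t y) =
    (fun u => old_weight rho gamma u [seq z | z <- t] y) by rewrite map_id.
exact: (@measurable_old_weight _ _ X_separable rho gamma _ _ _ (fun z _ => z) id y t).
Qed.

Let extend_new (t : m.-tuple (borel X)) :
  \int[eta]_z \int[leb]_u (G ([tuple of z :: t], u) * dens m.+1 [tuple of z :: t] u) =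
  \int[leb]_u ((\int[eta]_z (new_weight rho gamma u z * G ([tuple of z :: t], u))) * dens m t u).
Proof.
have mF := @measurable_fun_fubini_tonelli_F _ _ _ _ _ leb.
transitivity (\int[eta]_z \int[leb]_u
    (new_weight rho gamma u z * G ([tuple of z :: t], u) * dens m t u)).
  apply: ge0_ae_eq_integral.
  - by [].
  - apply: (mF _ _ (fun p : borel X * measurableTypeR R =>
      G ([tuple of p.1 :: t], p.2) * dens m.+1 [tuple of p.1 :: t] p.2)).
      apply: (measurableT_comp mH); apply: measurable_fun_pair; last exact: measurable_snd.
      by apply: measurable_cons; [exact: measurable_fst|exact: measurable_cst].
    by move=> p; exact: H0.
  - by apply: (mF _ _ _ (mnew t)) => p; exact: newG_ge0.
  - by move=> z _; apply: integral_ge0 => u _; exact: H0.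
  - by move=> z _; apply: integral_ge0 => u _; exact: newG_ge0.
  apply: filterS (ae_notin eta_diffuse t) => z zt _; apply: eq_integral => u _.
  rewrite (joint_density_new _ _ _ _ _ shape_gt0 zt).
  by rewrite muleCA muleC (muleC (G _)).
have fub := @fubini_tonelli _ _ _ _ R eta leb _ (mnew t) (fun p => newG_ge0 t p.2 p.1).
apply: (etrans fub); apply: eq_integral => u _.
rewrite (eq_integral (fun z => new_weight rho gamma u z * G ([tuple of z :: t], u) * dens m t u));
  last by move=> z _.
rewrite ge0_integralZr; first by [].
- by [].
- apply: emeasurable_funM.
    by apply: measurable_new_weight; [exact: measurable_cst|exact: measurable_id].
  apply: (measurableT_comp mG); apply: measurable_fun_pair; last exact: measurable_cst.
  by apply: measurable_cons; [exact: measurable_id|exact: measurable_cst].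
- by move=> z _; apply: mule_ge0; [exact: new_weight_ge0|exact: G0].
- exact: joint_density_ge0.
Qed.

Let extend_old (t : m.-tuple (borel X)) : \int[leb]_u dens m t u < +oo ->
  \sum_(y <- undup t) \int[leb]_u (G ([tuple of y :: t], u) * dens m.+1 [tuple of y :: t] u) =
  \int[leb]_u ((\sum_(y <- undup t) (old_weight rho gamma u t y * G ([tuple of y :: t], u))) * dens m t u).
Proof.
move=> fin.
have dfin := ge0_finite_integral_ae (mdt t) (fun u => joint_density_ge0 rho P0 mu gamma q m t u) fin.
have og0 u y : 0 <= old_weight rho gamma u t y * G ([tuple of y :: t], u).
  by apply: mule_ge0; [exact: old_weight_ge0|exact: G0].
have ogd0 u y : 0 <= old_weight rho gamma u t y * G ([tuple of y :: t], u) * dens m t u.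
  by apply: mule_ge0; [exact: og0|exact: joint_density_ge0].
transitivity (\sum_(y <- undup t)
    \int[leb]_u (old_weight rho gamma u t y * G ([tuple of y :: t], u) * dens m t u)).
  apply: eq_big_seq => y; rewrite mem_undup => yt; apply: ge0_ae_eq_integral.
  - by [].
  - exact: (measurableT_comp mH (pair1_measurable _)).
  - by apply: emeasurable_funM; [exact: mold|exact: mdt].
  - by move=> u _; exact: H0.
  - by move=> u _; exact: ogd0.
  apply: filterS dfin => u ufin _.
  rewrite (joint_density_old shape_gt0 yt ufin).
  by rewrite muleCA muleC (muleC (G _)).
rewrite (eq_integral (fun u : measurableTypeR R => (\sum_(y <- undup t)
    (old_weight rho gamma u t y * G ([tuple of y :: t], u) * dens m t u))%E)); last first.
  by move=> u _; rewrite ge0_sume_distrl.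
rewrite ge0_integral_sum; first by [].
- by [].
- by move=> y; apply: emeasurable_funM; [exact: mold|exact: mdt].
- by move=> y u _; exact: ogd0.
Qed.

(** Passing from [m] to [m + 1] points multiplies the joint density by the weights of
    the predictive rule. For a fresh point this holds off the finite set of previous
    values, which is [eta]-negligible; for a repeated one, where the density is
    finite, hence for almost every [u] as soon as the density of [t] has finite mass. *)
Lemma continuation_identity :
  \int[seat m.+1]_s \int[leb]_u (G (s, u) * dens m.+1 s u) =
  \int[seat m]_t \int[leb]_u (cont (t, u) * dens m t u).
Proof.
have mF k := @measurable_fun_fubini_tonelli_F _ _ (k.-tuple (borel X)) _ _ leb.
have mcd : measurable_fun setT
    (fun p : m.-tuple (borel X) * measurableTypeR R => cont p * dens m p.1 p.2).
  apply: emeasurable_funM; first exact: measurable_continuation.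
  by apply: (@mdens m); [exact: measurable_fst|exact: measurable_snd].
have cd0 (t : m.-tuple (borel X)) u : 0 <= cont (t, u) * dens m t u.
  by apply: mule_ge0; [exact: continuation_ge0|exact: joint_density_ge0].
rewrite integral_seatingS; first last.
- by move=> s; apply: integral_ge0 => u _; exact: H0.
- by apply: (mF _ _ mH) => -[s u]; exact: H0.
apply: ge0_ae_eq_integral.
- by [].
- apply: measurable_extend; [exact: X_separable|by apply: (mF _ _ mH) => -[s u]; exact: H0|].
  by move=> s; apply: integral_ge0 => u _; exact: H0.
- by apply: (mF _ _ mcd) => -[t u]; exact: cd0.
- by move=> t _; apply: extend_ge0 => s; apply: integral_ge0 => u _; exact: H0.
- by move=> t _; apply: integral_ge0 => u _; exact: cd0.
apply: filterS dens_fin => t fin _.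
rewrite /extend extend_new (extend_old fin) -ge0_integralD; first last.
- apply: emeasurable_funM; last exact: mdt.
  by apply: emeasurable_sum => y; exact: mold.
- move=> u _; apply: mule_ge0; last exact: joint_density_ge0.
  by apply: sume_ge0 => y _; apply: mule_ge0; [exact: old_weight_ge0|exact: G0].
- apply: emeasurable_funM; last exact: mdt.
  apply: (@measurable_fun_fubini_tonelli_F _ _ _ _ _ eta (fun p : measurableTypeR R * borel X =>
      new_weight rho gamma p.1 p.2 * G ([tuple of p.2 :: t], p.1))).
    apply: emeasurable_funM.
      by apply: measurable_new_weight; [exact: measurable_fst|exact: measurable_snd].
    apply: (measurableT_comp mG); apply: measurable_fun_pair; last exact: measurable_fst.
    by apply: measurable_cons; [exact: measurable_snd|exact: measurable_cst].
  by move=> p; apply: mule_ge0; [exact: new_weight_ge0|exact: G0].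
- move=> u _; apply: mule_ge0; last exact: joint_density_ge0.
  by apply: integral_ge0 => z _; apply: mule_ge0; [exact: new_weight_ge0|exact: G0].
- by [].
apply: eq_integral => u _; apply/esym; apply: ge0_muleDl.
- by apply: integral_ge0 => z _; apply: mule_ge0; [exact: new_weight_ge0|exact: G0].
- by apply: sume_ge0 => y _; apply: mule_ge0; [exact: old_weight_ge0|exact: G0].
Qed.

End continuation_identity.

(** * Conditional expectations *)

Section conditional_expectation.
Context d d' (Omega : measurableType d) (E : measurableType d') (R : realType).

(** [F] is the sigma-algebra generated by the map [T]. *)
Definition generated (F : set (set Omega)) (T : Omega -> E) : Prop :=
  (forall D, F D -> exists2 D', measurable D' & D = T @^-1` D') /\
  (forall D', measurable D' -> F (T @^-1` D')).

Lemma integral_preimage (m : {measure set Omega -> \bar R}) (T : Omega -> E)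
    (D : set E) (f : Omega -> \bar R) :
  \int[m]_(w in T @^-1` D) f w = \int[m]_w ((\1_D (T w))%:E * f w).
Proof.
rewrite integral_mkcond; apply: eq_integral => w _; rewrite patchE indicE.
have -> : (w \in T @^-1` D) = (T w \in D) by apply/idP/idP; rewrite !inE.
by case: (T w \in D) => /=; rewrite ?mul1e ?mul0e.
Qed.

(** Events of [F] are preimages under [T], so that conditioning on [F] only involves
    the joint law of [T] and [Z]. *)
Lemma cond_exp_comp (P : probability Omega R) (F : set (set Omega)) (T : Omega -> E)
    (Z : Omega -> \bar R) (Y : E -> \bar R) : generated F T ->
  measurable_fun setT Y -> (forall x, 0 <= Y x) ->
  (forall D, measurable D -> \int[P]_w ((\1_D (T w))%:E * Y (T w)) =
                             \int[P]_w ((\1_D (T w))%:E * Z w)) ->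
  is_cond_exp P F Z (Y \o T).
Proof.
move=> [FT TF] mY Y0 eq; split.
- by move=> w; exact: Y0.
- move=> B mB; rewrite comp_preimage; apply: TF.
  by rewrite -[X in measurable X]setTI; exact: mY.
- by move=> D /FT[D' mD' ->]; rewrite !integral_preimage eq.
Qed.

(** The law of [Y] integrates the identity and the constant alike over all sets, hence
    is concentrated at the constant. *)
Lemma ae_eq_cst (P : probability Omega R) (Y : Omega -> \bar R) (c : R) :
  measurable_fun setT Y -> (forall w, 0 <= Y w) -> (0 <= c)%R ->
  (forall B, measurable B -> \int[P]_w ((\1_B (Y w))%:E * Y w) =
                             \int[P]_w ((\1_B (Y w))%:E * c%:E)) ->
  {ae P, forall w, Y w = c%:E}.
Proof.
move=> mY Y0 c0 eq.
have m1 : measurable_fun [set: Omega] (fun _ : Omega => 1 : \bar R) by exact: measurable_cst.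
have p1 (w : Omega) : 0 <= (1 : \bar R) by exact: lee01.
pose Q := wmeasure P m1 p1 mY.
have QE B : measurable B -> Q B = P (Y @^-1` B).
  move=> mB; rewrite /Q /wmeasure (eq_integral (fun w => (\1_(Y @^-1` B) w)%:E)).
    rewrite integral_indic ?setIT//.
    by rewrite -[X in measurable X]setTI; exact: (mY measurableT).
  by move=> w _; rewrite mul1e.
have QT : Q setT = 1 by rewrite QE// preimage_setT probability_setT.
have intQ (B : set (\bar R)) (g : \bar R -> \bar R) : measurable B -> measurable_fun setT g ->
    (forall y, 0 <= g y) ->
    \int[Q]_(y in B) g y = \int[P]_w ((\1_B (Y w))%:E * g (Y w)).
  move=> mB mg g0; rewrite integral_mkcond.
  rewrite (eq_integral (fun y => (\1_B y)%:E * g y)); last first.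
    by move=> y _; rewrite patchE indicE; case: (y \in B) => /=; rewrite ?mul1e ?mul0e.
  rewrite ge0_integral_wmeasure.
  - by apply: eq_integral => w _; rewrite mul1e.
  - apply: emeasurable_funM; last exact: mg.
    by apply/measurable_EFinP; exact: measurable_indic.
  - by move=> y; apply: mule_ge0; [rewrite lee_fin|exact: g0].
have mabs : measurable_fun setT (fun y : \bar R => `|y|) by exact: abse_measurable.
have intc : Q.-integrable setT (cst c%:E).
  apply/integrableP; split; first exact: measurable_cst.
  by rewrite integral_cst// [X in _ * X]QT mule1 ltry.
have [N [mN N0 NP]] : ae_eq Q setT (cst c%:E) (fun y => `|y|).
  apply: integral_ae_eq => //.
  move=> B _ mB; rewrite !intQ//.
    by apply/esym; rewrite -eq//; apply: eq_integral => w _; rewrite gee0_abs.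
exists (Y @^-1` N); split.
- by rewrite -[X in measurable X]setTI; exact: (mY measurableT).
- by rewrite -QE.
- move=> w /= Yc; apply: NP => /= H; apply: Yc.
  by have := H I; rewrite gee0_abs.
Qed.

End conditional_expectation.

Section sample_sigma_algebra.
Context (R : realType) (X : completeMetricType R) (n : nat).
Context d (Omega : measurableType d).
Variable S : 'I_n -> Omega -> borel X.
Local Notation F := (sigma_fam setT S).

Lemma generated_sample : generated F (revtuple S).
Proof.
split.
  move=> D FD; have sub : F `<=` g_sigma_algebra_preimage (revtuple S).
    apply: smallest_sub; first exact/sigma_algebra_preimage/sigma_algebra_measurable.
    move=> _ [i _ [B mB <-]]; exists ((fun t : n.-tuple (borel X) => tnth t (rev_ord i)) @^-1` B).
      by rewrite -[X in measurable X]setTI; exact: measurable_tnth.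
    rewrite !setTI; apply/seteqP; split => w /=; by rewrite tnth_mktuple rev_ordK.
  by have [D' mD' <-] := sub _ FD; exists D' => //; rewrite setTI.
move=> D' mD'.
pose G := \bigcup_(i in [set: 'I_n]) preimage_set_system setT (S i) measurable.
have mT : measurable_fun [set: g_sigma_algebraType G] (revtuple S : g_sigma_algebraType G -> _).
  apply/measurable_fun_tnthP => i _ B mB; rewrite setTI.
  apply: sub_sigma_algebra; exists (rev_ord i) => //; exists B => //.
  by rewrite setTI; apply/seteqP; split => w /=; rewrite tnth_mktuple.
by have := mT measurableT D' mD'; rewrite setTI.
Qed.

Variable U : Omega -> measurableTypeR R.

Lemma generated_sample_pair :
  generated <<s F `|` g_sigma_algebra_preimage U >> (fun w => (revtuple S w, U w)).
Proof.
have [FT TF] := generated_sample.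
split.
  move=> D FD; have sub : <<s F `|` g_sigma_algebra_preimage U >> `<=`
      g_sigma_algebra_preimage (fun w => (revtuple S w, U w)).
    apply: smallest_sub; first exact/sigma_algebra_preimage/sigma_algebra_measurable.
    move=> _ [/FT[D' mD' ->]|[B mB <-]].
      exists (D' `*` setT); first exact: measurableX.
      by rewrite setTI; apply/seteqP; split => w //= [].
    exists (setT `*` B); first exact: measurableX.
    by rewrite !setTI; apply/seteqP; split => w //= [].
  by have [D' mD' <-] := sub _ FD; exists D' => //; rewrite setTI.
move=> D' mD'.
have mT : measurable_fun [set: g_sigma_algebraType (F `|` g_sigma_algebra_preimage U)]
    (fun w : g_sigma_algebraType (F `|` g_sigma_algebra_preimage U) => (revtuple S w, U w)).
  apply: measurable_fun_pair.
    by move=> _ B mB; rewrite setTI; apply: sub_sigma_algebra; left; exact: TF.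
  by move=> _ B mB; apply: sub_sigma_algebra; right; exists B.
by have := mT measurableT D' mD'; rewrite setTI.
Qed.

End sample_sigma_algebra.

(** * Enlarged probability spaces *)

(** Dividing a density by its total mass [Z] and multiplying back is harmless as soon
    as [Z] is finite: when [Z = 0] the density vanishes almost everywhere. *)
Lemma integral_normalize (R : realType) d (T : measurableType d)
    (m : {measure set T -> \bar R}) (f g : T -> \bar R) :
  measurable_fun setT f -> (forall x, 0 <= f x) ->
  measurable_fun setT g -> (forall x, 0 <= g x) -> \int[m]_x g x < +oo ->
  (\int[m]_x (f x * (g x / \int[m]_x g x))) * \int[m]_x g x = \int[m]_x (f x * g x).
Proof.
move=> mf f0 mg g0; set Z := \int[m]_x g x => Zfin.
have fg0 x : 0 <= f x * g x by apply: mule_ge0.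
have mfg : measurable_fun setT (fun x => f x * g x) by apply: emeasurable_funM.
have Z0 : 0 <= Z by apply: integral_ge0 => x _; exact: g0.
have [Zz|Zn] := eqVneq Z 0.
  rewrite Zz mule0; apply/esym.
  have gae : {ae m, forall x, g x = 0}.
    have /(ae_eq_integral_abs m measurableT mg) : \int[m]_x `|g x| = 0.
      by rewrite -Zz; apply: eq_integral => x _; rewrite gee0_abs.
    by apply: filterS => x /(_ I).
  rewrite (ge0_ae_eq_integral (g := fun=> 0)); first by rewrite integral0.
  - by [].
  - exact: mfg.
  - exact: measurable_cst.
  - by move=> x _; exact: fg0.
  - by [].
  by apply: filterS gae => x -> _; rewrite mule0.
have ZV0 : 0 <= Z^-1 by rewrite inve_ge0.
rewrite (eq_integral (fun x => f x * g x * Z^-1)); last by move=> x _; rewrite muleA.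
rewrite ge0_integralZr; first last.
- exact: ZV0.
- by move=> x _; exact: fg0.
- exact: mfg.
- by [].
by rewrite -muleA mulVe ?mule1// ge0_fin_numE.
Qed.

Section enlarged_space.
Context d (Omega : measurableType d) (R : realType) (P : probability Omega R).
Local Notation leb := (@lebesgue_measure R).
Variable f : Omega * measurableTypeR R -> \bar R.
Hypotheses (mf : measurable_fun setT f) (f_ge0 : forall p, 0 <= f p).
Hypothesis f_int : forall w, \int[leb]_u f (w, u) = 1.

(** The product of [P] with a real coordinate of conditional density [f]. *)
Definition enlarged of (forall w, \int[leb]_u f (w, u) = 1) :
    set (Omega * measurableTypeR R) -> \bar R :=
  wmeasure (P \x leb) mf f_ge0 (@measurable_id _ (Omega * measurableTypeR R)%type setT).

Local Notation P' := (enlarged f_int).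

HB.instance Definition _ := Measure.copy P'
  (wmeasure (P \x leb) mf f_ge0 (@measurable_id _ (Omega * measurableTypeR R)%type setT)).

Lemma integral_enlarged (G : Omega * measurableTypeR R -> \bar R) :
  measurable_fun setT G -> (forall p, 0 <= G p) ->
  \int[P']_p G p = \int[P]_w \int[leb]_u (f (w, u) * G (w, u)).
Proof.
move=> mG G0; have mfG : measurable_fun setT (fun p => f p * G p).
  by apply: emeasurable_funM.
have fG0 p : 0 <= f p * G p by apply: mule_ge0.
rewrite -(@fubini_tonelli1 _ _ _ _ R P leb _ mfG fG0).
exact: ge0_integral_wmeasure.
Qed.

Let enlarged_setT : P' setT = 1.
Proof.
transitivity (\int[P']_p 1).
  by rewrite integral_cst// mul1e.
rewrite integral_enlarged//.
rewrite (eq_integral (fun=> 1)); last first.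
  by move=> w _; rewrite -[RHS](f_int w); apply: eq_integral => u _; rewrite mule1.
rewrite integral_cst// mul1e; exact: (probability_setT P).
Qed.

HB.instance Definition _ := Measure_isProbability.Build _ _ _ P' enlarged_setT.

Definition enlarged_probability : probability (Omega * measurableTypeR R)%type R := P'.

End enlarged_space.

Section coordinates.
Context d (Omega : measurableType d) (R : realType).

Definition base_point (p : Omega * measurableTypeR R) : Omega := p.1.

HB.instance Definition _ := isMeasurableFun.Build _ _ _ _ base_point measurable_fst.

(** The real coordinate, made positive on the null set where it is not. *)
Definition extra_coordinate (p : Omega * measurableTypeR R) : measurableTypeR R :=
  if (0 < (p.2 : R))%R then p.2 else 1%R.

Lemma extra_coordinate_gt0 p : (0 < (extra_coordinate p : R))%R.
Proof. by rewrite /extra_coordinate; case: ifP. Qed.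

Let measurable_extra_coordinate : measurable_fun setT extra_coordinate.
Proof.
apply: measurable_fun_ifT.
- by apply: measurable_fun_ltr; [exact: measurable_cst|exact: measurable_snd].
- exact: measurable_snd.
- exact: measurable_cst.
Qed.

HB.instance Definition _ := isMeasurableFun.Build _ _ _ _ extra_coordinate
  measurable_extra_coordinate.

End coordinates.

(** * Predictive formulas in terms of tuples *)

Lemma tauE (R : realType) (X : completeMetricType R)
  (rho : R.-sigmafker (borel X) ~> measurableTypeR R) k z a :
  tau rho k z a = lap rho (powerw k) z a.
Proof.
rewrite lapE /tau [LHS]integral_mkcond; apply: eq_integral => s _.
by rewrite patchE mem_setE in_itv/= andbT /lap_integrand; case: ifP.
Qed.

Section predictive_formulas.
Context (R : realType) (X : completeMetricType R) (X_separable : separable X).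
Local Notation leb := (@lebesgue_measure R).
Variables (eta : probability (borel X) R) (rho : R.-sigmafker (borel X) ~> measurableTypeR R).
Context d0 (Omega0 : measurableType d0) (P0 : probability Omega0 R).
Variables (mu : {mfun Omega0 >-> bfmeasures X}) (gamma q : R) (n : nat).
Hypothesis gamma_ge0 : (0 <= gamma)%R.
Hypothesis mass_laplace_psi : forall a, (0 <= a)%R ->
  mass_laplace P0 mu a = expeR (- psi eta rho 0 a).
Local Notation dens := (joint_density rho P0 mu gamma q n).
Local Notation new := (new_weight rho gamma).
Local Notation old := (old_weight rho gamma).

(** The conditional density of the augmenting variable, as a function of the tuple of
    observations and extended by zero to negative [u]. *)
Definition cond_density (t : seq (borel X)) (u : R) : \bar R :=
  dens t u / \int[leb]_v dens t v.

Lemma cond_density_ge0 t u : 0 <= cond_density t u.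
Proof.
apply: mule_ge0; first exact: joint_density_ge0.
by rewrite inve_ge0; apply: integral_ge0 => v _; exact: joint_density_ge0.
Qed.

Lemma cond_density_le0 t u : ~~ (0 < u)%R -> cond_density t u = 0.
Proof. by move=> u0; rewrite /cond_density /joint_density /powp (negbTE u0) !mul0e. Qed.

Lemma measurable_cond_density : measurable_fun setT
  (fun p : n.-tuple (borel X) * measurableTypeR R => cond_density p.1 p.2).
Proof.
have md : measurable_fun setT (fun p : n.-tuple (borel X) * measurableTypeR R => dens p.1 p.2).
  by apply: (@measurable_joint_density_tuple _ _ X_separable _ _ _ _ _ _ _ n n);
    [exact: measurable_fst|exact: measurable_snd].
apply: emeasurable_funM; first exact: md.
apply: measurable_inve_ge0; last by move=> p; apply: integral_ge0 => v _; exact: joint_density_ge0.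
have mZ : measurable_fun setT (fun t : n.-tuple (borel X) => \int[leb]_v dens t v).
  by apply: (@measurable_fun_fubini_tonelli_F _ _ _ _ _ leb _ md) => p; exact: joint_density_ge0.
exact: (measurableT_comp mZ measurable_fst).
Qed.

(** The unnormalized predictive rule; on the whole space it is [phi (u, x)]. *)
Definition next_weight (A : set (borel X)) : n.-tuple (borel X) * measurableTypeR R -> \bar R :=
  continuation eta rho gamma (fun s : n.+1.-tuple (borel X) * measurableTypeR R =>
    (\1_A (thead s.1))%:E).

Lemma next_weightE A (t : n.-tuple (borel X)) u : next_weight A (t, u) =
  \int[eta]_z (new u z * (\1_A z)%:E) + \sum_(y <- undup t) (old u t y * (\1_A y)%:E).
Proof.
by rewrite /next_weight /continuation/=; congr (_ + _).
Qed.

Let measurable_thead_indic A : measurable A -> measurable_fun setT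
  (fun s : n.+1.-tuple (borel X) * measurableTypeR R => (\1_A (thead s.1) : R)%:E).
Proof.
move=> mA; apply/measurable_EFinP; apply: (measurableT_comp (measurable_indic mA)).
exact: (measurableT_comp (measurable_tnth ord0) measurable_fst).
Qed.

Lemma measurable_next_weight A : measurable A -> measurable_fun setT (next_weight A).
Proof.
move=> mA; apply: measurable_continuation; [exact: X_separable|exact: measurable_thead_indic|].
by move=> p; rewrite lee_fin.
Qed.

Lemma next_weight_ge0 A p : 0 <= next_weight A p.
Proof. by apply: continuation_ge0 => s; rewrite lee_fin. Qed.

Lemma omega_new_atE u z : (0 < u)%R -> omega_new_at rho gamma u z = new u z.
Proof. by move=> u0; rewrite /omega_new_at /new_weight tauE upos_gt0E. Qed.

Variable x : 'I_n -> borel X.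
Local Notation t := [tuple x (rev_ord i) | i < n].

Lemma omega_cell_atE u k : (0 < u)%R -> omega_cell_at rho gamma u x k = old u t (Yval x k).
Proof.
by move=> u0; rewrite /omega_cell_at /old_weight !tauE upos_gt0E// (ncellE x k).
Qed.

Lemma fU_numE u : (0 < u)%R -> fU_num eta rho gamma q x u = dens t u.
Proof.
move=> u0; rewrite /fU_num /joint_density mass_laplace_psi; last by rewrite addr_ge0// ltW.
rewrite /powp u0 muleC; congr (_ * (_ * _)).
rewrite /pweight -(@big_cells _ n x _ _ _ (fun c y => lap rho (powerw c) y (gamma + u))).
by apply: eq_bigr => k _; rewrite tauE.
Qed.

Lemma fUE u : (0 < u)%R -> fU eta rho gamma q x u = cond_density t u.
Proof.
move=> u0; rewrite /fU /cond_density fU_numE//; congr (_ * _^-1).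
rewrite integral_mkcond; apply: eq_integral => v _.
rewrite patchE mem_setE in_itv/= andbT; case: ifPn => v0; first exact: fU_numE.
by rewrite /joint_density /powp (negbTE v0) mul0e.
Qed.

Lemma integral_fU (f g : R -> \bar R) : (forall u, (0 < u)%R -> f u = g u) ->
  \int[leb]_(u in `]0%R, +oo[) (f u * fU eta rho gamma q x u) =
  \int[leb]_u (g u * cond_density t u).
Proof.
move=> fg; rewrite integral_mkcond; apply: eq_integral => u _.
rewrite patchE mem_setE in_itv/= andbT; case: ifPn => u0; first by rewrite fg// fUE.
by rewrite cond_density_le0// mule0.
Qed.

Lemma omega_newE z : omega_new eta rho gamma q x z = \int[leb]_u (new u z * cond_density t u).
Proof. by apply: integral_fU => u u0; exact: omega_new_atE. Qed.

Lemma omega_cellE k : omega_cell eta rho gamma q x k =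
  \int[leb]_u (old u t (Yval x k) * cond_density t u).
Proof. by apply: integral_fU => u u0; exact: omega_cell_atE. Qed.

Let omega_new_ge0 z : 0 <= omega_new eta rho gamma q x z.
Proof.
rewrite omega_newE; apply: integral_ge0 => u _.
by apply: mule_ge0; [exact: new_weight_ge0|exact: cond_density_ge0].
Qed.

Let omega_cell_ge0 k : 0 <= omega_cell eta rho gamma q x k.
Proof.
rewrite omega_cellE; apply: integral_ge0 => u _.
by apply: mule_ge0; [exact: old_weight_ge0|exact: cond_density_ge0].
Qed.

Let mcd : measurable_fun setT (fun u : measurableTypeR R => cond_density t u).
Proof. exact: (measurableT_comp measurable_cond_density (pair1_measurable t)). Qed.

Let mnew2 : measurable_fun setT (fun p : borel X * measurableTypeR R => new p.2 p.1).
Proof. by apply: measurable_new_weight; [exact: measurable_snd|exact: measurable_fst]. Qed.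

Let mold y : measurable_fun setT (fun u : measurableTypeR R => old u t y).
Proof.
have -> : (fun u => old u t y) = (fun u => old u [seq z | z <- t] y) by rewrite map_id.
exact: (@measurable_old_weight _ _ X_separable rho gamma _ _ _ (fun z _ => z) id y t).
Qed.

Let measurable_omega_new : measurable_fun setT (omega_new eta rho gamma q x).
Proof.
rewrite (_ : omega_new _ _ _ _ _ = fun z => \int[leb]_u (new u z * cond_density t u)).
  apply: (@measurable_fun_fubini_tonelli_F _ _ _ _ _ leb
    (fun p : borel X * measurableTypeR R => new p.2 p.1 * cond_density t p.2)).
    by apply: emeasurable_funM; [exact: mnew2|exact: (measurableT_comp mcd measurable_snd)].
  by move=> p; apply: mule_ge0; [exact: new_weight_ge0|exact: cond_density_ge0].
by apply/funext => z; exact: omega_newE.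
Qed.

Let patch_indic A (f : borel X -> \bar R) :
  \int[eta]_(z in A) f z = \int[eta]_z (f z * (\1_A z)%:E).
Proof.
rewrite integral_mkcond; apply: eq_integral => z _; rewrite patchE indicE.
by case: (z \in A) => /=; rewrite ?mule1 ?mule0.
Qed.

Let cells_undup (F : borel X -> \bar R) :
  \sum_(k < ncells x) F (Yval x k) = \sum_(y <- undup t) F y.
Proof. exact: (@big_cells _ n x _ _ _ (fun _ y => F y)). Qed.

(** Averaging the weights over the augmenting variable commutes with summing them over
    continuations, by Tonelli's theorem. *)
Lemma integral_next_weight A : measurable A ->
  \int[leb]_u (next_weight A (t, u) * cond_density t u) =
  \int[eta]_(z in A) omega_new eta rho gamma q x z +
  \sum_(k < ncells x) omega_cell eta rho gamma q x k * \d_(Yval x k) A.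
Proof.
move=> mA.
have mA1 : measurable_fun setT (fun z => (\1_A z : R)%:E).
  by apply/measurable_EFinP; exact: measurable_indic.
have a0 (z : borel X) : 0 <= (\1_A z : R)%:E by rewrite lee_fin.
have nA0 u z : 0 <= new u z * (\1_A z)%:E by apply: mule_ge0; [exact: new_weight_ge0|exact: a0].
have oA0 u y : 0 <= old u t y * (\1_A y)%:E by apply: mule_ge0; [exact: old_weight_ge0|exact: a0].
have nc0 u z : 0 <= new u z * (\1_A z)%:E * cond_density t u.
  by apply: mule_ge0; [exact: nA0|exact: cond_density_ge0].
have mnA : measurable_fun setT (fun p : borel X * measurableTypeR R =>
    new p.2 p.1 * (\1_A p.1)%:E * cond_density t p.2).
  apply: emeasurable_funM; last exact: (measurableT_comp mcd measurable_snd).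
  by apply: emeasurable_funM; [exact: mnew2|exact: (measurableT_comp mA1 measurable_fst)].
have mN : measurable_fun setT (fun u : measurableTypeR R =>
    (\int[eta]_z (new u z * (\1_A z)%:E)) * cond_density t u).
  apply: emeasurable_funM; last exact: mcd.
  apply: (@measurable_fun_fubini_tonelli_F _ _ _ _ _ eta
    (fun p : measurableTypeR R * borel X => new p.1 p.2 * (\1_A p.2)%:E)).
    apply: emeasurable_funM; last exact: (measurableT_comp mA1 measurable_snd).
    by apply: measurable_new_weight; [exact: measurable_fst|exact: measurable_snd].
  by move=> p; exact: nA0.
have mO : measurable_fun setT (fun u : measurableTypeR R =>
    (\sum_(y <- undup t) (old u t y * (\1_A y)%:E))%E * cond_density t u).
  apply: emeasurable_funM; last exact: mcd.
  apply: emeasurable_sum => y; apply: emeasurable_funM; first exact: mold.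
  exact: measurable_cst.
have N0 u : 0 <= \int[eta]_z (new u z * (\1_A z)%:E) by apply: integral_ge0 => z _; exact: nA0.
have O0 u : 0 <= (\sum_(y <- undup t) (old u t y * (\1_A y)%:E))%E.
  by apply: sume_ge0 => y _; exact: oA0.
rewrite (eq_integral (fun u : measurableTypeR R =>
    (\int[eta]_z (new u z * (\1_A z)%:E)) * cond_density t u +
    (\sum_(y <- undup t) (old u t y * (\1_A y)%:E))%E * cond_density t u)); last first.
  move=> u _; rewrite next_weightE; apply: ge0_muleDl; [exact: N0|exact: O0].
rewrite ge0_integralD; first last.
- exact: mO.
- by move=> u _; apply: mule_ge0; [exact: O0|exact: cond_density_ge0].
- exact: mN.
- by move=> u _; apply: mule_ge0; [exact: N0|exact: cond_density_ge0].
- by [].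
congr (_ + _).
  rewrite patch_indic.
  have fub := @fubini_tonelli _ _ _ _ R eta leb _ mnA (fun p => nc0 p.2 p.1).
  transitivity (\int[leb]_u \int[eta]_z (new u z * (\1_A z)%:E * cond_density t u)).
    apply: eq_integral => u _; apply/esym; apply: ge0_integralZr.
    - by [].
    - apply: emeasurable_funM; last exact: mA1.
      by apply: measurable_new_weight; [exact: measurable_cst|exact: measurable_id].
    - by move=> z _; exact: nA0.
    - exact: cond_density_ge0.
  apply: (etrans (esym fub)); apply: eq_integral => z _; rewrite omega_newE.
  rewrite -ge0_integralZr; first last.
  - exact: a0.
  - by move=> u _; apply: mule_ge0; [exact: new_weight_ge0|exact: cond_density_ge0].
  - apply: emeasurable_funM; last exact: mcd.
    by apply: measurable_new_weight; [exact: measurable_id|exact: measurable_cst].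
  - by [].
  by apply: eq_integral => u _; rewrite muleAC.
transitivity (\sum_(y <- undup t) \int[leb]_u (old u t y * (\1_A y)%:E * cond_density t u)).
  rewrite -ge0_integral_sum; first last.
  - by move=> y u _; apply: mule_ge0; [exact: oA0|exact: cond_density_ge0].
  - move=> y; apply: emeasurable_funM; last exact: mcd.
    by apply: emeasurable_funM; [exact: mold|exact: measurable_cst].
  - by [].
  apply: eq_integral => u _; apply: ge0_sume_distrl => y _; exact: oA0.
rewrite -(cells_undup (fun y => \int[leb]_u (old u t y * (\1_A y)%:E * cond_density t u))).
apply: eq_bigr => k _; rewrite omega_cellE diracE -ge0_integralZr; first last.
- by rewrite lee_fin.
- by move=> u _; apply: mule_ge0; [exact: old_weight_ge0|exact: cond_density_ge0].
- by apply: emeasurable_funM; [exact: mold|exact: mcd].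
- by [].
by apply: eq_integral => u _; rewrite muleAC indicE.
Qed.

Lemma phiE : phi eta rho gamma q x = \int[leb]_u (next_weight setT (t, u) * cond_density t u).
Proof.
rewrite integral_next_weight//; congr (_ + _); apply: eq_bigr => k _.
by rewrite diracT mule1.
Qed.

Let phi_ge0 : 0 <= phi eta rho gamma q x.
Proof.
rewrite phiE; apply: integral_ge0 => u _.
by apply: mule_ge0; [exact: next_weight_ge0|exact: cond_density_ge0].
Qed.

Lemma predictiveE A : measurable A -> predictive eta rho gamma q x A =
  (\int[leb]_u (next_weight A (t, u) * cond_density t u)) / phi eta rho gamma q x.
Proof.
move=> mA; rewrite integral_next_weight// /predictive.
have p0 : 0 <= (phi eta rho gamma q x)^-1 by rewrite inve_ge0.
rewrite ge0_muleDl; first last.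
- by apply: sume_ge0 => k _; apply: mule_ge0; [exact: omega_cell_ge0|rewrite diracE lee_fin].
- by apply: integral_ge0 => z _; exact: omega_new_ge0.
rewrite ge0_integralZr; first last.
- exact: p0.
- by move=> z _; exact: omega_new_ge0.
- exact: measurable_funTS.
- by [].
congr (_ + _); rewrite ge0_sume_distrl; last first.
  by move=> k _; apply: mule_ge0; [exact: omega_cell_ge0|rewrite diracE lee_fin].
by apply: eq_bigr => k _; rewrite muleAC.
Qed.

Lemma phi_atE u : (0 < u)%R -> phi_at eta rho gamma u x = next_weight setT (t, u).
Proof.
move=> u0; rewrite next_weightE /phi_at; congr (_ + _).
  by apply: eq_integral => z _; rewrite indicT mule1 omega_new_atE.
rewrite -(cells_undup (fun y => old u t y * (\1_[set: borel X] y)%:E)).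
by apply: eq_bigr => k _; rewrite indicT mule1 omega_cell_atE.
Qed.

Lemma predictive_atE A u : measurable A -> (0 < u)%R ->
  predictive_at eta rho gamma u x A = next_weight A (t, u) / phi_at eta rho gamma u x.
Proof.
move=> mA u0; have p0 : 0 <= (phi_at eta rho gamma u x)^-1.
  by rewrite inve_ge0 phi_atE// next_weight_ge0.
have a0 (z : borel X) : 0 <= (\1_A z : R)%:E by rewrite lee_fin.
rewrite /predictive_at next_weightE ge0_muleDl; first last.
- by apply: sume_ge0 => y _; apply: mule_ge0; [exact: old_weight_ge0|exact: a0].
- by apply: integral_ge0 => z _; apply: mule_ge0; [exact: new_weight_ge0|exact: a0].
congr (_ + _).
  rewrite patch_indic -ge0_integralZr; first last.
  - exact: p0.
  - by move=> z _; apply: mule_ge0; [exact: new_weight_ge0|exact: a0].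
  - apply: emeasurable_funM; last by apply/measurable_EFinP; exact: measurable_indic.
    by apply: measurable_new_weight; [exact: measurable_cst|exact: measurable_id].
  - by [].
  by apply: eq_integral => z _; rewrite omega_new_atE// muleAC.
rewrite ge0_sume_distrl; last first.
  by move=> y _; apply: mule_ge0; [exact: old_weight_ge0|exact: a0].
rewrite -(cells_undup (fun y => old u t y * (\1_A y)%:E / phi_at eta rho gamma u x)).
by apply: eq_bigr => k _; rewrite omega_cell_atE// muleAC diracE indicE.
Qed.

End predictive_formulas.

(** * Laws under the tilted model *)

Section posterior.
Context (R : realType) (X : completeMetricType R) (X_separable : separable X).
Local Notation leb := (@lebesgue_measure R).
Variables (eta : probability (borel X) R) (rho : R.-sigmafker (borel X) ~> measurableTypeR R).
Variable nu : {measure set (borel X * measurableTypeR R) -> \bar R}.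
Hypothesis nu_intensity : is_intensity eta rho nu.
Context d0 (Omega0 : measurableType d0) (P0 : probability Omega0 R).
Variable mu : {mfun Omega0 >-> bfmeasures X}.
Hypothesis mu_crm : is_crm P0 mu nu.
Hypothesis mu_total : {ae P0, forall w, 0 < (mu w : bfmeasure X) setT < +oo}.
Variables q gamma : R.
Hypotheses (q_ge0 : (0 <= q)%R) (gamma_ge0 : (0 <= gamma)%R).
Variable h : R -> R.
Hypothesis hE : forall x : R, h x = (expR (- (gamma * x)) * x `^ (- q))%R.
Hypothesis h_fin : \int[P0]_w (h (total_mass (mu w)))%:E < +oo.
Context d (Omega : measurableType d) (P : probability Omega R).
Variable mut : {mfun Omega >-> bfmeasures X}.
Hypothesis mut_tilted : is_tilted P0 mu h P mut.
Local Notation dens := (joint_density rho P0 mu gamma q).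
Local Notation seat := (seating eta X_separable).
Local Notation kappa := (joint_const P0 mu q h).

Let eta_diffuse z : eta [set z] = 0.
Proof. by case: nu_intensity => na _ _ _ _; exact: nonatomic_set1. Qed.

Let nuE (A : set (borel X)) (B : set (measurableTypeR R)) :
  measurable A -> measurable B -> nu (A `*` B) = \int[eta]_(x in A) rho x B.
Proof. by case: nu_intensity => _ _ + _ _; exact. Qed.

Lemma mass_laplace_psi a : (0 <= a)%R -> mass_laplace P0 mu a = expeR (- psi eta rho 0 a).
Proof. by case: mu_crm => N [NP muN]; apply: (mass_laplaceE nuE NP muN). Qed.

Let mu_moment m (A : 'I_m -> set (borel X)) (a : R) :
  (forall i, measurable (A i)) -> (0 < a)%R ->
  \int[P0]_w (expN (a%:E * mu w [set: borel X]) * \prod_(i < m) mu w (A i)) =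
  mass_laplace P0 mu a * \int[seat m]_x ((\1_(box A) x)%:E * pweight rho (fun=> a) x).
Proof.
by case: mu_crm => N [NP muN]; apply: (random_measure_moment X_separable nuE eta_diffuse NP muN mu_total).
Qed.

Let mh : measurable_fun setT h.
Proof.
rewrite (_ : h = fun x => (expR (- (gamma * x)) * x `^ (- q))%R); last exact/funext.
apply: measurable_funM; last exact: measurable_powR.
apply: measurableT_comp; first exact: measurable_expR.
by apply: measurable_funN; exact: mulrl_measurable.
Qed.

Let h_ge0 x : (0 <= h x)%R. Proof. by rewrite hE mulr_ge0 ?expR_ge0 ?powR_ge0. Qed.

Let shape_ge1 m : (1 <= m)%N -> (1 <= m%:R + q)%R.
Proof. by move=> m1; rewrite -[leLHS]addr0 lerD// ler1n. Qed.

Lemma kappa_gt0 m : (1 <= m)%N -> (0 < kappa m)%R.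
Proof.
move=> m1; rewrite invr_gt0 mulr_gt0//; last exact/Gamma_gt0/shape_ge1.
exact: (tilt_norm_gt0 mh h_ge0 h_fin mut_tilted).
Qed.

(** The functional equation of the gamma function: this is where the norming constant
    [n + q] of the predictive rule comes from. *)
Lemma kappaS m : (1 <= m)%N -> kappa m.+1 = (kappa m / (m%:R + q))%R.
Proof.
move=> m1; rewrite /joint_const (_ : (m.+1%:R + q = m%:R + q + 1)%R); last first.
  by rewrite -natr1; ring.
by rewrite GammaS ?shape_ge1// mulrCA invfM mulrC.
Qed.

Let moment m (A : 'I_m -> set (borel X)) (B : set (measurableTypeR R)) : (1 <= m)%N ->
  (forall i, measurable (A i)) -> measurable B ->
  \int[P]_w (\prod_(i < m) normalized (mut w) (A i) *
             gamma_law (m%:R + q) (total_mass (mut w)) B) =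
  (kappa m)%:E * \int[seat m]_x
    ((\1_(box A) x)%:E * \int[leb]_u ((\1_B u)%:E * dens m x u)).
Proof.
move=> m1 mA mB.
exact: (joint_moment q_ge0 gamma_ge0 mu_total mu_moment hE h_fin mut_tilted m1 mA mB).
Qed.

Let mut_total := tilted_total mu_total mh h_ge0 h_fin mut_tilted.

Section laws.
Variables (m : nat) (m_ge1 : (1 <= m)%N) (S : 'I_m -> {mfun Omega >-> borel X}).
Local Notation Tm := (revtuple (fun i => S i : Omega -> borel X)).

Lemma law_augmented (U : {mfun Omega >-> measurableTypeR R})
    (F : m.-tuple (borel X) * measurableTypeR R -> \bar R) :
  is_augmenting P mut q (fun i => S i : Omega -> borel X) U ->
  measurable_fun setT F -> (forall p, 0 <= F p) ->
  \int[P]_w F (Tm w, U w) = (kappa m)%:E * \int[seat m]_x \int[leb]_u (F (x, u) * dens m x u).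
Proof.
by apply: augmented_law => [|A B mA mB]; [exact/ltW/kappa_gt0|exact: moment].
Qed.

Lemma law_sample (F : m.-tuple (borel X) -> \bar R) :
  is_iid_normalized P mut (fun i => S i : Omega -> borel X) ->
  measurable_fun setT F -> (forall p, 0 <= F p) ->
  \int[P]_w F (Tm w) = (kappa m)%:E * \int[seat m]_x (F x * \int[leb]_u dens m x u).
Proof.
apply: sample_law => [|||A B mA mB].
- exact/ltW/kappa_gt0.
- exact: mut_total.
- exact: shape_ge1.
- exact: moment.
Qed.

End laws.

End posterior.

(** * Prediction *)

Lemma indic_preimage (R : pzRingType) (T1 T2 : Type) (f : T1 -> T2) (A : set T2) x :
  \1_(f @^-1` A) x = \1_A (f x) :> R.
Proof. by rewrite !indicE; congr (nat_of_bool _)%:R; apply/idP/idP; rewrite !inE. Qed.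

Section prediction.
Context (R : realType) (X : completeMetricType R) (X_separable : separable X).
Local Notation leb := (@lebesgue_measure R).
Variables (eta : probability (borel X) R) (rho : R.-sigmafker (borel X) ~> measurableTypeR R).
Hypothesis eta_diffuse : forall z, eta [set z] = 0.
Context d0 (Omega0 : measurableType d0) (P0 : probability Omega0 R).
Variables (mu : {mfun Omega0 >-> bfmeasures X}) (gamma q : R) (n : nat).
Context d (Omega : measurableType d) (P : probability Omega R).
Variables (S : 'I_n.+1 -> {mfun Omega >-> borel X}) (U : {mfun Omega >-> measurableTypeR R}).
Hypothesis shape_gt0 : (0 < n%:R + q)%R.
Local Notation dens := (joint_density rho P0 mu gamma q).
Local Notation cdens := (cond_density rho P0 mu gamma q n).
Local Notation seat := (seating eta X_separable).
Local Notation cont := (@continuation R X eta rho gamma n).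
Local Notation next := (@next_weight R X eta rho gamma n).

Definition first_values (i : 'I_n) : {mfun Omega >-> borel X} := S (widen_ord (leqnSn n) i).

Local Notation Tn := (revtuple (fun i => first_values i : Omega -> borel X)).
Local Notation T1 := (revtuple (fun i => S i : Omega -> borel X)).

Variables kn k1 : R.
Hypotheses (kn_gt0 : (0 < kn)%R) (k1E : k1 = (kn / (n%:R + q))%R).
Hypothesis law_U : forall F : n.-tuple (borel X) * measurableTypeR R -> \bar R,
  measurable_fun setT F -> (forall p, 0 <= F p) ->
  \int[P]_w F (Tn w, U w) = kn%:E * \int[seat n]_t \int[leb]_u (F (t, u) * dens n t u).
Hypothesis law_S : forall F : n.+1.-tuple (borel X) -> \bar R,
  measurable_fun setT F -> (forall p, 0 <= F p) ->
  \int[P]_w F (T1 w) = k1%:E * \int[seat n.+1]_t (F t * \int[leb]_u dens n.+1 t u).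

Let k1_gt0 : (0 < k1)%R. Proof. by rewrite k1E divr_gt0. Qed.

Lemma revtuple_cons w : T1 w = [tuple of S ord_max w :: Tn w].
Proof.
apply: eq_from_tnth => i; rewrite tnth_mktuple.
case: (unliftP ord0 i) => [j ->|->]; last first.
  by rewrite tnth0; congr (S _ w); apply: val_inj; rewrite /= subn1.
rewrite tnthS tnth_mktuple; congr (S _ w); apply: val_inj => /=.
by rewrite /bump/= add1n subSS.
Qed.

Let mTn : measurable_fun setT Tn. Proof. exact: measurable_revtuple. Qed.
Let mT1 : measurable_fun setT T1. Proof. exact: measurable_revtuple. Qed.
Let mU : measurable_fun setT (U : Omega -> measurableTypeR R).
Proof. exact: measurable_funPT. Qed.
Let mTU : measurable_fun setT (fun w => (Tn w, U w)).
Proof. by apply: measurable_fun_pair; [exact: mTn|exact: mU]. Qed.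

Let mdens k : measurable_fun setT
  (fun p : k.-tuple (borel X) * measurableTypeR R => dens k p.1 p.2).
Proof.
by apply: (@measurable_joint_density_tuple _ _ X_separable _ _ _ _ _ _ _ k k);
  [exact: measurable_fst|exact: measurable_snd].
Qed.

Let mdens1 k (t : k.-tuple (borel X)) :
  measurable_fun setT (fun u : measurableTypeR R => dens k t u).
Proof.
by apply: (@measurable_joint_density_tuple _ _ X_separable _ _ _ _ _ _ _ k k _ _ (fun=> t));
  [exact: measurable_cst|exact: measurable_id].
Qed.

Let d_ge0 k t u : 0 <= dens k t u. Proof. exact: joint_density_ge0. Qed.

Let mZ k : measurable_fun setT (fun t : k.-tuple (borel X) => \int[leb]_u dens k t u).
Proof. by apply: (@measurable_fun_fubini_tonelli_F _ _ _ _ _ leb _ (@mdens k)) => p. Qed.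

Let Z_ge0 k (t : k.-tuple (borel X)) : 0 <= \int[leb]_u dens k t u.
Proof. by apply: integral_ge0 => u _. Qed.

Let P1 : \int[P]_w 1 = 1 :> \bar R.
Proof. by rewrite integral_cst// mul1e; exact: (probability_setT P). Qed.

Let fin_of_mul (k : R) (I : \bar R) : (0 < k)%R -> 1 = k%:E * I -> I < +oo.
Proof.
by case: I => [r| |]// k0; [rewrite ltry|rewrite gt0_muley].
Qed.

Lemma mass_fin : {ae seat n, forall t : n.-tuple (borel X), \int[leb]_u dens n t u < +oo}.
Proof.
apply: ge0_finite_integral_ae; [exact: mZ|exact: Z_ge0|].
have := law_U (F := fun=> 1) (@measurable_cst _ _ _ _ _ _) (fun=> lee01).
rewrite P1 => /(fin_of_mul kn_gt0).
move=> fin; apply: le_lt_trans fin; rewrite le_eqVlt; apply/orP; left; apply/eqP.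
by apply: eq_integral => t _; apply: eq_integral => u _; rewrite mul1e.
Qed.

Lemma mass_fin1 :
  {ae seat n.+1, forall t : n.+1.-tuple (borel X), \int[leb]_u dens n.+1 t u < +oo}.
Proof.
apply: ge0_finite_integral_ae; [exact: mZ|exact: Z_ge0|].
have := law_S (F := fun=> 1) (@measurable_cst _ _ _ _ _ _) (fun=> lee01).
rewrite P1 => /(fin_of_mul k1_gt0).
move=> fin; apply: le_lt_trans fin; rewrite le_eqVlt; apply/orP; left; apply/eqP.
by apply: eq_integral => t _; rewrite mul1e.
Qed.

(** The joint law of [n + 1] observations and of their augmenting variable, in terms of
    that of [n] observations. *)
Lemma next_law (G : n.+1.-tuple (borel X) * measurableTypeR R -> \bar R) :
  measurable_fun setT G -> (forall p, 0 <= G p) ->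
  k1%:E * \int[seat n.+1]_s \int[leb]_u (G (s, u) * dens n.+1 s u) =
  ((n%:R + q)^-1)%:E * \int[P]_w cont G (Tn w, U w).
Proof.
move=> mG G0.
have ci := continuation_identity eta_diffuse shape_gt0 mass_fin mG G0.
rewrite ci law_U; first last.
- by move=> p; exact: continuation_ge0.
- by apply: measurable_continuation.
by rewrite k1E mulrC EFinM -muleA.
Qed.

Lemma sample_next (F : n.+1.-tuple (borel X) -> \bar R) :
  measurable_fun setT F -> (forall p, 0 <= F p) ->
  \int[P]_w F (T1 w) =
  ((n%:R + q)^-1)%:E * \int[P]_w cont (fun s => F s.1) (Tn w, U w).
Proof.
move=> mF F0; rewrite law_S// -next_law; first last.
- by move=> p; exact: F0.
- exact: (measurableT_comp mF measurable_fst).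
congr (_ * _); apply: eq_integral => s _; rewrite -ge0_integralZl; first last.
- exact: F0.
- by move=> u _; exact: d_ge0.
- exact: mdens1.
- by [].
by [].
Qed.

Let rest (s : n.+1.-tuple (borel X)) : n.-tuple (borel X) := [tuple of behead s].

Let mrest : measurable_fun setT rest.
Proof.
apply/measurable_fun_tnthP => i.
rewrite (_ : _ \o _ = (fun s : n.+1.-tuple (borel X) => tnth s (lift ord0 i))).
  exact: measurable_tnth.
by apply/funext => s /=; rewrite tnth_behead; congr tnth; apply: val_inj; rewrite /= inordK// ltnS.
Qed.

Let rest_cons z (t : n.-tuple (borel X)) : rest [tuple of z :: t] = t.
Proof. exact: val_inj. Qed.

Lemma continuation_factor (c : n.-tuple (borel X) * measurableTypeR R -> \bar R)
    (H : n.+1.-tuple (borel X) * measurableTypeR R -> \bar R) t u :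
  0 <= c (t, u) -> measurable_fun setT H -> (forall p, 0 <= H p) ->
  cont (fun s => c (rest s.1, s.2) * H s) (t, u) = c (t, u) * cont H (t, u).
Proof.
move=> c0 mH H0; rewrite /continuation/=.
have nH0 z : 0 <= new_weight rho gamma u z * H ([tuple of z :: t], u).
  by apply: mule_ge0; [exact: new_weight_ge0|exact: H0].
have oH0 y : 0 <= old_weight rho gamma u t y * H ([tuple of y :: t], u).
  by apply: mule_ge0; [exact: old_weight_ge0|exact: H0].
rewrite [RHS]ge0_muleDr; first last.
- by apply: sume_ge0 => y _; exact: oH0.
- by apply: integral_ge0 => z _; exact: nH0.
congr (_ + _).
  rewrite -ge0_integralZl; first last.
  - exact: c0.
  - by move=> z _; exact: nH0.
  - apply: emeasurable_funM.
      by apply: measurable_new_weight; [exact: measurable_cst|exact: measurable_id].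
    apply: (measurableT_comp mH); apply: measurable_fun_pair; last exact: measurable_cst.
    by apply: measurable_cons; [exact: measurable_id|exact: measurable_cst].
  - by [].
  by apply: eq_integral => z _; rewrite rest_cons muleCA.
rewrite ge0_sume_distrr; last by move=> y _; exact: oH0.
by apply: eq_bigr => y _; rewrite rest_cons muleCA.
Qed.

(** Bayes' formula for a joint density; tuples whose density has infinite mass are
    negligible, and where the mass is 0 both sides vanish. *)
Lemma conditional_law (F : n.-tuple (borel X) * measurableTypeR R -> \bar R)
    (D : set (n.-tuple (borel X))) :
  measurable_fun setT F -> (forall p, 0 <= F p) -> measurable D ->
  \int[P]_w ((\1_D (Tn w))%:E * \int[leb]_u (F (Tn w, u) * cdens (Tn w) u)) =
  \int[P]_w ((\1_D (Tn w))%:E * F (Tn w, U w)).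
Proof.
move=> mF F0 mD.
have D0 (t : n.-tuple (borel X)) : 0 <= (\1_D t : R)%:E by rewrite lee_fin.
have mD1 : measurable_fun setT (fun t : n.-tuple (borel X) => (\1_D t : R)%:E).
  by apply/measurable_EFinP; exact: measurable_indic.
pose J (t : n.-tuple (borel X)) : \bar R := \int[leb]_u (F (t, u) * cdens t u).
have Fc0 t u : 0 <= F (t, u) * cdens t u by apply: mule_ge0; [exact: F0|exact: cond_density_ge0].
have J0 t : 0 <= J t by apply: integral_ge0 => u _; exact: Fc0.
have mFc : measurable_fun setT (fun p : n.-tuple (borel X) * measurableTypeR R => F p * cdens p.1 p.2).
  by apply: emeasurable_funM; [exact: mF|exact: measurable_cond_density].
have mJ : measurable_fun setT J.
  by apply: (@measurable_fun_fubini_tonelli_F _ _ _ _ _ leb _ mFc) => -[t u]; exact: Fc0.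
have mDF : measurable_fun setT (fun p : n.-tuple (borel X) * measurableTypeR R => (\1_D p.1)%:E * F p).
  by apply: emeasurable_funM; [exact: (measurableT_comp mD1 measurable_fst)|exact: mF].
have DF0 (p : n.-tuple (borel X) * measurableTypeR R) : 0 <= (\1_D p.1 : R)%:E * F p.
  by apply: mule_ge0; [exact: D0|exact: F0].
have mDJ : measurable_fun setT (fun t => (\1_D t)%:E * J t).
  by apply: emeasurable_funM; [exact: mD1|exact: mJ].
have DJ0 t : 0 <= (\1_D t)%:E * J t by apply: mule_ge0; [exact: D0|exact: J0].
have mFd t : measurable_fun setT (fun u : measurableTypeR R => F (t, u)).
  exact: (measurableT_comp mF (pair1_measurable t)).
have e1 := law_U (measurableT_comp mDJ measurable_fst) (fun p => DJ0 p.1).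
apply: (etrans e1).
have e2 := law_U mDF DF0; apply/esym; apply: (etrans e2); congr (_ * _); apply/esym.
apply: ge0_ae_eq_integral.
- by [].
- rewrite (_ : (fun t => _) = fun t => (\1_D t)%:E * J t * \int[leb]_u dens n t u).
    by apply: emeasurable_funM; [exact: mDJ|exact: mZ].
  apply/funext => t.
  rewrite (eq_integral (fun u : measurableTypeR R => ((\1_D t)%:E * J t) * dens n t u));
    last by move=> u _.
  rewrite ge0_integralZl; first by [].
  - by [].
  - exact: mdens1.
  - by move=> u _; exact: d_ge0.
  - exact: DJ0.
- apply: (@measurable_fun_fubini_tonelli_F _ _ _ _ _ leb
    (fun p : n.-tuple (borel X) * measurableTypeR R => (\1_D p.1)%:E * F p * dens n p.1 p.2)).
    by apply: emeasurable_funM; [exact: mDF|exact: mdens].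
  by move=> p; apply: mule_ge0; [exact: DF0|exact: d_ge0].
- by move=> t _; apply: integral_ge0 => u _; apply: mule_ge0; [exact: DJ0|exact: d_ge0].
- by move=> t _; apply: integral_ge0 => u _; apply: mule_ge0; [exact: DF0|exact: d_ge0].
apply: filterS mass_fin => t fin _.
rewrite (eq_integral (fun u : measurableTypeR R => ((\1_D t)%:E * J t) * dens n t u));
  last by move=> u _.
rewrite ge0_integralZl; first last.
- exact: DJ0.
- by move=> u _; exact: d_ge0.
- exact: mdens1.
- by [].
rewrite -muleA /J /cond_density integral_normalize; first last.
- exact: fin.
- by move=> u; exact: d_ge0.
- exact: mdens1.
- by move=> u; exact: F0.
- exact: mFd.
rewrite -ge0_integralZl; first last.
- exact: D0.
- by move=> u _; apply: mule_ge0; [exact: F0|exact: d_ge0].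
- by apply: emeasurable_funM; [exact: mFd|exact: mdens1].
- by [].
by apply: eq_integral => u _; rewrite muleA.
Qed.

Lemma event_law (A : set (borel X)) (D : set (n.-tuple (borel X))) :
  measurable A -> measurable D ->
  \int[P]_w ((\1_D (Tn w))%:E * (\1_A (S ord_max w))%:E) =
  ((n%:R + q)^-1)%:E * \int[P]_w ((\1_D (Tn w))%:E * next A (Tn w, U w)).
Proof.
move=> mA mD.
have mA1 : measurable_fun setT (fun s : n.+1.-tuple (borel X) => (\1_A (thead s) : R)%:E).
  apply/measurable_EFinP; apply: (measurableT_comp (measurable_indic mA)).
  exact: measurable_tnth.
have mD1 : measurable_fun setT (fun s : n.+1.-tuple (borel X) => (\1_D (rest s) : R)%:E).
  by apply/measurable_EFinP; exact: (measurableT_comp (measurable_indic mD) mrest).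
transitivity (\int[P]_w ((fun s => (\1_D (rest s))%:E * (\1_A (thead s))%:E) (T1 w))).
  by apply: eq_integral => w _; rewrite revtuple_cons rest_cons.
rewrite (sample_next (F := fun s => (\1_D (rest s))%:E * (\1_A (thead s))%:E)); first last.
- by move=> s; apply: mule_ge0; rewrite lee_fin.
- by apply: emeasurable_funM.
congr (_ * _); apply: eq_integral => w _.
apply: (@continuation_factor (fun p => (\1_D p.1)%:E) (fun s => (\1_A (thead s.1))%:E)).
- by rewrite lee_fin.
- exact: (measurableT_comp mA1 measurable_fst).
- by move=> p; rewrite lee_fin.
Qed.

(** Taking the whole space as the set of the next observation shows that the total
    weight has conditional expectation [n + q]. *)
Lemma total_law (D : set (n.-tuple (borel X))) : measurable D ->
  \int[P]_w ((\1_D (Tn w))%:E * next setT (Tn w, U w)) =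
  \int[P]_w ((\1_D (Tn w))%:E * (n%:R + q)%:E).
Proof.
move=> mD; have := event_law measurableT mD => e.
have a0 : (n%:R + q != 0)%R by exact: lt0r_neq0.
transitivity ((n%:R + q)%:E * (((n%:R + q)^-1)%:E *
    \int[P]_w ((\1_D (Tn w))%:E * next setT (Tn w, U w)))).
  by rewrite muleA -EFinM mulfV// mul1e.
rewrite -e -ge0_integralZl_EFin; first last.
- exact: ltW.
- apply: emeasurable_funM; apply/measurable_EFinP.
    exact: (measurableT_comp (measurable_indic mD) mTn).
  by apply: measurableT_comp => //; exact: measurable_indic.
- by move=> w _; apply: mule_ge0; rewrite lee_fin.
- by [].
by apply: eq_integral => w _; rewrite indicT mule1 muleC.
Qed.


Hypothesis gamma_ge0 : (0 <= gamma)%R.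
Hypothesis mass_laplace_psi : forall a, (0 <= a)%R ->
  mass_laplace P0 mu a = expeR (- psi eta rho 0 a).
Hypothesis U_gt0 : forall w, (0 < (U w : R))%R.

Definition observed (w : Omega) : 'I_n -> borel X := fun i => S (widen_ord (leqnSn n) i) w.
Local Notation sigmaSn := (sigma_fam setT (fun (i : 'I_n) (w : Omega) => observed w i)).

Lemma generated_observed : generated sigmaSn Tn.
Proof. exact: (generated_sample (fun (i : 'I_n) (w : Omega) => observed w i)). Qed.

Let mJ (F : n.-tuple (borel X) * measurableTypeR R -> \bar R) :
  measurable_fun setT F -> (forall p, 0 <= F p) ->
  measurable_fun setT (fun t => \int[leb]_u (F (t, u) * cdens t u)).
Proof.
move=> mF F0; apply: (@measurable_fun_fubini_tonelli_F _ _ _ _ _ leb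
  (fun p : n.-tuple (borel X) * measurableTypeR R => F p * cdens p.1 p.2)).
  by apply: emeasurable_funM; [exact: mF|exact: measurable_cond_density].
by move=> p; apply: mule_ge0; [exact: F0|exact: cond_density_ge0].
Qed.

Let J0 (F : n.-tuple (borel X) * measurableTypeR R -> \bar R) (t : n.-tuple (borel X)) :
  (forall p, 0 <= F p) -> 0 <= \int[leb]_u (F (t, u) * cdens t u).
Proof.
move=> F0; apply: integral_ge0 => u _; apply: mule_ge0; first exact: F0.
exact: cond_density_ge0.
Qed.

(** All the identities between conditional expectations given the augmented sample
    follow by specializing [F]. *)
Lemma cond_exp_augmented (F : n.-tuple (borel X) * measurableTypeR R -> \bar R)
    (Z Y : Omega -> \bar R) :
  measurable_fun setT F -> (forall p, 0 <= F p) ->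
  (forall w, Z w = F (Tn w, U w)) ->
  (forall w, Y w = \int[leb]_u (F (Tn w, u) * cdens (Tn w) u)) ->
  is_cond_exp P sigmaSn Z Y.
Proof.
move=> mF F0 ZE YE; rewrite (funext ZE) (funext YE).
apply: (@cond_exp_comp _ _ _ _ _ P _ _ _ (fun t => \int[leb]_u (F (t, u) * cdens t u))
  generated_observed).
- exact: mJ.
- by move=> t; exact: J0.
- by move=> D mD; exact: conditional_law.
Qed.

Lemma cond_exp_phi : is_cond_exp P sigmaSn
  (fun w => phi_at eta rho gamma (U w) (observed w))
  (fun w => phi eta rho gamma q (observed w)).
Proof.
apply: (@cond_exp_augmented (next setT)).
- exact: measurable_next_weight.
- exact: next_weight_ge0.
- by move=> w; exact: phi_atE.
- by move=> w; exact: (phiE X_separable q gamma_ge0 mass_laplace_psi).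
Qed.

Lemma phi_total : {ae P, forall w, phi eta rho gamma q (observed w) = (n%:R + q)%:E}.
Proof.
have [Y0 _ _] := cond_exp_phi.
pose J (t : n.-tuple (borel X)) : \bar R := \int[leb]_u (next setT (t, u) * cdens t u).
have mJ' : measurable_fun setT J by apply: mJ; [exact: measurable_next_weight|exact: next_weight_ge0].
have YE w : phi eta rho gamma q (observed w) = J (Tn w).
  exact: (phiE X_separable q gamma_ge0 mass_laplace_psi).
apply: ae_eq_cst.
- by rewrite (funext YE); exact: (measurableT_comp mJ' mTn).
- exact: Y0.
- exact: ltW.
move=> B mB; have mD : measurable (J @^-1` B) by rewrite -[X in measurable X]setTI; exact: mJ'.
have := total_law mD; rewrite -conditional_law; first last.
- exact: mD.
- exact: next_weight_ge0.
- exact: measurable_next_weight.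
move=> e; rewrite (eq_integral (fun w => (\1_(J @^-1` B) (Tn w))%:E * J (Tn w))); last first.
  by move=> w _; rewrite YE.
by apply: (etrans e); apply: eq_integral => w _; rewrite YE.
Qed.

Lemma cond_exp_new z : is_cond_exp P sigmaSn
  (fun w => omega_new_at rho gamma (U w) z)
  (fun w => omega_new eta rho gamma q (observed w) z).
Proof.
apply: (@cond_exp_augmented (fun p => new_weight rho gamma p.2 z)).
- by apply: measurable_new_weight; [exact: measurable_snd|exact: measurable_cst].
- by move=> p; exact: new_weight_ge0.
- by move=> w; exact: omega_new_atE.
- by move=> w; exact: (omega_newE q gamma_ge0 mass_laplace_psi).
Qed.

Lemma cond_exp_cell k : is_cond_exp P sigmaSn
  (fun w => if (k < ncells (observed w))%N
            then omega_cell_at rho gamma (U w) (observed w) k else 0)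
  (fun w => if (k < ncells (observed w))%N
            then omega_cell eta rho gamma q (observed w) k else 0).
Proof.
pose xt (t : n.-tuple (borel X)) : 'I_n -> borel X := fun i => tnth t (rev_ord i).
have xtE w : xt (Tn w) = observed w.
  by apply/funext => i; rewrite /xt tnth_mktuple rev_ordK.
pose F (p : n.-tuple (borel X) * measurableTypeR R) : \bar R :=
  if (k < ncells (xt p.1))%N then old_weight rho gamma p.2 p.1 (Yval (xt p.1) k) else 0.
apply: (@cond_exp_augmented F).
- have mt i : measurable_fun setT
      (fun p : n.-tuple (borel X) * measurableTypeR R => tnth p.1 i).
    exact: (measurableT_comp (measurable_tnth i) measurable_fst).
  apply: (@measurable_nth_undup _ _ X_separable _ _ _
    (fun i (p : n.-tuple (borel X) * measurableTypeR R) => xt p.1 i) _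
    (fun p y => old_weight rho gamma p.2 p.1 y) (enum 'I_n) k).
    by move=> i; exact: mt.
  move=> i; rewrite (_ : (fun p => _) = fun p : n.-tuple (borel X) * measurableTypeR R =>
    old_weight rho gamma p.2 [seq tnth p.1 j | j <- enum 'I_n] (tnth p.1 (rev_ord i))).
    apply: (@measurable_old_weight _ _ X_separable rho gamma _ _ _
      (fun j (p : n.-tuple (borel X) * measurableTypeR R) => tnth p.1 j)); first exact: mt.
    exact: measurable_snd.
  by apply/funext => p; rewrite map_tnth_enum.
- by move=> p; rewrite /F; case: ifP => // _; exact: old_weight_ge0.
- move=> w; rewrite /F /= xtE; case: ifP => // _; exact: omega_cell_atE.
- move=> w; rewrite /F /= xtE; case: ifP => _.
    exact: (omega_cellE q gamma_ge0 mass_laplace_psi).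
  by rewrite integral0_eq// => u _; rewrite mul0e.
Qed.

Lemma cond_prob_next A : measurable A ->
  is_cond_prob P sigmaSn (S ord_max @^-1` A)
    (fun w => predictive eta rho gamma q (observed w) A).
Proof.
move=> mA.
pose J (B : set (borel X)) (t : n.-tuple (borel X)) : \bar R :=
  \int[leb]_u (next B (t, u) * cdens t u).
have mJ' B : measurable B -> measurable_fun setT (J B).
  by move=> mB; apply: mJ; [exact: measurable_next_weight|exact: next_weight_ge0].
have J0' B t : 0 <= J B t by apply: J0; exact: next_weight_ge0.
pose Y (t : n.-tuple (borel X)) : \bar R := J A t / J setT t.
have YE w : predictive eta rho gamma q (observed w) A = Y (Tn w).
  rewrite (predictiveE X_separable q gamma_ge0 mass_laplace_psi)//.
  by rewrite (phiE X_separable q gamma_ge0 mass_laplace_psi).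
rewrite (funext YE).
have mY : measurable_fun setT Y.
  apply: emeasurable_funM; first exact: mJ'.
  by apply: measurable_inve_ge0; [exact: mJ'|exact: J0'].
have Y0 t : 0 <= Y t by apply: mule_ge0; [exact: J0'|rewrite inve_ge0; exact: J0'].
apply: (@cond_exp_comp _ _ _ _ _ P _ _ _ Y generated_observed) => // D mD.
have mD1 : measurable_fun setT (fun w => (\1_D (Tn w) : R)%:E).
  by apply/measurable_EFinP; exact: (measurableT_comp (measurable_indic mD) mTn).
have ninv0 : (0 <= (n%:R + q)^-1)%R by rewrite invr_ge0 ltW.
transitivity (\int[P]_w ((\1_D (Tn w))%:E * (\1_A (S ord_max w))%:E)); last first.
  by apply: eq_integral => w _; rewrite indic_preimage.
rewrite event_law// -conditional_law; first last.
- exact: mD.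
- exact: next_weight_ge0.
- exact: measurable_next_weight.
have mDJ : measurable_fun setT (fun w => (\1_D (Tn w))%:E * J A (Tn w)).
  by apply: emeasurable_funM; [exact: mD1|exact: (measurableT_comp (mJ' _ mA) mTn)].
have DJ0 w : 0 <= (\1_D (Tn w) : R)%:E * J A (Tn w).
  by apply: mule_ge0; [rewrite lee_fin|exact: J0'].
rewrite -ge0_integralZl_EFin; first last.
- exact: ninv0.
- exact: mDJ.
- by move=> w _; exact: DJ0.
- by [].
apply: ge0_ae_eq_integral.
- by [].
- by apply: emeasurable_funM; [exact: mD1|exact: (measurableT_comp mY mTn)].
- by apply: measurable_funeM; exact: mDJ.
- by move=> w _; apply: mule_ge0; [rewrite lee_fin|exact: Y0].
- by move=> w _; apply: mule_ge0; [rewrite lee_fin|exact: DJ0].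
apply: filterS phi_total => w pw _.
have JE : J setT (Tn w) = (n%:R + q)%:E.
  by rewrite -pw; apply/esym; exact: (phiE X_separable q gamma_ge0 mass_laplace_psi).
by rewrite /Y JE inver gt_eqF// muleA muleC.
Qed.


(** Any version of the conditional expectation of the total weight is almost surely
    the constant [n + q]. *)
Lemma cond_exp_total_cst (e : Omega -> \bar R) :
  is_cond_exp P sigmaSn (fun w => phi_at eta rho gamma (U w) (observed w)) e ->
  {ae P, forall w, e w = (n%:R + q)%:E}.
Proof.
move=> [e0 me eE]; have [FT TF] := generated_observed.
apply: ae_eq_cst.
- move=> _ B mB; rewrite setTI; have [D mD ->] := FT _ (me B mB).
  by rewrite -[X in measurable X]setTI; exact: mTn.
- exact: e0.
- exact: ltW.
move=> B mB; have [D mD DE] := FT _ (me B mB).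
have BD w : (\1_B (e w) : R) = \1_D (Tn w).
  by rewrite -(indic_preimage R e B w) DE indic_preimage.
rewrite (eq_integral (fun w => (\1_D (Tn w))%:E * e w)); last by move=> w _; rewrite BD.
rewrite -integral_preimage eE; last exact: TF.
rewrite integral_preimage.
transitivity (\int[P]_w ((\1_D (Tn w))%:E * next setT (Tn w, U w))).
  by apply: eq_integral => w _; congr (_ * _); exact: phi_atE.
by rewrite total_law//; apply: eq_integral => w _; rewrite BD.
Qed.

Local Notation Z1 := (fun s : n.+1.-tuple (borel X) => \int[leb]_v dens n.+1 s v).

(** The conditional density of the augmenting variable of the sample of size
    [n + 1], replaced by that of an exponential law where its mass is degenerate. *)
Definition next_density (s : n.+1.-tuple (borel X)) (u : R) : \bar R :=
  if (0 < Z1 s) && (Z1 s < +oo) then dens n.+1 s u / Z1 s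
  else lap_integrand (poww 1) 1 u.

Let next_density_ge0 s u : 0 <= next_density s u.
Proof.
rewrite /next_density; case: ifP => _; last by apply: lap_integrand_ge0; exact: weight_poww.
by apply: mule_ge0; [exact: d_ge0|rewrite inve_ge0; exact: Z_ge0].
Qed.

Let measurable_next_density : measurable_fun setT
  (fun p : n.+1.-tuple (borel X) * measurableTypeR R => next_density p.1 p.2).
Proof.
have mZ1 : measurable_fun setT
    (fun p : n.+1.-tuple (borel X) * measurableTypeR R => Z1 p.1).
  exact: (measurableT_comp (@mZ n.+1) measurable_fst).
apply: measurable_fun_ifT.
- apply: measurable_and.
    by apply: measurable_fun_lte; [exact: measurable_cst|exact: mZ1].
  by apply: measurable_fun_lte; [exact: mZ1|exact: measurable_cst].
- apply: emeasurable_funM; first exact: mdens.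
  by apply: measurable_inve_ge0; [exact: mZ1|move=> p; exact: Z_ge0].
- exact: (measurableT_comp (measurable_lap_integrand 1 (weight_poww 1)) measurable_snd).
Qed.

Let next_density_int s : \int[leb]_u next_density s u = 1.
Proof.
have [c|c] := boolP ((0 < Z1 s) && (Z1 s < +oo)); last first.
  rewrite -(gammaI1 R) /gammaI lapE; apply: eq_integral => u _.
  by rewrite /next_density (negbTE c).
rewrite (eq_integral (fun u : measurableTypeR R => dens n.+1 s u / Z1 s)); last first.
  by move=> u _; rewrite /next_density c.
have /andP[z0 zy] := c.
rewrite ge0_integralZr; first last.
- by rewrite inve_ge0; exact: Z_ge0.
- by move=> u _; exact: d_ge0.
- exact: mdens1.
- by [].
by rewrite muleC mulVe ?gt_eqF// ge0_fin_numE// ltW.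
Qed.

Let f (p : Omega * measurableTypeR R) : \bar R := next_density (T1 p.1) p.2.

Let mf : measurable_fun setT f.
Proof.
have mp : measurable_fun setT (fun p : Omega * measurableTypeR R => (T1 p.1, p.2)).
  apply: measurable_fun_pair; last exact: measurable_snd.
  exact: (measurableT_comp mT1 measurable_fst).
exact: (measurableT_comp measurable_next_density mp).
Qed.

Let f_ge0 p : 0 <= f p. Proof. exact: (next_density_ge0 (T1 p.1) p.2). Qed.

Let f_int w : \int[leb]_u f (w, u) = 1. Proof. by rewrite -(next_density_int (T1 w)); apply: eq_integral => u _. Qed.

Definition augmented_space : probability (Omega * measurableTypeR R)%type R :=
  enlarged_probability P mf f_ge0 f_int.

Local Notation P' := augmented_space.
Local Notation pi := (@base_point _ Omega R).
Local Notation Ut := (@extra_coordinate _ Omega R).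

Let integral_P' (G : Omega * measurableTypeR R -> \bar R) :
  measurable_fun setT G -> (forall p, 0 <= G p) ->
  \int[P']_p G p = \int[P]_w \int[leb]_u (f (w, u) * G (w, u)).
Proof. by move=> mG G0; exact: integral_enlarged. Qed.

Lemma integral_base (H : Omega -> \bar R) : measurable_fun setT H -> (forall w, 0 <= H w) ->
  \int[P']_p H (pi p) = \int[P]_w H w.
Proof.
move=> mH H0; rewrite integral_P'; first last.
- by move=> p; exact: H0.
- exact: (measurableT_comp mH measurable_fst).
apply: eq_integral => w _.
rewrite (eq_integral (fun u : measurableTypeR R => f (w, u) * H w)); last by move=> u _.
rewrite ge0_integralZr; first by rewrite f_int mul1e.
- by [].
- exact: (measurableT_comp mf (pair1_measurable w)).
- by move=> u _; exact: f_ge0.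
- exact: H0.
Qed.

(** The extra coordinate, given the [n + 1] observations, has the conditional law of
    their augmenting variable. This choice makes the conditional law of the next
    observation, given the first [n] ones and the extra coordinate, proportional to
    the weights. *)
Lemma augmented_space_law (G : n.+1.-tuple (borel X) * measurableTypeR R -> \bar R) :
  measurable_fun setT G -> (forall p, 0 <= G p) ->
  \int[P']_p G (T1 (pi p), Ut p) =
  ((n%:R + q)^-1)%:E * \int[P]_w cont G (Tn w, U w).
Proof.
move=> mG G0; rewrite -(next_law mG G0).
pose ut (u : measurableTypeR R) : measurableTypeR R := if (0 < (u : R))%R then u else 1%R.
have mut' : measurable_fun setT ut.
  apply: measurable_fun_ifT.
  - by apply: measurable_fun_ltr; [exact: measurable_cst|exact: measurable_id].
  - exact: measurable_id.
  - exact: measurable_cst.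
pose F (s : n.+1.-tuple (borel X)) : \bar R := \int[leb]_u (next_density s u * G (s, ut u)).
have mGt s : measurable_fun setT (fun u : measurableTypeR R => G (s, ut u)).
  apply: (measurableT_comp mG); apply: measurable_fun_pair; [exact: measurable_cst|exact: mut'].
have mF : measurable_fun setT F.
  apply: (@measurable_fun_fubini_tonelli_F _ _ _ _ _ leb
    (fun p : n.+1.-tuple (borel X) * measurableTypeR R => next_density p.1 p.2 * G (p.1, ut p.2))).
    apply: emeasurable_funM; first exact: measurable_next_density.
    apply: (measurableT_comp mG); apply: measurable_fun_pair; first exact: measurable_fst.
    exact: (measurableT_comp mut' measurable_snd).
  by move=> p; apply: mule_ge0; [exact: next_density_ge0|exact: G0].
have F0 s : 0 <= F s.
  by apply: integral_ge0 => u _; apply: mule_ge0; [exact: next_density_ge0|exact: G0].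
transitivity (\int[P]_w F (T1 w)).
  rewrite integral_P'; first by [].
  - apply: (measurableT_comp mG); apply: measurable_fun_pair; last exact: measurable_funPT.
    exact: (measurableT_comp mT1 measurable_fst).
  - by move=> p; exact: G0.
rewrite (law_S mF F0); congr (_ * _); apply: ge0_ae_eq_integral.
- by [].
- by apply: emeasurable_funM; [exact: mF|exact: mZ].
- apply: (@measurable_fun_fubini_tonelli_F _ _ _ _ _ leb
    (fun p : n.+1.-tuple (borel X) * measurableTypeR R => G p * dens n.+1 p.1 p.2)).
    by apply: emeasurable_funM; [exact: mG|exact: mdens].
  by move=> p; apply: mule_ge0; [exact: G0|exact: d_ge0].
- by move=> s _; apply: mule_ge0; [exact: F0|exact: Z_ge0].
- by move=> s _; apply: integral_ge0 => u _; apply: mule_ge0; [exact: G0|exact: d_ge0].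
apply: filterS mass_fin1 => s sfin _.
have Gd : \int[leb]_u (G (s, u) * dens n.+1 s u) = \int[leb]_u (G (s, ut u) * dens n.+1 s u).
  apply: eq_integral => u _; rewrite /ut; case: ifPn => // u0.
  by rewrite /joint_density /powp (negbTE u0) !mul0e !mule0.
rewrite Gd -(@integral_normalize _ _ _ leb (fun u => G (s, ut u)) (fun u => dens n.+1 s u)) //.
have [z0|z0] := eqVneq (Z1 s) 0; first by rewrite z0 !mule0.
congr (_ * _); apply: eq_integral => u _.
by rewrite /next_density sfin andbT lt0e z0 Z_ge0/= muleC.
Qed.

Lemma augmented_next (c : n.-tuple (borel X) * measurableTypeR R -> \bar R) A :
  measurable_fun setT c -> (forall p, 0 <= c p) -> measurable A ->
  \int[P']_p (c (Tn (pi p), Ut p) * (\1_A (S ord_max (pi p)))%:E) =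
  ((n%:R + q)^-1)%:E * \int[P]_w (c (Tn w, U w) * next A (Tn w, U w)).
Proof.
move=> mc c0 mA.
have mA1 : measurable_fun setT (fun s : n.+1.-tuple (borel X) * measurableTypeR R =>
    (\1_A (thead s.1) : R)%:E).
  apply/measurable_EFinP; apply: (measurableT_comp (measurable_indic mA)).
  exact: (measurableT_comp (measurable_tnth ord0) measurable_fst).
have a0 (z : borel X) : 0 <= (\1_A z : R)%:E by rewrite lee_fin.
pose G (s : n.+1.-tuple (borel X) * measurableTypeR R) : \bar R :=
  c (rest s.1, s.2) * (\1_A (thead s.1))%:E.
have mG : measurable_fun setT G.
  apply: emeasurable_funM; last exact: mA1.
  apply: (measurableT_comp mc); apply: measurable_fun_pair; last exact: measurable_snd.
  exact: (measurableT_comp mrest measurable_fst).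
have G0 p : 0 <= G p by apply: mule_ge0; [exact: c0|exact: a0].
transitivity (\int[P']_p G (T1 (pi p), Ut p)).
  by apply: eq_integral => p _; rewrite /G/= revtuple_cons rest_cons.
rewrite (augmented_space_law mG G0); congr (_ * _); apply: eq_integral => w _.
by apply: (@continuation_factor c (fun s => (\1_A (thead s.1))%:E)).
Qed.

Lemma next_weight_le A p : measurable A -> next A p <= next setT p.
Proof.
case: p => t u mA; rewrite !next_weightE.
have le z : (\1_A z : R)%:E <= (\1_[set: borel X] z : R)%:E.
  by rewrite lee_fin indicT indicE; case: (z \in A).
apply: leeD.
  apply: ge0_le_integral.
  - by [].
  - by move=> z _; apply: mule_ge0; [exact: new_weight_ge0|rewrite lee_fin].
  - apply: emeasurable_funM; last by apply/measurable_EFinP; exact: measurable_indic.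
    by apply: measurable_new_weight; [exact: measurable_cst|exact: measurable_id].
  - apply: emeasurable_funM; last by apply/measurable_EFinP; exact: measurable_indic.
    by apply: measurable_new_weight; [exact: measurable_cst|exact: measurable_id].
  - by move=> z _; apply: lee_wpmul2l; [exact: new_weight_ge0|exact: le].
by apply: lee_sum => y _; apply: lee_wpmul2l; [exact: old_weight_ge0|exact: le].
Qed.


Local Notation sigmaSn' := (sigma_fam setT
  (fun (i : 'I_n) (p : Omega * measurableTypeR R) => observed (pi p) i)).

Lemma generated_base : generated sigmaSn' (fun p => Tn (pi p)).
Proof.
exact: (generated_sample (fun (i : 'I_n) (p : Omega * measurableTypeR R) => observed (pi p) i)).
Qed.

Lemma generated_extra :
  generated <<s sigmaSn' `|` g_sigma_algebra_preimage Ut >> (fun p => (Tn (pi p), Ut p)).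
Proof.
exact: (generated_sample_pair (fun (i : 'I_n) (p : Omega * measurableTypeR R) => observed (pi p) i) Ut).
Qed.

Lemma augmented_space_base A : measurable A -> distribution P' pi A = P A.
Proof.
move=> mA; have mpi : measurable (pi @^-1` A).
  by rewrite -[X in measurable X]setTI; exact: measurable_fst.
transitivity (\int[P']_p (\1_(pi @^-1` A) p)%:E).
  by rewrite integral_indic ?setIT; [|exact: measurableT|exact: mpi].
transitivity (\int[P']_p (\1_A (pi p))%:E).
  by apply: eq_integral => p _; rewrite indic_preimage.
rewrite (integral_base (H := fun w => (\1_A w)%:E)); first by rewrite integral_indic// setIT.
- by apply/measurable_EFinP; exact: measurable_indic.
- by move=> w; rewrite lee_fin.
Qed.

(** Given the first observations and the extra coordinate, the unnormalized law of the
    next observation has total mass [next setT], which is almost surely finite, and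
    vanishes together with all the weights. *)
Lemma cond_prob_next_extra A : measurable A ->
  is_cond_prob P' <<s sigmaSn' `|` g_sigma_algebra_preimage Ut >>
    ((S ord_max \o pi) @^-1` A)
    (fun p => predictive_at eta rho gamma (Ut p) (observed (pi p)) A).
Proof.
move=> mA; pose V p : \bar R := next A p / next setT p.
have VE p : predictive_at eta rho gamma (Ut p) (observed (pi p)) A = V (Tn (pi p), Ut p).
  rewrite (predictive_atE eta rho gamma (observed (pi p)) mA (extra_coordinate_gt0 p)).
  by rewrite (phi_atE _ _ _ _ (extra_coordinate_gt0 p)).
rewrite (funext VE).
have mnT : measurable_fun setT (next setT) by exact: measurable_next_weight.
have mnA : measurable_fun setT (next A) by exact: measurable_next_weight.
have mV : measurable_fun setT V.
  apply: emeasurable_funM; first exact: mnA.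
  by apply: measurable_inve_ge0; [exact: mnT|exact: next_weight_ge0].
have V0 p : 0 <= V p.
  by apply: mule_ge0; [exact: next_weight_ge0|rewrite inve_ge0; exact: next_weight_ge0].
apply: (@cond_exp_comp _ _ _ _ _ P' _ _ _ V generated_extra mV V0) => D mD.
have mD1 : measurable_fun setT
    (fun p : n.-tuple (borel X) * measurableTypeR R => (\1_D p : R)%:E).
  by apply/measurable_EFinP; exact: measurable_indic.
have D0 (p : n.-tuple (borel X) * measurableTypeR R) : 0 <= (\1_D p : R)%:E by rewrite lee_fin.
have mDV : measurable_fun setT (fun p => (\1_D p)%:E * V p) by exact: emeasurable_funM.
have DV0 p : 0 <= (\1_D p)%:E * V p by exact: mule_ge0.
transitivity (\int[P']_p ((\1_D (Tn (pi p), Ut p))%:E * V (Tn (pi p), Ut p) *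
    (\1_[set: borel X] (S ord_max (pi p)))%:E)).
  by apply: eq_integral => p _; rewrite indicT mule1.
rewrite (augmented_next mDV DV0 measurableT).
transitivity (\int[P']_p ((\1_D (Tn (pi p), Ut p))%:E * (\1_A (S ord_max (pi p)))%:E)); last first.
  by apply: eq_integral => p _; rewrite indic_preimage.
rewrite (augmented_next mD1 D0 mA); congr (_ * _).
have next_fin : {ae P, forall w, next setT (Tn w, U w) < +oo}.
  apply: ge0_finite_integral_ae.
  - exact: (measurableT_comp mnT mTU).
  - by move=> w; exact: next_weight_ge0.
  have -> : \int[P]_w next setT (Tn w, U w) =
      \int[P]_w ((\1_setT (Tn w))%:E * next setT (Tn w, U w)).
    by apply: eq_integral => w _; rewrite indicT mul1e.
  rewrite (total_law measurableT).
  have -> : \int[P]_w ((\1_setT (Tn w))%:E * (n%:R + q)%:E) = \int[P]_w (n%:R + q)%:E.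
    by apply: eq_integral => w _; rewrite indicT mul1e.
  by rewrite integral_cst// [X in _ * X](probability_setT P) mule1 ltry.
apply: ge0_ae_eq_integral.
- by [].
- by apply: emeasurable_funM; [exact: (measurableT_comp mDV mTU)|exact: (measurableT_comp mnT mTU)].
- by apply: emeasurable_funM; [exact: (measurableT_comp mD1 mTU)|exact: (measurableT_comp mnA mTU)].
- by move=> w _; apply: mule_ge0; [exact: DV0|exact: next_weight_ge0].
- by move=> w _; apply: mule_ge0; [exact: D0|exact: next_weight_ge0].
apply: filterS next_fin => w nfin _; rewrite -muleA; congr (_ * _); rewrite /V.
have le := next_weight_le (Tn w, U w) mA.
have nA0 := next_weight_ge0 eta rho gamma A (Tn w, U w).
have nT0 := next_weight_ge0 eta rho gamma setT (Tn w, U w).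
have [z|nz] := eqVneq (next setT (Tn w, U w)) 0.
  have -> : next A (Tn w, U w) = 0 by apply/eqP; rewrite eq_le nA0 andbT -z.
  by rewrite !mul0e.
by rewrite -muleA mulVe ?mule1// ge0_fin_numE.
Qed.

Lemma cond_prob_extra (e : Omega -> \bar R) B :
  is_cond_exp P sigmaSn (fun w => phi_at eta rho gamma (U w) (observed w)) e ->
  measurable B ->
  is_cond_prob P' sigmaSn' (Ut @^-1` B)
    (fun p => \int[leb]_(u in B `&` `]0%R, +oo[)
       (phi_at eta rho gamma u (observed (pi p)) / e (pi p) *
        fU eta rho gamma q (observed (pi p)) u)).
Proof.
move=> ece mB; have ecst := cond_exp_total_cst ece; have [e0 me _] := ece.
have [FT TF] := generated_observed; have [FT' TF'] := generated_base.
pose F (p : n.-tuple (borel X) * measurableTypeR R) : \bar R := (\1_B p.2)%:E * next setT p.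
have mnT : measurable_fun setT (next setT) by exact: measurable_next_weight.
have mB2 : measurable_fun setT
    (fun p : n.-tuple (borel X) * measurableTypeR R => (\1_B p.2 : R)%:E).
  by apply/measurable_EFinP; exact: (measurableT_comp (measurable_indic mB) measurable_snd).
have mF : measurable_fun setT F by apply: emeasurable_funM.
have F0 p : 0 <= F p by apply: mule_ge0; [rewrite lee_fin|exact: next_weight_ge0].
pose H (t : n.-tuple (borel X)) : \bar R := \int[leb]_u (F (t, u) * cdens t u).
have mH : measurable_fun setT H by exact: mJ.
have H0 t : 0 <= H t by exact: J0.
pose Y w : \bar R := (e w)^-1 * H (Tn w).
have einv0 w : 0 <= (e w)^-1 by rewrite inve_ge0; exact: e0.
have Y0 w : 0 <= Y w by exact: mule_ge0.
have YE p : \int[leb]_(u in B `&` `]0%R, +oo[)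
       (phi_at eta rho gamma u (observed (pi p)) / e (pi p) *
        fU eta rho gamma q (observed (pi p)) u) = Y (pi p).
  rewrite /Y /H -ge0_integralZl; first last.
  - exact: einv0.
  - by move=> u _; apply: mule_ge0; [exact: F0|exact: cond_density_ge0].
  - apply: emeasurable_funM; first exact: (measurableT_comp mF (pair1_measurable _)).
    exact: (measurableT_comp (@measurable_cond_density _ _ X_separable _ _ _ _ _ _ _ _) (pair1_measurable _)).
  - by [].
  rewrite [LHS]integral_mkcond; apply: eq_integral => u _.
  rewrite patchE in_setI mem_setE in_itv/= andbT /F indicE /=.
  case: (u \in B) => /=; last by rewrite !mul0e mule0.
  case: ifPn => u0; last by rewrite cond_density_le0// !mule0.
  rewrite mul1e (phi_atE _ _ _ _ u0) (fUE q gamma_ge0 mass_laplace_psi _ u0).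
  by rewrite [RHS]muleA; congr (_ * _); exact: muleC.
rewrite (funext YE).
(* the sigma-algebra of the sample, as a structure on the sample space *)
pose G := \bigcup_(i in [set: 'I_n]) preimage_set_system setT
  (fun w => observed w i) (@measurable _ (borel X)).
have mYG : measurable_fun [set: g_sigma_algebraType G] (Y : g_sigma_algebraType G -> \bar R).
  apply: emeasurable_funM.
    apply: (@measurable_inve_ge0 _ _ (g_sigma_algebraType G) e); last exact: e0.
    by move=> _ C mC; rewrite setTI; exact: me.
  apply: (measurableT_comp mH) => _ C mC; rewrite setTI; exact: TF.
have YF C : measurable C -> sigmaSn (Y @^-1` C).
  by move=> mC; have := mYG measurableT C mC; rewrite setTI.
have mY : measurable_fun setT Y.
  move=> _ C mC; rewrite setTI; have [D mD ->] := FT _ (YF C mC).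
  by rewrite -[X in measurable X]setTI; exact: mTn.
split.
- by move=> p; exact: Y0.
- move=> C mC; have [D mD DE] := FT _ (YF C mC).
  have -> : (fun p => Y (pi p)) @^-1` C = (fun p => Tn (pi p)) @^-1` D.
    by rewrite (comp_preimage C pi Y) DE.
  exact: TF'.
move=> _ /FT'[D mD ->]; rewrite !integral_preimage.
have mD1 : measurable_fun setT (fun w => (\1_D (Tn w) : R)%:E).
  by apply/measurable_EFinP; exact: (measurableT_comp (measurable_indic mD) mTn).
have D0 (t : n.-tuple (borel X)) : 0 <= (\1_D t : R)%:E by rewrite lee_fin.
rewrite (integral_base (H := fun w => (\1_D (Tn w))%:E * Y w)); first last.
- by move=> w; exact: mule_ge0.
- by apply: emeasurable_funM.
pose c (p : n.-tuple (borel X) * measurableTypeR R) : \bar R := (\1_D p.1)%:E * (\1_B p.2)%:E.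
have mc : measurable_fun setT c.
  apply: emeasurable_funM; last exact: mB2.
  by apply/measurable_EFinP; exact: (measurableT_comp (measurable_indic mD) measurable_fst).
have c0 p : 0 <= c p by apply: mule_ge0; rewrite lee_fin.
transitivity (\int[P']_p (c (Tn (pi p), Ut p) * (\1_[set: borel X] (S ord_max (pi p)))%:E)); last first.
  by apply: eq_integral => p _; rewrite indicT mule1 /c/= indic_preimage.
rewrite (augmented_next mc c0 measurableT).
have ninv0 : (0 <= (n%:R + q)^-1)%R by rewrite invr_ge0 ltW.
transitivity (((n%:R + q)^-1)%:E * \int[P]_w ((\1_D (Tn w))%:E * H (Tn w))); last first.
  congr (_ * _); rewrite (conditional_law mF F0 mD).
  by apply: eq_integral => w _; rewrite /F /c/= muleA.
rewrite -ge0_integralZl_EFin; first last.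
- exact: ninv0.
- by apply: emeasurable_funM; [exact: mD1|exact: (measurableT_comp mH mTn)].
- by move=> w _; exact: mule_ge0.
- by [].
apply: ge0_ae_eq_integral.
- by [].
- by apply: emeasurable_funM.
- apply: measurable_funeM; apply: emeasurable_funM; first exact: mD1.
  exact: (measurableT_comp mH mTn).
- by move=> w _; exact: mule_ge0.
- by move=> w _; apply: mule_ge0; [rewrite lee_fin|exact: mule_ge0].
apply: filterS ecst => w ew _; rewrite /Y ew inver gt_eqF// muleCA.
by [].
Qed.

End prediction.

(** * The predictive distributions *)

Theorem proposition3p1 (R : realType) (X : completeMetricType R)
  (X_separable : separable X)
  (eta : probability (borel X) R)
  (rho : R.-sigmafker (borel X) ~> measurableTypeR R)
  (nu : {measure set (borel X * measurableTypeR R) -> \bar R})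
  (nu_intensity : is_intensity eta rho nu)
  (d0 : measure_display) (Omega0 : measurableType d0)
  (P0 : probability Omega0 R)
  (mu : {mfun Omega0 >-> bfmeasures X})
  (mu_crm : is_crm P0 mu nu)
  (mu_total : {ae P0, forall w, 0 < (mu w : bfmeasure X) setT < +oo})
  (q gamma : R) (q_ge0 : (0 <= q)%R) (gamma_ge0 : (0 <= gamma)%R)
  (h : R -> R) (hE : forall x : R, h x = (expR (- (gamma * x)) * x `^ (- q))%R)
  (h_fin : \int[P0]_w (h (total_mass (mu w)))%:E < +oo)
  (d : measure_display) (Omega : measurableType d) (P : probability Omega R)
  (mut : {mfun Omega >-> bfmeasures X})
  (mut_tilted : is_tilted P0 mu h P mut)
  (n : nat) (n_ge1 : (1 <= n)%N)
  (S : 'I_n.+1 -> {mfun Omega >-> borel X})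
  (S_iid : is_iid_normalized P mut (fun i => S i : Omega -> borel X))
  (U : {mfun Omega >-> measurableTypeR R}) :
  let Sn (w : Omega) : 'I_n -> borel X := fun i => S (widen_ord (leqnSn n) i) w in
  let sigmaSn := sigma_fam setT (fun (i : 'I_n) (w : Omega) => Sn w i) in
  is_augmenting P mut q (fun i w => Sn w i) U ->
  [/\ (forall A : set (borel X), measurable A ->
        is_cond_prob P sigmaSn (S ord_max @^-1` A)
          (fun w => predictive eta rho gamma q (Sn w) A)),
      (forall e : Omega -> \bar R,
        is_cond_exp P sigmaSn (fun w => phi_at eta rho gamma (U w) (Sn w)) e ->
        exists (d' : measure_display) (Omega' : measurableType d')
               (P' : probability Omega' R) (pi : {mfun Omega' >-> Omega})
               (Ut : {mfun Omega' >-> measurableTypeR R}),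
        let Sn' (w : Omega') := Sn (pi w) in
        let sigmaSn' := sigma_fam setT (fun (i : 'I_n) (w : Omega') => Sn' w i) in
        let sigmaSnUt := <<s sigmaSn' `|` g_sigma_algebra_preimage Ut >> in
        [/\ forall A : set Omega, measurable A -> distribution P' pi A = P A,
            forall w, (0 < (Ut w : R))%R,
            forall B : set (measurableTypeR R), measurable B ->
              is_cond_prob P' sigmaSn' (Ut @^-1` B)
                (fun w => \int[lebesgue_measure]_(u in B `&` `]0%R, +oo[)
                   (phi_at eta rho gamma u (Sn' w) / e (pi w) *
                    fU eta rho gamma q (Sn' w) u)) &
            forall A : set (borel X), measurable A ->
              is_cond_prob P' sigmaSnUt ((S ord_max \o pi) @^-1` A)
                (fun w => predictive_at eta rho gamma (Ut w) (Sn' w) A)]) &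
      [/\ is_cond_exp P sigmaSn (fun w => phi_at eta rho gamma (U w) (Sn w))
            (fun w => phi eta rho gamma q (Sn w)),
          {ae P, forall w, phi eta rho gamma q (Sn w) = (n%:R + q)%:E},
          forall z : borel X,
            is_cond_exp P sigmaSn (fun w => omega_new_at rho gamma (U w) z)
              (fun w => omega_new eta rho gamma q (Sn w) z) &
          forall k : nat,
            is_cond_exp P sigmaSn
              (fun w => if (k < ncells (Sn w))%N
                        then omega_cell_at rho gamma (U w) (Sn w) k else 0)
              (fun w => if (k < ncells (Sn w))%N
                        then omega_cell eta rho gamma q (Sn w) k else 0)]].
Proof.
move=> Sn sigmaSn aug.
have eta_diffuse z : eta [set z] = 0.
  by case: nu_intensity => na _ _ _ _; exact: nonatomic_set1.
have psiE := @mass_laplace_psi _ _ _ _ _ nu_intensity _ _ _ _ mu_crm.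
have shape_gt0 : (0 < n%:R + q)%R by rewrite ltr_wpDr// ltr0n.
have kn_gt0 := kappa_gt0 q_ge0 hE h_fin mut_tilted n_ge1.
have k1E := kappaS P0 mu q_ge0 h n_ge1.
have law_U (F : n.-tuple (borel X) * measurableTypeR R -> \bar R) := @law_augmented
  R X X_separable eta rho nu nu_intensity d0 Omega0 P0 mu mu_crm mu_total q gamma q_ge0
  gamma_ge0 h hE h_fin d Omega P mut mut_tilted n n_ge1 (first_values S) U F aug.
have law_S (F : n.+1.-tuple (borel X) -> \bar R) := @law_sample
  R X X_separable eta rho nu nu_intensity d0 Omega0 P0 mu mu_crm mu_total q gamma q_ge0
  gamma_ge0 h hE h_fin d Omega P mut mut_tilted n.+1 (ltn0Sn n) S F S_iid.
have U_gt0 := proj1 aug.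
split.
- move=> A mA.
  exact: (cond_prob_next eta_diffuse shape_gt0 kn_gt0 k1E law_U law_S gamma_ge0 psiE U_gt0 mA).
- move=> e ece.
  exists _, (Omega * measurableTypeR R)%type, (augmented_space X_separable rho P0 mu gamma q P S),
    (@base_point _ Omega R), (@extra_coordinate _ Omega R) => Sn' sigmaSn' sigmaSnUt; split.
  + by move=> A; exact: augmented_space_base.
  + exact: extra_coordinate_gt0.
  + move=> B mB.
    exact: (cond_prob_extra eta_diffuse shape_gt0 kn_gt0 k1E law_U law_S gamma_ge0 psiE U_gt0 ece mB).
  + move=> A mA.
    exact: (cond_prob_next_extra eta_diffuse shape_gt0 kn_gt0 k1E law_U law_S mA).
- split.
  + exact: (cond_exp_phi kn_gt0 law_U gamma_ge0 psiE U_gt0).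
  + exact: (phi_total eta_diffuse shape_gt0 kn_gt0 k1E law_U law_S gamma_ge0 psiE U_gt0).
  + by move=> z; exact: (cond_exp_new kn_gt0 law_U gamma_ge0 psiE U_gt0).
  + by move=> k; exact: (cond_exp_cell kn_gt0 law_U gamma_ge0 psiE U_gt0).
Qed.
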